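(* Let $-A$ be the generator of a bounded $C_0$-semigroup $(T(s))_{s\ge0}$ on a Banach space $X$, and suppose $A$ is injective. (a) For each $x\in\operatorname{dom}(\log A)$, $\|\mathcal C_t(A)x\|=O\big(1/\log t\big)$ as $t\to\infty$. (b) If $\operatorname{ran}(A)$ is dense in $X$, then for each $x\in\operatorname{dom}(\log A)$, $\|\mathcal C_t(A)x\|=o\big(1/\log t\big)$ as $t\to\infty$. (c) If $0$ is an accumulation point of $\sigma(A)$, then for any decreasing function $\epsilon:(0,\infty)\to(0,\infty)$ with $\lim_{t\to\infty}\epsilon(t)=0$ there exists $y\in\operatorname{dom}(\log A)$ such that $\sup_{t\ge1}\frac{\log t\,\|\mathcal C_t(A)y\|}{\epsilon(t)}=\infty$.
   Context: $\log z$ denotes the principal branch. For injective $A$, the operator $\log A$ is defined in the extended Hille–Phillips calculus with regularizer $e(z)=z(1+z)^{-2}$: for Laplace transforms $\hat\nu(z)=\int_{[0,\infty)}e^{-sz}\nu(\mathrm ds)$ of bounded complex measures, $\hat\nu(A)x=\int T(s)x\,\nu(\mathrm ds)$; both $e$ and $e\log$ are such Laplace transforms, $e(A)=A(1+A)^{-2}$ is injective, and $\log A:=e(A)^{-1}(e\log)(A)$ with domain $\{x:(e\log)(A)x\in\operatorname{ran}e(A)\}$ (this agrees with the logarithm from the sectorial functional calculus). Cesàro means: $\mathcal C_t(A)x=\frac1t\int_0^tT(s)x\,\mathrm ds$. *)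

(* Defs.v *)
From HB Require Import structures.
From mathcomp Require Import all_boot all_order all_algebra.
From mathcomp Require Import all_classical all_reals all_analysis.
From mathcomp Require Import complex.
Import Order.TTheory GRing.Theory Num.Theory numFieldNormedType.Exports.

Set Implicit Arguments.
Unset Strict Implicit.
Unset Printing Implicit Defensive.

Local Open Scope ring_scope.
Local Open Scope complex_scope.
Local Open Scope classical_set_scope.

Section Defs.
Variable R : realType.
Variable X : completeNormedModType R[i].

(** Bounded C_0-semigroup (T(s))_{s>=0} of bounded operators on X.
    Values of T at negative times are irrelevant. *)
Definition bounded_C0_semigroup (T : R -> X -> X) : Prop :=
  [/\ (forall s (a : R[i]) (u v : X), T s (a *: u + v) = a *: T s u + T s v),
      (forall x, T 0 x = x),
      (forall s t, 0 <= s -> 0 <= t -> forall x, T (s + t) x = T s (T t x)),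
      (forall x, (fun s => T s x) @ 0^'+ --> x) &
      (exists M : R, forall s, 0 <= s -> forall x, `|T s x| <= M%:C * `|x|)].

(** [gen T x y] : x \in dom(A) and A x = y, where -A generates T,
    i.e.  A x = lim_{t -> 0+} (x - T(t)x)/t. *)
Definition gen (T : R -> X -> X) (x y : X) : Prop :=
  (fun t : R => (t^-1)%:C *: (x - T t x)) @ 0^'+ --> y.

Definition gen_injective (T : R -> X -> X) : Prop :=
  forall x1 x2 y, gen T x1 y -> gen T x2 y -> x1 = x2.

Definition gen_range (T : R -> X -> X) : set X := [set y | exists x, gen T x y].

Definition in_resolvent (T : R -> X -> X) (lam : R[i]) : Prop :=
  (forall y, exists x u, gen T x u /\ lam *: x - u = y) /\
  (exists M : R, forall x u, gen T x u -> `|x| <= M%:C * `|lam *: x - u|).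

Definition spectrum (T : R -> X -> X) : set R[i] := [set lam | ~ in_resolvent T lam].

Definition zero_limit_point_spectrum (T : R -> X -> X) : Prop :=
  forall d : R, 0 < d -> exists lam, spectrum T lam /\ lam != 0 /\ `|lam| < d%:C.

(** Cesaro mean  C_t(A)x = (1/t) \int_0^t T(s)x ds, the integral being the
    limit of the (left, uniform) Riemann sums (which converge since
    s |-> T(s)x is continuous). *)
Definition cesaro_mean (T : R -> X -> X) (t : R) (x : X) : X :=
  lim ((fun n : nat => (n%:R^-1)%:C *: \sum_(k < n) T (k%:R * t / n%:R) x) @ \oo).

Definition cint (mu : {measure set R -> \bar R}) (D : set R) (g : R -> R[i]) : R[i] :=
  (Rintegral mu D (fun s => complex.Re (g s)))%:C + 'i * (Rintegral mu D (fun s => complex.Im (g s)))%:C.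

(** X-valued integral, tested against all bounded linear functionals phi
    (weak/Pettis form, which coincides with the Bochner
    integral whenever the latter exists): y = \int_D f dmu *)
Definition wint (mu : {measure set R -> \bar R}) (D : set R) (f : R -> X) (y : X) : Prop :=
  forall phi : X -> R[i],
    (forall (a : R[i]) u v, phi (a *: u + v) = a * phi u + phi v) ->
    (exists C : R, forall u, `|phi u| <= C%:C * `|u|) ->
    phi y = cint mu D (fun s => phi (f s)).

Definition cexp (z : R[i]) : R[i] := (expR (complex.Re z))%:C * (cos (complex.Im z) +i* sin (complex.Im z)).

(** principal logarithm, on the open right half-plane (the only place used) *)
Definition clog (z : R[i]) : R[i] := (ln (Normc.normc z))%:C + 'i * (atan (complex.Im z / complex.Re z))%:C.

Definition ereg (z : R[i]) : R[i] := z / (1 + z) ^+ 2.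
Definition elog (z : R[i]) : R[i] := ereg z * clog z.

(** Hille--Phillips calculus: [hp T f x y] means f = \hat nu on the open right
    half-plane for a bounded complex measure nu on [0,oo) and
    y = \int_{[0,oo)} T(s)x nu(ds).  A bounded complex measure on [0,oo) is
    represented as nu(ds) = h(s) mu(ds) with mu a finite positive measure and
    h = hr + i hi bounded measurable (every bounded complex measure has this
    form, e.g. mu = |nu|, and conversely). *)
Definition hp (T : R -> X -> X) (f : R[i] -> R[i]) (x y : X) : Prop :=
  exists (mu : {finite_measure set R -> \bar R}) (hr hi : R -> R),
    [/\ measurable_fun setT hr, measurable_fun setT hi,
        (exists M : R, forall s, `|hr s| <= M /\ `|hi s| <= M),
        (forall z : R[i], 0 < complex.Re z ->
           cint mu `[0, +oo[ (fun s => cexp (- (s%:C) * z) * (hr s +i* hi s)) = f z) &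
        wint mu `[0, +oo[ (fun s => (hr s +i* hi s) *: T s x) y].

Definition dom_log (T : R -> X -> X) : set X :=
  [set x | exists w, hp T elog x w /\ exists u, hp T ereg u w].

End Defs.

(* Main.v *)
(* Let E be a standard exponential variable and U an independent uniform one on
   [0, 1]. The laws of E, of U E and of E / U have Laplace transforms
     e(z) = 1/(1+z),  q(z) = log(1+z)/z,  n(z) = 1 - z(log(1+z) - log z),
   and ereg = e - e^2, elog = (1-e)^2 q - e^2 (1-n). Laplace transforms being
   injective, x is in the domain of log A with (e log)(A) x = e(A) u iff
     (1 - N) y = - (1 - J) b,   y = J^2 x,   b = J u - (1 - J) Q x,
   where J = (1+A)^-1 and N, Q are the operators attached to n and q.
   (a), (b) With J_u = (1 + A/u)^-1, N y is the integral of J_u y over [0, 1], and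
   the resolvent identity turns the equation above into
     \int_a^1 J_u y du/u + J b = ln(1/a) J_a y + (remainder),
   the remainder being bounded, and small as a -> 0 when ran A is dense.
   Differentiating in a, J_a y converges at rate 1/ln(1/a); its limit is fixed by J,
   hence lies in ker A = 0. The Cesaro mean at time t is controlled by J_{1/t}.
   (c) Near a spectral point close to 0 there are approximate eigenvectors v for
   some mu with Re mu > 0; then (e(A) v, (e log)(A) v) is a pair in the graph of
   log A for which the bound of (a) is sharp at time t ~ 1/|mu|. A gliding hump
   along such pairs yields y. *)

Require Import Defs.
From HB Require Import structures.
From mathcomp Require Import all_boot all_order all_algebra.
From mathcomp Require Import all_classical all_reals all_analysis.
From mathcomp Require Import measurable_realfun complex ring lra.
Import Order.TTheory GRing.Theory Num.Theory numFieldNormedType.Exports.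
Set Implicit Arguments.
Unset Strict Implicit.
Unset Printing Implicit Defensive.
Local Open Scope ring_scope.
Local Open Scope complex_scope.
Local Open Scope classical_set_scope.

(** * Bounded functions on finite measures *)

(** No vector-valued integral is constructed. A law P acts on x through the vector [op P x], whose
    image under each bounded real-linear functional psi is the P-expectation of psi (T s x);
    Hahn-Banach turns vector statements into scalar ones, uniform over the unit ball of the dual.
    Operator identities are checked on the exponentials exp(-js), j >= 1, and injectivity of the
    Laplace transform carries them over to orbits. The same injectivity shows that the calculus does
    not depend on the measure representing e or e log. The equation (1 - N) y = - (1 - J) b contains
    no logarithm. One appears on applying J_a, because J_a (1 - J_u) = (a/u) J_u (1 - J_a): the part
    u > a of the integral over [0, 1] then carries the weight du/u. Differentiating in a only
    compares J_a y at two points, so it gives a rate towards some limit; that the limit is 0 has to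
    come from the injectivity of A. In (c) the bound of (a) is needed with a constant linear in the
    graph norm of log A, since it must control the tail of the gliding hump. *)

Section FiniteMeasureIntegrals.
Context {R : realType} {d : measure_display} {Y : measurableType d}.
Variables (mu : {finite_measure set Y -> \bar R}) (D : set Y).
Hypothesis mD : measurable D.
Implicit Types f g : Y -> R.

Definition bmeas f := measurable_fun D f /\ exists K, forall y, D y -> `|f y| <= K.

Lemma bmeas_cst c : bmeas (fun=> c).
Proof. by split; [exact: measurable_cst|exists `|c|]. Qed.

Lemma bmeasD f g : bmeas f -> bmeas g -> bmeas (fun y => f y + g y).
Proof.
move=> [mf [K hK]] [mg [L hL]]; split; first exact: measurable_funD.
by exists (K + L) => y Dy; rewrite (le_trans (ler_normD _ _))// lerD ?hK ?hL.
Qed.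

Lemma bmeasM f g : bmeas f -> bmeas g -> bmeas (fun y => f y * g y).
Proof.
move=> [mf [K hK]] [mg [L hL]]; split; first exact: measurable_funM.
by exists (K * L) => y Dy; rewrite normrM ler_pM ?hK ?hL.
Qed.

Lemma bmeasZ c f : bmeas f -> bmeas (fun y => c * f y).
Proof. by apply: bmeasM; exact: bmeas_cst. Qed.

Lemma bmeasB f g : bmeas f -> bmeas g -> bmeas (fun y => f y - g y).
Proof.
move=> hf hg; have := bmeasD hf (bmeasZ (-1) hg).
by congr bmeas; apply/funext => y; rewrite mulN1r.
Qed.

Lemma bmeas_integrable f : bmeas f -> mu.-integrable D (EFin \o f).
Proof.
move=> [mf [K hK]]; apply: measurable_bounded_integrable => //.
  by rewrite -ge0_fin_numE ?measure_ge0// fin_num_measure.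
by exists K; split; [exact: num_real|move=> x Kx y /hK h; exact: le_trans h (ltW Kx)].
Qed.

Lemma bintD f g : bmeas f -> bmeas g ->
  \int[mu]_(y in D) (f y + g y) = \int[mu]_(y in D) f y + \int[mu]_(y in D) g y.
Proof. by move=> hf hg; rewrite RintegralD//; exact: bmeas_integrable. Qed.

Lemma bintB f g : bmeas f -> bmeas g ->
  \int[mu]_(y in D) (f y - g y) = \int[mu]_(y in D) f y - \int[mu]_(y in D) g y.
Proof. by move=> hf hg; rewrite RintegralB//; exact: bmeas_integrable. Qed.

Lemma bintZ c f : bmeas f ->
  \int[mu]_(y in D) (c * f y) = c * \int[mu]_(y in D) f y.
Proof. by move=> hf; rewrite RintegralZl//; exact: bmeas_integrable. Qed.

Lemma bint_sum n (f : 'I_n -> Y -> R) : (forall i, bmeas (f i)) ->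
  bmeas (fun y => \sum_(i < n) f i y) /\
  \int[mu]_(y in D) (\sum_(i < n) f i y) = \sum_(i < n) \int[mu]_(y in D) f i y.
Proof.
elim: n f => [|n IH] f hf.
  have e : (fun y => \sum_(i < 0) f i y) = fun=> 0.
    by apply/funext => y; rewrite big_ord0.
  rewrite e big_ord0; split; first exact: bmeas_cst.
  by rewrite Rintegral_cst// mul0r.
have [h1 h2] := IH (fun i => f (lift ord0 i)) (fun i => hf _).
have e : (fun y => \sum_(i < n.+1) f i y) =
    fun y => f ord0 y + \sum_(i < n) f (lift ord0 i) y.
  by apply/funext => y; rewrite big_ord_recl.
by rewrite e big_ord_recl -h2 bintD//; split=> //; exact: bmeasD.
Qed.

Lemma bint_le f g : bmeas f -> bmeas g -> (forall y, D y -> f y <= g y) ->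
  \int[mu]_(y in D) f y <= \int[mu]_(y in D) g y.
Proof. by move=> hf hg h; apply: le_Rintegral => //; exact: bmeas_integrable. Qed.

Lemma bint_norm f : bmeas f ->
  `|\int[mu]_(y in D) f y| <= \int[mu]_(y in D) `|f y|.
Proof. by move=> hf; apply: le_normr_Rintegral => //; exact: bmeas_integrable. Qed.

Lemma bmeas_norm f : bmeas f -> bmeas (fun y => `|f y|).
Proof.
move=> [mf [K hK]]; split; first exact: measurableT_comp.
by exists K => y Dy; rewrite normr_id hK.
Qed.

Lemma bint_bound f K : measurable_fun D f -> (forall y, D y -> `|f y| <= K) ->
  `|\int[mu]_(y in D) f y| <= K * fine (mu D).
Proof.
move=> mf fK; have bf : bmeas f by split=> //; exists K.
rewrite (le_trans (bint_norm bf))// -Rintegral_cst//.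
by apply: bint_le => //; [exact: bmeas_norm|exact: bmeas_cst].
Qed.

Lemma bint_dct (f_ : nat -> Y -> R) f K : (forall n, measurable_fun D (f_ n)) ->
  measurable_fun D f -> (forall n y, D y -> `|f_ n y| <= K) ->
  (forall y, D y -> f_ ^~ y @ \oo --> f y) ->
  (fun n => \int[mu]_(y in D) f_ n y) @ \oo --> \int[mu]_(y in D) f y.
Proof.
move=> mf_ mf hK hc.
have := @dominated_convergence _ _ _ mu D mD
  (fun n => EFin \o f_ n) (EFin \o f) (cst K%:E).
case.
- by move=> n; apply/measurable_EFinP.
- exact/measurable_EFinP.
- by apply: aeW => y Dy; apply: cvg_EFin; [exact: nearW|exact: hc].
- exact: bmeas_integrable (bmeas_cst K).
- by apply: aeW => y n Dy; rewrite /= lee_fin hK.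
move=> fi _ h3.
have Ef : (\int[mu]_(y in D) (EFin \o f) y)%E = (\int[mu]_(y in D) f y)%:E.
  by rewrite /Rintegral fineK// integrable_fin_num.
by move: h3; rewrite Ef => /fine_cvgP[].
Qed.

Lemma bmeasS f : measurable_fun setT f -> (exists K, forall y, `|f y| <= K) -> bmeas f.
Proof. by move=> mf [K fK]; split; [exact: measurable_funTS|exists K => y _]. Qed.

End FiniteMeasureIntegrals.

Lemma eq_Rintegral_ge0 {R : realType} (mu : {measure set R -> \bar R}) (f g : R -> R) :
  (forall s, 0 <= s -> f s = g s) ->
  \int[mu]_(s in `[0, +oo[) f s = \int[mu]_(s in `[0, +oo[) g s.
Proof. by move=> fg; apply: eq_Rintegral => s; rewrite inE /= in_itv /= andbT; exact: fg. Qed.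

(** * Injectivity of the Laplace transform *)

Section LaplaceUniqueness.
Context {R : realType}.
Implicit Types (F : R -> R) (L : (R -> R) -> R) (p s : R).

(* Functions on [0, +oo) are extended to R by their value at 0, so that
   continuity and measurability can be stated globally. *)
Definition bcont F :=
  [/\ continuous F, exists K, forall s, `|F s| <= K & forall s, F (Num.max s 0) = F s].

Definition ex (j : nat) s : R := expR (- (j%:R * Num.max s 0)).

Lemma maxr0_ge0 s : 0 <= Num.max s 0.
Proof. by rewrite le_max lexx orbT. Qed.

Lemma maxr0_id s : 0 <= s -> Num.max s 0 = s.
Proof. exact: max_l. Qed.

Lemma continuous_maxr0 : continuous (fun s : R => Num.max s 0).
Proof.
move=> s; apply: (@continuous_max _ _ (fun s => s) (fun=> 0)); first exact: cvg_id.
exact: cvg_cst.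
Qed.

Lemma continuous_ex j : continuous (ex j).
Proof.
move=> s; apply: continuous_comp; last exact: continuous_expR.
by apply: continuousN; apply: cvgMr; exact: continuous_maxr0.
Qed.

Lemma ex_itv j s : 0 < ex j s <= 1.
Proof. by rewrite expR_gt0 -[leRHS]expR0 ler_expR oppr_le0 mulr_ge0 ?maxr0_ge0. Qed.

Lemma norm_ex_le1 j s : `|ex j s| <= 1.
Proof. by have /andP[h1 h2] := ex_itv j s; rewrite ger0_norm// ltW. Qed.

Lemma exX j s : ex 1 s ^+ j = ex j s.
Proof. by rewrite /ex -expRM_natl mulrN mulrA mulr1 -mulrN. Qed.

Lemma exD j s r : ex j (Num.max s 0 + Num.max r 0) = ex j s * ex j r.
Proof.
by rewrite /ex -expRD [Num.max (_ + _) _]maxr0_id ?addr_ge0 ?maxr0_ge0// mulrDr opprD.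
Qed.

Lemma bcont_ex j : bcont (ex j).
Proof.
split; first exact: continuous_ex.
  by exists 1 => s; exact: norm_ex_le1.
by move=> s; rewrite /ex [Num.max (Num.max _ _) _]maxr0_id ?maxr0_ge0.
Qed.

(** Bernstein polynomial of order n, defined by conditioning on the first trial, so that the facts
    below are inductions on n without binomial coefficients. *)
Fixpoint bern_poly n (g : nat -> R) : {poly R} :=
  if n is n'.+1 then 'X * bern_poly n' (g \o S) + (1 - 'X) * bern_poly n' g
  else (g 0%N)%:P.

(* Expectation of g under the binomial law B(n, p). *)
Fixpoint bern p n (g : nat -> R) : R :=
  if n is n'.+1 then p * bern p n' (g \o S) + (1 - p) * bern p n' g else g 0%N.

Lemma bern_polyE p n g : (bern_poly n g).[p] = bern p n g.
Proof. by elim: n g => [|n IH] g /=; rewrite ?hornerE// !IH. Qed.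

Lemma bern_poly_coef0 n g : (bern_poly n g)`_0 = g 0%N.
Proof.
elim: n g => [|n IH] g /=; first by rewrite coefC.
by rewrite coefD !coef0M coefX mul0r add0r IH coefB coef1 coefX subr0 mul1r.
Qed.

Lemma bernD p n g h : bern p n (fun k => g k + h k) = bern p n g + bern p n h.
Proof.
elim: n g h => [|n IH] g h //=.
rewrite (IH g h) (IH (g \o S) (h \o S)); ring.
Qed.

Lemma bernZ p n c g : bern p n (fun k => c * g k) = c * bern p n g.
Proof.
elim: n g => [|n IH] g //=.
rewrite (IH g) (IH (g \o S)); ring.
Qed.

Lemma bern_cst p n c : bern p n (fun=> c) = c.
Proof. elim: n => [|n IH] //=; rewrite /comp IH; ring. Qed.

Lemma bern_le p n g h : 0 <= p <= 1 -> (forall k, g k <= h k) ->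
  bern p n g <= bern p n h.
Proof.
move=> /andP[p0 p1]; elim: n g h => [|n IH] g h gh //=.
by rewrite lerD// ler_wpM2l ?subr_ge0// IH// => k /=.
Qed.

(** Variance plus squared bias. The centre c is left free because a success in the first trial
    shifts it by 1 in the induction. *)
Lemma bern_variance p n c :
  bern p n (fun k => (k%:R - c) ^+ 2) = n%:R * p * (1 - p) + (n%:R * p - c) ^+ 2.
Proof.
elim: n c => [|n IH] c /=; first by ring.
rewrite IH (_ : _ \o S = fun k => (k%:R - (c - 1)) ^+ 2); last first.
  by apply/funext => k /=; rewrite -natr1; ring.
rewrite IH -natr1; ring.
Qed.

(** Bernstein's argument by Chebyshev, at a single point: continuity is asked for at p only, because
    [log_pull F] may jump at 0. *)
Lemma bern_cvg (f : R -> R) p K : 0 < p <= 1 -> f 0 = 0 ->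
    (forall x, `|f x| <= K) -> {for p, continuous f} ->
  (fun n => bern p n (fun k => f (k%:R / n%:R))) @ \oo --> f p.
Proof.
move=> /andP[p0 p1] f0 fK cf; apply/cvgrPdist_le => e e0.
have e20 : 0 < e / 2 by rewrite divr_gt0.
have [dl /= dl0 hdl] := (cvgrPdist_le _ _).1 cf _ e20.
have K0 : 0 <= K by rewrite (le_trans _ (fK 0)).
(* At distance at least [dl] from p the trivial bound 2 K is below c (x - p)^2, so one quadratic
   majorant serves for all x. *)
pose c := 2 * K / dl ^+ 2.
have c0 : 0 <= c by apply: divr_ge0; [exact: mulr_ge0|exact: sqr_ge0].
have pt x : `|f x - f p| <= e / 2 + c * (x - p) ^+ 2.
  have [h|h] := ltP `|p - x| dl.
    rewrite distrC (le_trans (hdl _ h))// lerDl.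
    by apply: mulr_ge0 => //; exact: sqr_ge0.
  have := fK x; have := fK p; have := ler_normB (f x) (f p).
  suff : 2 * K <= c * (x - p) ^+ 2 by lra.
  rewrite /c mulrAC ler_pdivlMr ?exprn_gt0// ler_wpM2l ?mulr_ge0//.
  by rewrite -(real_normK (num_real (x - p))) distrC lerXn2r ?nnegrE// ltW.
near=> n.
have n0 : (0 < n)%N by near: n; exists 1%N.
have nR : 0 < n%:R :> R by rewrite ltr0n.
set g := fun k => f (k%:R / n%:R).
have p01 : 0 <= p <= 1 by rewrite ltW.
have hb : bern p n (fun k => e / 2 + c * (k%:R / n%:R - p) ^+ 2) <= e.
  rewrite bernD bern_cst (_ : (fun k => _) = fun k =>
      (c / n%:R ^+ 2) * (k%:R - n%:R * p) ^+ 2); last first.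
    by apply/funext => k; field; rewrite gt_eqF.
  rewrite bernZ bern_variance subrr expr0n addr0.
  have -> : c / n%:R ^+ 2 * (n%:R * p * (1 - p)) = c * (p * (1 - p)) / n%:R.
    by field; rewrite gt_eqF.
  have : c * (p * (1 - p)) / n%:R <= e / 2.
    rewrite ler_pdivrMr// -ler_pdivrMl//.
    near: n; exact: nbhs_infty_ger.
  by lra.
set r := fun k : nat => e / 2 + c * (k%:R / n%:R - p) ^+ 2 in hb.
have h1 : bern p n g <= f p + bern p n r.
  rewrite -(bern_cst p n (f p)) -bernD; apply: bern_le => // k.
  by have := pt (k%:R / n%:R); rewrite ler_norml => /andP[_]; rewrite /g /r; lra.
have h2 : f p <= bern p n g + bern p n r.
  rewrite -[leLHS](bern_cst p n (f p)) -bernD; apply: bern_le => // k.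
  by have := pt (k%:R / n%:R); rewrite ler_norml => /andP[+ _]; rewrite /g /r; lra.
by rewrite ler_norml; apply/andP; split; lra.
Unshelve. all: by end_near. Qed.

Definition log_pull F (x : R) : R := if x <= 0 then 0 else F (- ln x).

Definition bern_log n F := bern_poly n (fun k => log_pull F (k%:R / n%:R)).

(* A functional is "good" when it is the limit of its values on the Bernstein
   polynomials of F in the variable exp(-s); such a functional is determined
   by its values on the exponentials exp(-js), j >= 1. *)
Definition good L := forall F, bcont F ->
  (fun n => \sum_(j < size (bern_log n F)) (bern_log n F)`_j * L (ex j)) @ \oo --> L F.

Lemma good_eq0 L F : good L -> bcont F -> (forall j, L (ex j.+1) = 0) -> L F = 0.
Proof.
move=> gL hF L0; have := gL F hF.
rewrite (_ : (fun n => _) = fun=> 0) => [h|]; last first.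
  apply/funext => n; apply: big1 => -[[|j] hj] _ /=; last by rewrite L0 mulr0.
  by rewrite /bern_log bern_poly_coef0 mul0r /log_pull lexx mul0r.
by rewrite -(cvg_lim _ h)// lim_cst.
Qed.

Lemma good_comb a L1 L2 : good L1 -> good L2 -> good (fun F => L1 F + a * L2 F).
Proof.
move=> g1 g2 F hF.
pose c L n := \sum_(j < size (bern_log n F)) (bern_log n F)`_j * L (ex j).
have h : (fun n => c L1 n + a * c L2 n) @ \oo --> L1 F + a * L2 F.
  by apply: cvgD; [exact: g1|apply: cvgM; [exact: cvg_cst|exact: g2]].
rewrite (_ : (fun n => _) = fun n => c L1 n + a * c L2 n)//.
apply/funext => n; rewrite /c mulr_sumr -big_split /=.
by apply: eq_bigr => j _; ring.
Qed.

(** Dominated convergence: a Bernstein polynomial averages values of [log_pull F], hence keeps the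
    bound of F, and it converges at exp(-tau y), a point of ]0, 1]. The map [tau] allows for shifted
    orbits, the weight [h] for signed densities. *)
Lemma good_measure {d} {Y : measurableType d} (mu : {finite_measure set Y -> \bar R})
    (D : set Y) (tau h : Y -> R) : measurable D -> measurable_fun D tau ->
  bmeas D h -> good (fun F => \int[mu]_(y in D) (F (tau y) * h y)).
Proof.
move=> mD mtau bh F hF.
have [cF [K FK] F0] := hF; have [mh [H hH]] := bh.
have mF : measurable_fun D (F \o tau).
  by apply: measurableT_comp => //; exact: continuous_measurable_fun.
have bex j : bmeas D (fun y => ex j (tau y)).
  split; first by apply: measurableT_comp => //;
    apply: continuous_measurable_fun; exact: continuous_ex.
  by exists 1 => y _; exact: norm_ex_le1.
pose p n := bern_log n F.
have E n y : \sum_(j < size (p n)) (p n)`_j * (ex j (tau y) * h y) =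
    (p n).[ex 1 (tau y)] * h y.
  rewrite horner_coef mulr_suml; apply: eq_bigr => j _.
  by rewrite -exX mulrA.
rewrite (_ : (fun n => _) = fun n => \int[mu]_(y in D) ((p n).[ex 1 (tau y)] * h y));
  last first.
  apply/funext => n; have [_ h2] := @bint_sum _ _ _ mu D mD (size (p n))
    (fun j y => (p n)`_j * (ex j (tau y) * h y)) (fun j => bmeasZ _ (bmeasM (bex j) bh)).
  rewrite -(eq_Rintegral _ (fun y _ => E n y)) h2; apply: eq_bigr => j _.
  by rewrite bintZ//; exact: bmeasM.
have bp n s : `|(p n).[ex 1 s]| <= K.
  rewrite bern_polyE; have /andP[e0 e1] := ex_itv 1 s.
  have lK x : `|log_pull F x| <= K.
    by rewrite /log_pull; case: ifP => // _; rewrite normr0 (le_trans _ (FK 0)).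
  rewrite ler_norml -{1}(bern_cst (ex 1 s) n (- K)) -{2}(bern_cst (ex 1 s) n K).
  by apply/andP; split; apply: bern_le; rewrite ?(ltW e0)// => k;
    have := lK (k%:R / n%:R); rewrite ler_norml => /andP[].
apply: (@bint_dct _ _ _ mu D mD _ _ (K * H)).
- move=> n; apply: measurable_funM => //.
  apply: (@measurableT_comp _ _ _ _ _ _ (fun s => (p n).[s])).
    by apply: continuous_measurable_fun; exact: continuous_horner.
  by have [] := bex 1%N.
- exact: measurable_funM.
- by move=> n y Dy; rewrite normrM ler_pM ?bp ?hH.
move=> y Dy; apply: cvgMr_tmp.
rewrite (_ : (fun n => _) = fun n => bern (ex 1 (tau y)) n
    (fun k => log_pull F (k%:R / n%:R))); last first.
  by apply/funext => n; rewrite bern_polyE.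
have /andP[e0 e1] := ex_itv 1 (tau y).
have -> : F (tau y) = log_pull F (ex 1 (tau y)).
  by rewrite /log_pull leNgt e0 /= /ex expRK opprK mul1r F0.
apply: (@bern_cvg _ _ K).
- by rewrite e0.
- by rewrite /log_pull lexx.
- by move=> x; rewrite /log_pull; case: ifP => // _; rewrite normr0 (le_trans _ (FK 0)).
have c1 : {for ex 1 (tau y), continuous (fun x => F (- ln x))}.
  apply: continuous_comp; last exact: cF.
  by apply: continuousN; exact: continuous_ln.
have lE x : 0 < x -> log_pull F x = F (- ln x) by rewrite /log_pull leNgt => ->.
move: c1; rewrite /prop_for /continuous_at (lE _ e0).
apply: cvg_trans; apply: near_eq_cvg; near=> x; rewrite /= lE//.
near: x; exact: lt_nbhsr.
Unshelve. all: by end_near. Qed.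

End LaplaceUniqueness.
Local Notation leb := lebesgue_measure.

(** * Lebesgue integrals over segments *)

Section SegmentIntegrals.
Context {R : realType}.
Implicit Types (f g : R -> R).

(** The point 0 is negligible; it has to be left out because ln and the inverse take default values
    there. *)
Lemma seg_eq f g : measurable_fun setT f -> (forall u, 0 < u -> u <= 1 -> f u = g u) ->
  \int[leb]_(u in `[0, 1]) f u = \int[leb]_(u in `[0, 1]) g u.
Proof.
move=> mf fg; have e : {in `]0, 1]%classic, f =1 g}.
  by move=> u; rewrite inE /= in_itv /= => /andP[u0 u1]; exact: fg.
rewrite /Rintegral -integral_itv_obnd_cbnd; last first.
  by apply/measurable_EFinP; apply: measurable_funTS.
rewrite -[in RHS]integral_itv_obnd_cbnd; last first.
  by apply/measurable_EFinP; apply: eq_measurable_fun e _; apply: measurable_funTS.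
by congr fine; apply: eq_integral => u u01 /=; rewrite e.
Qed.

Lemma seg_ftc (F f : R -> R) (a b : R) : a < b ->
  (forall u, a <= u -> is_derive u 1 F (f u)) ->
  (forall u, a <= u -> {for u, continuous f}) ->
  \int[leb]_(u in `[a, b]) f u = F b - F a.
Proof.
move=> ab dF cf.
have c (u : R) : a <= u -> F x @[x --> u] --> F u.
  by move=> u0; apply: differentiable_continuous; apply/derivable1_diffP; have [] := dF u u0.
rewrite /Rintegral (@continuous_FTC2 _ f F a b)//=.
- apply: continuous_in_subspaceT => u.
  by rewrite inE /= in_itv /= => /andP[u0 _]; exact: cf.
- split.
  + by move=> u; rewrite in_itv /= => /andP[u0 _]; have [] := dF u (ltW u0).
  + exact/cvg_at_right_filter/c.
  + exact/cvg_at_left_filter/c/ltW.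
- by move=> u; rewrite in_itv /= => /andP[u0 _]; rewrite derive1E; have [] := dF u (ltW u0).
Qed.

Definition cont_pos f := forall u, 0 < u -> {for u, continuous f}.

Lemma cont_posD f g : cont_pos f -> cont_pos g -> cont_pos (fun u => f u + g u).
Proof. by move=> cf cg u u0; apply: cvgD; [exact: cf|exact: cg]. Qed.

Lemma cont_posM f g : cont_pos f -> cont_pos g -> cont_pos (fun u => f u * g u).
Proof. by move=> cf cg u u0; apply: cvgM; [exact: cf|exact: cg]. Qed.

Lemma cont_posZ c f : cont_pos f -> cont_pos (fun u => c * f u).
Proof. by apply: cont_posM => u _; exact: cvg_cst. Qed.

Lemma cont_pos_inv : cont_pos (GRing.inv : R -> R).
Proof. by move=> u u0; apply: cvgV; rewrite ?gt_eqF//; exact: cvg_id. Qed.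

Lemma seg_inv (a : R) : 0 < a -> a < 1 ->
  \int[leb]_(u in `[a, 1]) u^-1 = - ln a.
Proof.
move=> a0 a1; have d u (au : a <= u) := is_derive1_ln (lt_le_trans a0 au).
by rewrite (seg_ftc a1 d) ?ln1 ?sub0r// => u au; exact: cont_pos_inv (lt_le_trans a0 au).
Qed.

Lemma seg_inv2 (a : R) : 0 < a -> a < 1 ->
  \int[leb]_(u in `[a, 1]) (u^-1 * u^-1) = a^-1 - 1.
Proof.
move=> a0 a1; pose F (u : R) := - u^-1.
have d u : a <= u -> is_derive u 1 F (u^-1 * u^-1).
  move=> au; have un : u != 0 by rewrite gt_eqF// (lt_le_trans a0).
  have dV := is_deriveV un (is_derive_id u (1 : R)).
  by apply: is_derive_eq; rewrite /GRing.scale /=; field.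
rewrite (seg_ftc a1 d) => [|u au]; first by rewrite /F invr1 opprK addrC.
by apply: cvgM; exact: cont_pos_inv (lt_le_trans a0 au).
Qed.

Lemma seg_int_pos f (a b : R) : cont_pos f -> 0 < a ->
  leb.-integrable `[a, b] (EFin \o f).
Proof.
move=> cf a0; apply: continuous_compact_integrable; first exact: segment_compact.
apply: continuous_in_subspaceT => u.
by rewrite inE /= in_itv /= => /andP[au _]; apply: cf; exact: lt_le_trans au.
Qed.

Lemma seg_int_bmeas f (a b : R) : bmeas setT f ->
  leb.-integrable `[a, b] (EFin \o f).
Proof.
move=> [mf [K fK]]; apply: measurable_bounded_integrable => //.
- by rewrite /= lebesgue_measure_itv /=; case: ifP => _; rewrite ?ltry// -EFinD ltry.
- exact: measurable_funTS.
- by exists K; split; [exact: num_real|move=> r Kr v _; exact: le_trans (fK v I) (ltW Kr)].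
Qed.

Lemma seg_split f (a b c : R) : a <= b -> b <= c ->
  leb.-integrable `[a, c] (EFin \o f) ->
  \int[leb]_(u in `[a, c]) f u - \int[leb]_(u in `[a, b]) f u =
  \int[leb]_(u in `[b, c]) f u.
Proof.
move=> ab bc fi; have := Rintegral_itvB fi (x := b).
rewrite !bnd_simp ab bc => /(_ isT isT) ->; rewrite Rintegral_itv_obnd_cbnd//.
by apply: (integrableS _ _ _ fi) => //; apply: subset_itvr; rewrite bnd_simp.
Qed.

Lemma seg_cst (a b c : R) : a <= b ->
  \int[leb]_(u in `[a, b]) c = (b - a) * c.
Proof.
move=> ab; rewrite Rintegral_cst// mulrC; congr (_ * _).
rewrite [X in fine X]lebesgue_measure_itv /= lte_fin.
case: ltP => //= ba; have -> : a = b by apply/le_anti; rewrite ab ba.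
by rewrite subrr.
Qed.

Lemma seg_dist f (a b c e : R) : a <= b ->
  leb.-integrable `[a, b] (EFin \o f) ->
  (forall u, a <= u -> u <= b -> `|f u - c| <= e) ->
  `|\int[leb]_(u in `[a, b]) f u - (b - a) * c| <= (b - a) * e.
Proof.
move=> ab fi fe; have ci (r : R) := seg_int_bmeas a b (bmeas_cst setT r).
have h1 : \int[leb]_(u in `[a, b]) f u <= (b - a) * (c + e).
  rewrite -seg_cst//; apply: le_Rintegral => //.
  move=> u; rewrite /= in_itv /= => /andP[au ub].
  by have := fe u au ub; rewrite ler_norml => /andP[_]; lra.
have h2 : (b - a) * (c - e) <= \int[leb]_(u in `[a, b]) f u.
  rewrite -seg_cst//; apply: le_Rintegral => //.
  move=> u; rewrite /= in_itv /= => /andP[au ub].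
  by have := fe u au ub; rewrite ler_norml => /andP[+ _]; lra.
by rewrite ler_norml; apply/andP; split; lra.
Qed.

Lemma seg_le f g (a b : R) :
  leb.-integrable `[a, b] (EFin \o f) ->
  leb.-integrable `[a, b] (EFin \o g) ->
  (forall u, a <= u -> u <= b -> `|f u| <= g u) ->
  `|\int[leb]_(u in `[a, b]) f u| <=
    \int[leb]_(u in `[a, b]) g u.
Proof.
move=> fi gi fg; apply: le_trans (le_normr_Rintegral _ fi) _ => //.
apply: le_Rintegral => //; first exact: (integrable_norm fi).
by move=> u; rewrite /= in_itv /= => /andP[au ub]; exact: fg.
Qed.

End SegmentIntegrals.

(** * Probability laws on the half-line *)

Section Laws.
Context {R : realType}.
Implicit Types (F : R -> R).

Definition ev (P : probability R R) F : R := \int[P]_s F s.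

(** Concentration on [0, +oo[, expressed by expectations so that the image laws below satisfy it by
    idempotence of the truncation. *)
Definition nonneg_law (P : probability R R) :=
  forall f, bmeas setT f -> ev P (fun s => f (Num.max s 0)) = ev P f.

Lemma bmeas_comp_max (f : R -> R) : bmeas setT f ->
  bmeas setT (fun s : R => f (Num.max s 0)).
Proof.
move=> [mf [K fK]]; split; last by exists K => y _; exact: fK.
by apply: measurableT_comp => //; apply: measurable_maxr.
Qed.

Section Fubini.
Context {d1 d2 : measure_display} {Y1 : measurableType d1} {Y2 : measurableType d2}.
Variables (P1 : probability Y1 R) (P2 : probability Y2 R).

Lemma Rfubini (f : Y1 * Y2 -> R) : bmeas setT f ->
  bmeas setT (fun x => \int[P2]_y f (x, y)) /\
  \int[(P1 \x P2)%E]_p f p = \int[P1]_x \int[P2]_y f (x, y).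
Proof.
move=> bf; have [mf [K fK]] := bf.
have fi : (P1 \x P2)%E.-integrable setT (EFin \o f).
  exact: (@bmeas_integrable _ _ _ ((P1 \x P2)%E : probability _ R)).
have bx x : bmeas setT (fun y => f (x, y)).
  split; last by exists K => y _; exact: fK.
  by apply: measurableT_comp => //; exact: pair1_measurable.
have E x : (\int[P2]_y (f (x, y))%:E)%E = (\int[P2]_y f (x, y))%:E.
  by rewrite /Rintegral fineK// integrable_fin_num//; exact: bmeas_integrable.
have EF : fubini_F P2 (EFin \o f) = EFin \o (fun x => \int[P2]_y f (x, y)).
  by apply/funext => x; rewrite /fubini_F /= E.
split.
  split.
    by apply/measurable_EFinP; rewrite -EF; apply: measurable_fubini_F fi.
  exists (K * fine (P2 setT)) => x _.
  by apply: bint_bound => //; [case: (bx x)|move=> y _; exact: fK].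
rewrite /Rintegral -(integral12_prod_meas1 fi) EF.
by congr fine; apply: eq_integral => x _ /=.
Qed.

End Fubini.

Section Law.
Context {d : measure_display} {Y : measurableType d}.
Variables (P : probability Y R) (g : Y -> R).

Definition posf (mg : measurable_fun setT g) (y : Y) : R := Num.max (g y) 0.

Hypothesis mg : measurable_fun setT g.

Lemma measurable_posf : measurable_fun setT (posf mg).
Proof. by apply: measurable_maxr. Qed.

HB.instance Definition _ := isMeasurableFun.Build _ _ _ _ (posf mg) measurable_posf.

(** Image law of g, truncated at 0: every law built in this way lives on the half-line, whatever g
    does on negligible or irrelevant arguments. *)
Definition law : probability R R := distribution P (posf mg).

Lemma bmeas_bcont {D : set Y} {f : Y -> R} F : measurable D -> bcont F ->
  measurable_fun D f -> bmeas D (fun y => F (f y)).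
Proof.
move=> mD [cF [K FK] _] mf; split; last by exists K => y _.
by apply: measurableT_comp => //; exact: continuous_measurable_fun.
Qed.

Lemma bmeas_posf (f : R -> R) : bmeas setT f -> bmeas setT (fun y => f (Num.max (g y) 0)).
Proof.
move=> [mf [K fK]]; split; last by exists K => y _; exact: fK.
by apply: measurableT_comp => //; exact: measurable_posf.
Qed.

Lemma law_bint (f : R -> R) : bmeas setT f ->
  \int[law]_s f s = \int[P]_y f (Num.max (g y) 0).
Proof.
move=> bf; rewrite /Rintegral /law integral_distribution//.
  by apply/measurable_EFinP; case: bf.
exact: bmeas_integrable (bmeas_posf bf).
Qed.

Lemma law_int F : bcont F -> ev law F = \int[P]_y F (g y).
Proof.
move=> bF; rewrite /ev; have [_ _ F0] := bF.
rewrite law_bint; first by apply: eq_Rintegral => y _; rewrite F0.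
have [cF [K FK] _] := bF; split; last by exists K => s _.
exact: continuous_measurable_fun.
Qed.

Lemma nonneg_law_law : nonneg_law law.
Proof.
move=> f bf.
have bm : bmeas setT (fun s : R => f (Num.max s 0)).
  exact: (@bmeas_comp_max f).
rewrite /ev (law_bint bf) (law_bint bm); apply: eq_Rintegral => y _.
by rewrite (maxr0_id (maxr0_ge0 _)).
Qed.

End Law.

Definition unif : probability R R :=
  law (uniform_prob (@ltr01 R)) (@measurable_id _ (measurableTypeR R) setT).

Lemma unif_int (f : R -> R) : bmeas setT f ->
  ev unif f = \int[leb]_(u in `[0, 1]) f u.
Proof.
rewrite /ev => bf; have [mf [K fK]] := bf.
have Leb1 : lebesgue_measure (`[0, 1]%classic : set R) = 1%E.
  by rewrite lebesgue_measure_itv /= lte_fin ltr01 oppr0 adde0.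
(* Adding the bound [K] makes the integrand nonnegative, as [integral_uniform] requires; the shift
   cancels since both measures have mass 1. *)
have : \int[unif]_u (f u + K) = \int[leb]_(u in `[0, 1]) (f u + K).
  have bfK : bmeas setT (fun u => f u + K) by apply: bmeasD => //; exact: bmeas_cst.
  rewrite law_bint// /Rintegral integral_uniform.
  - rewrite subr0 invr1 mul1e; congr fine; apply: eq_integral => x.
    by rewrite inE /= in_itv /= => /andP[x0 _]; rewrite maxr0_id.
  - by apply/measurable_EFinP; case: (bmeas_posf (@measurable_id _ (measurableTypeR R) setT) bfK).
  - by move=> x; rewrite lee_fin; have := fK (Num.max x 0) I; rewrite ler_norml => /andP[]; lra.
rewrite bintD//; last exact: bmeas_cst.
rewrite RintegralD//; [|exact: seg_int_bmeas|exact: seg_int_bmeas (bmeas_cst setT K)].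
rewrite !Rintegral_cst//.
rewrite (_ : fine (unif setT) = fine (leb (`[0, 1]%classic : set R))).
  by move/addIr.
by rewrite Leb1 [X in fine X]probability_setT.
Qed.

Lemma unif_logN : measurable_fun setT (fun u : R => - ln u).
Proof. by apply: measurableT_comp => //; exact: measurable_ln. Qed.

(** Inverse sampling: - ln U is standard exponential for U uniform on [0, 1]. Integrals over the
    half-line thus become integrals over [0, 1]. *)
Definition expd : probability R R := law unif unif_logN.

Lemma measurable_scale c : measurable_fun setT (fun s : R => c * Num.max s 0).
Proof.
by apply: measurable_funM => //; apply: measurable_maxr.
Qed.

(* For c = 1/eta this is the resolvent kernel eta * exp(- eta s). *)
Definition expd_scaled c := law expd (measurable_scale c).

Definition unif_scaled t := law unif (@mulrl_measurable R setT t).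

Lemma measurable_conv : measurable_fun setT
  (fun p : R * R => Num.max p.1 0 + Num.max p.2 0).
Proof.
by apply: measurable_funD; apply: measurable_maxr.
Qed.

Definition conv (P1 P2 : probability R R) := law (P1 \x P2)%E measurable_conv.

Lemma measurable_mulexp : measurable_fun setT
  (fun p : R * R => p.1 * Num.max p.2 0).
Proof.
by apply: measurable_funM => //; apply: measurable_maxr.
Qed.

Lemma measurable_divexp : measurable_fun setT
  (fun p : R * R => expR (- ln p.1) * Num.max p.2 0).
Proof.
apply: measurable_funM; last by apply: measurable_maxr.
apply: measurableT_comp; first exact: measurable_expR.
apply: measurableT_comp => //.
by apply: measurableT_comp; first exact: measurable_ln.
Qed.

(* The laws of U * E and E / U for independent U uniform and E exponential;
   expR (- ln u) is u^-1 for u > 0. *)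
Definition low_law := law (unif \x expd)%E measurable_mulexp.
Definition high_law := law (unif \x expd)%E measurable_divexp.

Lemma nonneg_expd_scaled c : nonneg_law (expd_scaled c).
Proof. exact: nonneg_law_law. Qed.

Lemma nonneg_conv P1 P2 : nonneg_law (conv P1 P2).
Proof. exact: nonneg_law_law. Qed.

Lemma nonneg_low_law : nonneg_law low_law.
Proof. exact: nonneg_law_law. Qed.

Opaque law unif.

Lemma bmeas_conv F : bcont F ->
  bmeas setT (fun p : R * R => F (Num.max p.1 0 + Num.max p.2 0)).
Proof. by move=> bF; apply: bmeas_bcont => //; exact: measurable_conv. Qed.

Lemma conv_int P1 P2 F : bcont F ->
  ev (conv P1 P2) F = ev P1 (fun s => ev P2 (fun r => F (Num.max s 0 + Num.max r 0))).
Proof.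
move=> bF; rewrite /conv (law_int _ measurable_conv bF).
by have [_ ->] := Rfubini P1 P2 (bmeas_conv bF).
Qed.

Lemma scaled_int c F : bcont F ->
  ev (expd_scaled c) F = ev expd (fun s => F (c * Num.max s 0)).
Proof. by move=> bF; rewrite /expd_scaled (law_int _ (measurable_scale c) bF). Qed.

Lemma expd_int F : bcont F ->
  ev expd F = ev unif (fun u => F (- ln u)).
Proof. by move=> bF; rewrite /expd (law_int _ unif_logN bF). Qed.

Lemma unif_scaled_int t F : bcont F ->
  ev (unif_scaled t) F = ev unif (fun u => F (t * u)).
Proof. by move=> bF; rewrite /unif_scaled (law_int _ (@mulrl_measurable R setT t) bF). Qed.

(** Conditioning on U. On transforms: log(1+z)/z is the integral of 1/(1+uz) over u in [0, 1]. In
    [high_int] it is u/(u+z) that is integrated. Boundedness and measurability in u are recorded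
    since resolvents are integrated in u later. *)
Lemma low_int F : bcont F ->
  bmeas setT (fun u => ev (expd_scaled u) F) /\
  ev low_law F = ev unif (fun u => ev (expd_scaled u) F).
Proof.
move=> bF; have bf : bmeas setT (fun p : R * R => F (p.1 * Num.max p.2 0)).
  by apply: bmeas_bcont => //; exact: measurable_mulexp.
have [h1 h2] := Rfubini unif expd bf.
have E : (fun u => ev (expd_scaled u) F) = fun u => ev expd (fun s => F (u * Num.max s 0)).
  by apply/funext => u; rewrite (scaled_int u bF).
by rewrite E /low_law (law_int _ measurable_mulexp bF) h2.
Qed.

Lemma high_int F : bcont F ->
  bmeas setT (fun u => ev (expd_scaled (expR (- ln u))) F) /\
  ev high_law F = ev unif (fun u => ev (expd_scaled (expR (- ln u))) F).
Proof.
move=> bF; have bf : bmeas setT (fun p : R * R => F (expR (- ln p.1) * Num.max p.2 0)).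
  by apply: bmeas_bcont => //; exact: measurable_divexp.
have [h1 h2] := Rfubini unif expd bf.
have E : (fun u => ev (expd_scaled (expR (- ln u))) F) =
    fun u => ev expd (fun s => F (expR (- ln u) * Num.max s 0)).
  by apply/funext => u; rewrite (scaled_int _ bF).
by rewrite E /high_law (law_int _ measurable_divexp bF) h2.
Qed.

Opaque expd expd_scaled unif_scaled conv low_law high_law.

(* Real and imaginary parts of exp(-(a + ib)s). *)
Definition kc (a b s : R) := expR (- (a * Num.max s 0)) * cos (b * Num.max s 0).
Definition ks (a b s : R) := - (expR (- (a * Num.max s 0)) * sin (b * Num.max s 0)).

Lemma max00 (s : R) : Num.max (Num.max s 0) 0 = Num.max s 0.
Proof. by rewrite maxr0_id// maxr0_ge0. Qed.

Let cont_lin (c : R) : continuous (fun s : R => c * Num.max s 0).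
Proof. by move=> s; apply: cvgM; [exact: cvg_cst|exact: continuous_maxr0]. Qed.

Let cont_expN (a : R) : continuous (fun s : R => expR (- (a * Num.max s 0))).
Proof.
move=> s; apply: continuous_comp; last exact: continuous_expR.
by apply: continuousN; exact: cont_lin.
Qed.

Let norm_expN (a s : R) : 0 <= a -> `|expR (- (a * Num.max s 0))| <= 1.
Proof.
move=> a0; rewrite ger0_norm ?expR_ge0// -expR0 ler_expR oppr_le0.
by rewrite mulr_ge0// maxr0_ge0.
Qed.

Lemma kc_le1 a b s : 0 <= a -> `|kc a b s| <= 1.
Proof.
move=> a0; rewrite normrM mulr_ile1//; first exact: norm_expN.
by rewrite ler_norml cos_geN1 cos_le1.
Qed.

Lemma ks_le1 a b s : 0 <= a -> `|ks a b s| <= 1.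
Proof.
move=> a0; rewrite normrN normrM mulr_ile1//; first exact: norm_expN.
by rewrite ler_norml sin_geN1 sin_le1.
Qed.

Lemma bcont_kc a b : 0 <= a -> bcont (kc a b).
Proof.
move=> a0; split.
- move=> s; apply: cvgM; first exact: cont_expN.
  by apply: continuous_comp; [exact: cont_lin|exact: continuous_cos].
- by exists 1 => s; exact: kc_le1.
- by move=> s; rewrite /kc max00.
Qed.

Lemma bcont_ks a b : 0 <= a -> bcont (ks a b).
Proof.
move=> a0; split.
- move=> s; apply: cvgN; apply: cvgM; first exact: cont_expN.
  by apply: continuous_comp; [exact: cont_lin|exact: continuous_sin].
- by exists 1 => s; exact: ks_le1.
- by move=> s; rewrite /ks max00.
Qed.

Section ExponentialTransform.
Variables (a b p q : R).
Hypothesis a0 : 0 < a.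

(** The integrand after u = exp(-s). Its primitive is u^(1+a) (al cos(b ln u) + be sin(b ln u)),
    where [al] and [be] solve the 2 x 2 linear system found by differentiating. As a > 0, the value
    0 at u = 0 makes f continuous on [0, 1], so the fundamental theorem applies up to 0. *)
Let f (u : R) := if u <= 0 then 0 else
  expR (a * ln u) * (p * cos (b * ln u) + q * sin (b * ln u)).
Let al := ((1 + a) * p - b * q) / ((1 + a) ^+ 2 + b ^+ 2).
Let be := ((1 + a) * q + b * p) / ((1 + a) ^+ 2 + b ^+ 2).
Let G (u : R) := u * (expR (a * ln u) * (al * cos (b * ln u) + be * sin (b * ln u))).

Let D0 : (1 + a) ^+ 2 + b ^+ 2 != 0.
Proof.
rewrite gt_eqF// ltr_pwDl ?sqr_ge0// exprn_gt0//; move: a0; lra.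
Qed.

Let fE (u : R) : 0 < u ->
  f u = expR (a * ln u) * (p * cos (b * ln u) + q * sin (b * ln u)).
Proof. by move=> u0; rewrite /f leNgt u0. Qed.

Let dG (u : R) : 0 < u -> is_derive u 1 G (f u).
Proof.
move=> u0; have dl := is_derive1_ln u0.
rewrite /f leNgt u0 /=; apply: is_derive_eq.
rewrite /GRing.scale /= /al /be; field.
by rewrite D0 gt_eqF.
Qed.

Let trig_le (r s x : R) : `|r * cos x + s * sin x| <= `|r| + `|s|.
Proof.
rewrite (le_trans (ler_normD _ _))// !normrM lerD// ler_piMr//.
  by rewrite ler_norml cos_geN1 cos_le1.
by rewrite ler_norml sin_geN1 sin_le1.
Qed.

Let f_cvg0 : f u @[u --> 0^'+] --> 0.
Proof.
apply/cvgrPdist_le => e e0; near=> u.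
have u0 : 0 < u by near: u; exact: nbhs_right_gt.
rewrite sub0r normrN fE// normrM ger0_norm ?expR_ge0//.
have c0 : 0 < `|p| + `|q| + 1 by rewrite ltr_wpDl// addr_ge0.
have h : expR (a * ln u) <= e / (`|p| + `|q| + 1).
  rewrite -[leRHS]lnK ?posrE ?divr_gt0// ler_expR -ler_pdivlMl//.
  rewrite -ler_expR lnK ?posrE//; near: u; apply: nbhs_right_le.
  exact: expR_gt0.
rewrite (le_trans (ler_pM (expR_ge0 _) (normr_ge0 _) h (trig_le _ _ _)))//.
by rewrite mulrAC ler_pdivrMr// ler_wpM2l ?(ltW e0)// lerDl.
Unshelve. all: by end_near. Qed.

Let G_cvg0 : G u @[u --> 0^'+] --> 0.
Proof.
apply/cvgrPdist_le => e e0; near=> u.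
have u0 : 0 < u by near: u; exact: nbhs_right_gt.
have u1 : u <= 1 by near: u; exact: nbhs_right_le.
have c0 : 0 < `|al| + `|be| + 1 by rewrite ltr_wpDl// addr_ge0.
rewrite sub0r normrN /G !normrM (ger0_norm (ltW u0)) ger0_norm ?expR_ge0//.
have h : expR (a * ln u) <= 1.
  by rewrite -expR0 ler_expR mulr_ge0_le0 ?ln_le0// ltW.
have h2 : u <= e / (`|al| + `|be| + 1).
  by near: u; apply: nbhs_right_le; rewrite divr_gt0.
rewrite (le_trans (ler_pM (ltW u0) _ h2 (ler_pM (expR_ge0 _) (normr_ge0 _) h (trig_le _ _ _))))//.
by rewrite mul1r mulrAC ler_pdivrMr// ler_wpM2l ?(ltW e0)// lerDl.
Unshelve. all: by end_near. Qed.

Let f_cont (u : R) : 0 < u -> {for u, continuous f}.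
Proof.
move=> u0; have c : {for u, continuous (fun u => expR (a * ln u) *
    (p * cos (b * ln u) + q * sin (b * ln u)))}.
  apply: differentiable_continuous; apply/derivable1_diffP.
  have dl := is_derive1_ln u0; exact: ex_derive.
move: c; rewrite /prop_for /continuous_at {2}/f leNgt u0 /=.
apply: cvg_trans; apply: near_eq_cvg; near=> x.
rewrite /f leNgt ifF//; apply/negbTE; rewrite negbK.
by near: x; exact: lt_nbhsr.
Unshelve. all: by end_near. Qed.

Lemma exponential_transform :
  ev expd (fun s => p * kc a b s + q * ks a b s) = al.
Proof.
have b1 := bcont_kc b (ltW a0); have b2 := bcont_ks b (ltW a0).
have bF : bcont (fun s => p * kc a b s + q * ks a b s).
  have [c1 [K1 k1] m1] := b1; have [c2 [K2 k2] m2] := b2; split.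
  - move=> s; apply: cvgD; apply: cvgM; try exact: cvg_cst; [exact: c1|exact: c2].
  - exists (`|p| * K1 + `|q| * K2) => s; rewrite (le_trans (ler_normD _ _))//.
    by rewrite (normrM p) (normrM q); apply: lerD; apply: ler_wpM2l.
  - by move=> s; rewrite m1 m2.
rewrite expd_int// unif_int; last exact: (bmeas_bcont measurableT bF unif_logN).
have mF : measurable_fun setT (fun u : R => p * kc a b (- ln u) + q * ks a b (- ln u)).
  by case: (bmeas_bcont measurableT bF unif_logN).
transitivity (\int[leb]_(u in `[0, 1]) f u).
  apply: seg_eq => // u u0 u1; rewrite fE// /kc /ks maxr0_id ?oppr_ge0 ?ln_le0//.
  by rewrite !mulrN opprK cosN sinN; ring.
rewrite /Rintegral (@continuous_FTC2 _ f G 0 1)//=.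
- rewrite /G ln1 !mulr0 expR0 cos0 sin0 !mul0r; ring.
- apply/continuous_within_itvP => //; split.
  + by move=> x; rewrite in_itv /= => /andP[x0 _]; exact: f_cont.
  + by rewrite {2}/f lexx; exact: f_cvg0.
  + by apply: cvg_at_left_filter; exact: f_cont.
- split.
  + by move=> x; rewrite in_itv /= => /andP[x0 _]; have [] := dG x0.
  + by rewrite {2}/G mul0r; exact: G_cvg0.
  + apply: cvg_at_left_filter; apply: differentiable_continuous.
    by apply/derivable1_diffP; have [] := dG ltr01.
- by move=> x; rewrite in_itv /= => /andP[x0 _]; rewrite derive1E; have [] := dG x0.
Qed.

End ExponentialTransform.

Lemma expd_kc a b : 0 < a ->
  ev expd (kc a b) = (1 + a) / ((1 + a) ^+ 2 + b ^+ 2).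
Proof.
move=> a0; have := exponential_transform b 1 0 a0.
rewrite mulr1 mulr0 subr0 => <-.
by congr ev; apply/funext => s; rewrite mul1r mul0r addr0.
Qed.

Lemma expd_ks a b : 0 < a ->
  ev expd (ks a b) = - b / ((1 + a) ^+ 2 + b ^+ 2).
Proof.
move=> a0; have := exponential_transform b 0 1 a0.
rewrite mulr1 mulr0 sub0r => <-.
by congr ev; apply/funext => s; rewrite mul1r mul0r add0r.
Qed.

End Laws.

(** * A differential inequality for logarithmic averages *)

Section LogAverage.
Context {R : realType}.
Variable j : R -> R.
Hypothesis j_cont : cont_pos j.

Let f (u : R) := j u / u.

Let f_cont : cont_pos f := cont_posM j_cont cont_pos_inv.

(* With w = - ln a and s(a) = \int_a^1 j(u)/u du, the quotient (s + c)/w has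
   derivative b/(a w^2), which is dominated by the derivative of k/w. *)
Lemma log_average_decay (b : R -> R) (c k a1 a2 : R) :
    0 < a1 -> a1 < a2 -> a2 < 1 ->
    (forall a, 0 < a -> a < 1 ->
      \int[leb]_(u in `[a, 1]) (j u / u) + c = - ln a * j a + b a) ->
    (forall a, a1 <= a -> a <= a2 -> `|b a| <= k) ->
  `|j a1 - j a2| <= 3 * k / - ln a2.
Proof.
move=> a10 a12 a21 hs hb.
(* Integrating from a point to the left of [a1] makes the primitive [F] differentiable at every
   point of [a1, a2], [a1] included. *)
pose a0 := a1 / 2.
have a00 : 0 < a0 by rewrite divr_gt0.
have a01 : a0 < a1 by rewrite ltr_pdivrMr// ltr_pMr// ltr1n.
have a20 : 0 < a2 := lt_trans a10 a12.
have lnN (a : R) : 0 < a -> a < 1 -> 0 < - ln a by move=> h1 h2; rewrite oppr_gt0 ln_lt0// h1.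
pose F x := \int[leb]_(u in `[a0, x]) f u.
pose C := \int[leb]_(u in `[a0, 1]) f u + c.
have sF a : a0 <= a -> a < 1 -> C - F a = - ln a * j a + b a.
  move=> aa a1'; have aP : 0 < a := lt_le_trans a00 aa.
  rewrite -hs// /C addrAC; congr (_ + _).
  by rewrite (seg_split aa (ltW a1') (seg_int_pos 1 f_cont a00)).
have dF x : a0 < x -> x < 1 -> is_derive x 1 F (f x).
  move=> ax x1; have xP := lt_trans a00 ax.
  have [h1 h2] := continuous_FTC1_closed x1 (seg_int_pos 1 f_cont a00) ax (f_cont xP).
  exact: DeriveDef h1 (etrans (esym (derive1E F x)) h2).
(* The quotient (s + c + e k)/w. Since |b| <= k, it is nondecreasing for e = 1 and nonincreasing for
   e = -1; comparing its values at [a1] and [a2] bounds j a1 - j a2 from both sides. *)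
pose D e x := (C - F x + e * k) / - ln x.
have dD e x : a0 < x -> x < 1 -> is_derive x 1 (D e) ((b x + e * k) / (x * ln x ^+ 2)).
  move=> ax x1; have xP := lt_trans a00 ax.
  have lx := lnN _ xP x1.
  have dFx := dF x ax x1; have dlx := is_derive1_ln xP.
  have lx0 : - ln x != 0 by rewrite gt_eqF.
  have hF := sF x (ltW ax) x1.
  apply: is_derive_eq; rewrite /GRing.scale /= /f.
  rewrite hF; field.
  by rewrite -oppr_eq0 lx0 gt_eqF.
have contD e : {within `[a1, a2], continuous (D e)}.
  apply: derivable_within_continuous => x; rewrite in_itv /= => /andP[h1 h2].
  by have [] := dD e x (lt_le_trans a01 h1) (le_lt_trans h2 a21).
have mvt e : exists2 x, a1 <= x <= a2 &
    D e a2 - D e a1 = (b x + e * k) / (x * ln x ^+ 2) * (a2 - a1).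
  have [|x hx ->] := @MVT_segment _ (D e) (fun x => (b x + e * k) / (x * ln x ^+ 2)) a1 a2 (ltW a12) _ (contD e).
    move=> x; rewrite in_itv /= => /andP[h1 h2].
    exact: dD (lt_trans a01 h1) (lt_trans h2 a21).
  by exists x => //; move: hx; rewrite in_itv.
have k0 : 0 <= k by apply: le_trans (hb a1 _ _); rewrite // ltW.
have den x : a1 <= x <= a2 -> 0 <= (a2 - a1) / (x * ln x ^+ 2).
  move=> /andP[h1 h2]; apply: divr_ge0; first by rewrite subr_ge0 ltW.
  by apply: mulr_ge0; [exact: le_trans (ltW a10) h1|exact: sqr_ge0].
have m1 : 0 <= D 1 a2 - D 1 a1.
  have [x hx ->] := mvt 1; rewrite mulrAC -mulrA mulr_ge0 ?den//.
  by have /andP[h1 h2] := hx; have := hb x h1 h2; rewrite ler_norml; lra.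
have m2 : D (-1) a2 - D (-1) a1 <= 0.
  have [x hx ->] := mvt (-1); rewrite mulrAC -mulrA mulr_le0_ge0 ?den//.
  by have /andP[h1 h2] := hx; have := hb x h1 h2; rewrite ler_norml; lra.
have l1 := lnN _ a10 (lt_trans a12 a21); have l2 := lnN _ a20 a21.
have a11 := lt_trans a12 a21.
have DE e a : a0 <= a -> a < 1 -> 0 < a -> D e a = j a + (b a + e * k) / - ln a.
  move=> h1 h2 h3; rewrite /D sF//; field.
  by rewrite -oppr_eq0 gt_eqF// lnN.
move: m1 m2; rewrite !DE ?(ltW a01)//; last 2 first.
- exact: le_trans (ltW a01) (ltW a12).
- exact: le_trans (ltW a01) (ltW a12).
have i12 : (- ln a1)^-1 <= (- ln a2)^-1.
  by rewrite lef_pV2 ?posrE// lerN2 ler_ln ?posrE// ltW.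
have b1 := hb a1 (lexx _) (ltW a12); have b2 := hb a2 (ltW a12) (lexx _).
have i20 : 0 < (- ln a2)^-1 by rewrite invr_gt0.
have i10 : 0 < (- ln a1)^-1 by rewrite invr_gt0.
move: i12 i20 i10; move: (- ln a1)^-1 (- ln a2)^-1 => p q pq q0 p0.
move: b1 b2; rewrite !ler_norml; move: (j a1) (j a2) (b a1) (b a2) => j1 j2 b1 b2.
move=> /andP[b1l b1u] /andP[b2l b2u] m1 m2.
have e1 : (b1 + 1 * k) * p <= (b1 + 1 * k) * q by rewrite ler_wpM2l//; lra.
have e2 : 0 <= (b1 + 1 * k) * p by rewrite mulr_ge0//; lra.
have e3 : (b1 + -1 * k) * p <= 0 by rewrite mulr_le0_ge0//; lra.
have e4 : (b1 + -1 * k) * q <= (b1 + -1 * k) * p by rewrite ler_wnM2l//; lra.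
have f1 : (b2 + 1 * k) * q <= 2 * k * q by rewrite ler_wpM2r//; lra.
have f2 : - (2 * k) * q <= (b2 + -1 * k) * q by rewrite ler_wpM2r//; lra.
have k3 : 0 <= k * q by rewrite mulr_ge0// ltW.
by apply/andP; split; lra.
Qed.

End LogAverage.

(** * The real-valued norm and the Hahn-Banach theorem *)

Section RealNorm.
Context {R : realType} {X : normedModType R[i]}.
Implicit Types (u v x y : X) (r : R).

(* The norm of X takes its values in R[i]. *)
Definition nrm (x : X) : R := complex.Re `|x|.

Lemma nrmE x : `|x| = (nrm x)%:C.
Proof.
have : 0 <= `|x| by exact: normr_ge0.
rewrite /nrm; case: `|x| => a b; rewrite lecE /= => /andP[/eqP -> _].
by [].
Qed.

Lemma nrm_le x r : (`|x| <= r%:C) = (nrm x <= r).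
Proof. by rewrite nrmE lecR. Qed.

Lemma nrm_ge0 x : 0 <= nrm x.
Proof. by rewrite -lecR -nrmE normr_ge0. Qed.

Lemma nrm0 : nrm 0 = 0.
Proof. by rewrite /nrm normr0. Qed.

Lemma nrm_eq0 x : nrm x = 0 -> x = 0.
Proof. by move=> h; apply/eqP; rewrite -normr_eq0 nrmE h. Qed.

Lemma nrmN x : nrm (- x) = nrm x.
Proof. by rewrite /nrm normrN. Qed.

Lemma nrmB x y : nrm (x - y) = nrm (y - x).
Proof. by rewrite -opprB nrmN. Qed.

Lemma nrmD x y : nrm (x + y) <= nrm x + nrm y.
Proof. by rewrite -lecR rmorphD /= -!nrmE ler_normD. Qed.

Lemma nrm_dist x y : nrm (x - y) <= nrm x + nrm y.
Proof. by rewrite (le_trans (nrmD _ _))// nrmN. Qed.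

Lemma normc_ge0 (a : R[i]) : 0 <= Normc.normc a.
Proof. by case: a => a b; exact: sqrtr_ge0. Qed.

Lemma normc_real r : Normc.normc r%:C = `|r|.
Proof. by rewrite /= expr0n addr0 sqrtr_sqr. Qed.

Lemma normc_gt0 (a : R[i]) : 0 < complex.Re a -> 0 < Normc.normc a.
Proof. by case: a => a b /= a0; rewrite sqrtr_gt0 ltr_pwDl ?sqr_ge0// exprn_gt0. Qed.

Lemma nrmZc (a : R[i]) x : nrm (a *: x) = Normc.normc a * nrm x.
Proof.
apply: (@complexI R); rewrite rmorphM /= -!nrmE normrZ.
by congr (_ * _); case: a => a b; rewrite normc_def.
Qed.

Lemma nrmZ r x : nrm (r%:C *: x) = `|r| * nrm x.
Proof. by rewrite nrmZc normc_real. Qed.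

(** Real-linear functionals are enough: those of norm at most 1 already compute the norm of X. *)
Definition rlin (psi : X -> R) :=
  forall r u v, psi (r%:C *: u + v) = r * psi u + psi v.

Definition bfun C (psi : X -> R) := rlin psi /\ forall u, `|psi u| <= C * nrm u.

Lemma rlin0 psi : rlin psi -> psi 0 = 0.
Proof.
move=> /(_ 1 0 0); rewrite scaler0 addr0 mul1r => /eqP.
by rewrite -subr_eq0 opprD addrA subrr sub0r oppr_eq0 => /eqP.
Qed.

Lemma rlinD psi u v : rlin psi -> psi (u + v) = psi u + psi v.
Proof. by move=> /(_ 1 u v); rewrite scale1r mul1r. Qed.

Lemma rlinZ psi r u : rlin psi -> psi (r%:C *: u) = r * psi u.
Proof. by move=> h; have := h r u 0; rewrite (rlin0 h) !addr0. Qed.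

Lemma rlinN psi u : rlin psi -> psi (- u) = - psi u.
Proof.
by move=> h; rewrite -scaleN1r -(rmorphN1 (real_complex R)) rlinZ// mulN1r.
Qed.

Lemma rlinB psi u v : rlin psi -> psi (u - v) = psi u - psi v.
Proof. by move=> h; rewrite rlinD// rlinN. Qed.

Lemma rlin_sum psi n (F : 'I_n -> X) : rlin psi ->
  psi (\sum_(i < n) F i) = \sum_(i < n) psi (F i).
Proof.
move=> h; elim/big_ind2 : _ => //; first exact: rlin0.
by move=> x a y b <- <-; rewrite rlinD.
Qed.

Lemma bfun_rlin C psi : bfun C psi -> rlin psi. Proof. by case. Qed.

Lemma bfun1_le psi u : bfun 1 psi -> `|psi u| <= nrm u.
Proof. by move=> [_ h]; have := h u; rewrite mul1r. Qed.

Lemma bfun_ler C C' psi : C <= C' -> bfun C psi -> bfun C' psi.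
Proof.
move=> h [? hb]; split=> // u; rewrite (le_trans (hb u))// ler_wpM2r//.
exact: nrm_ge0.
Qed.

Section HahnBanach.
Variable v0 : X.

(* Graphs of linear functionals dominated by the norm and sending v0 to its norm;
   the empty graph is allowed, since Zorn_bigcup also considers empty chains. *)
Definition hb_graph (G : set (X * R)) :=
  [/\ (forall x a b, G (x, a) -> G (x, b) -> a = b),
      (forall r x a y b, G (x, a) -> G (y, b) -> G (r%:C *: x + y, r * a + b)),
      (forall x a, G (x, a) -> a <= nrm x) &
      (G !=set0 -> G (v0, nrm v0))].

Lemma hb_graph_line :
  hb_graph [set p | exists r, p = (r%:C *: v0, r * nrm v0)].
Proof.
split.
- move=> x a b [r [-> ->]] [s [e ->]].
  have [->|v0N] := eqVneq v0 0; first by rewrite nrm0 !mulr0.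
  move/eqP : e; rewrite -subr_eq0 -scalerBl scaler_eq0 (negbTE v0N) orbF.
  by rewrite subr_eq0 => /eqP /complexI ->.
- move=> r x a y b [s [-> ->]] [t [-> ->]]; exists (r * s + t).
  by congr (_, _); rewrite ?rmorphD ?rmorphM /= ?scalerDl ?scalerA// mulrDl mulrA.
- move=> x a [r [-> ->]]; rewrite nrmZ ler_wpM2r ?nrm_ge0//; exact: ler_norm.
- by move=> _; exists 1; rewrite scale1r mul1r.
Qed.

(** The value c at x0 has to satisfy b - |y - x0| <= c <= |y + x0| - b for all (y, b) in G. Each
    left side is below each right side by the triangle inequality for y + y', and c is the supremum
    of the left sides. *)
Lemma hb_graph_extend G x0 : hb_graph G -> G (v0, nrm v0) ->
  (forall a, ~ G (x0, a)) ->
  exists c, hb_graph [set p | exists x a r,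
    G (x, a) /\ p = (x + r%:C *: x0, a + r * c)].
Proof.
move=> [fG lG bG _] G0 nG.
have Gz : G (0, 0).
  by have := lG (-1) _ _ _ _ G0 G0; rewrite rmorphN1 scaleN1r mulN1r !addNr.
have GZ r x a : G (x, a) -> G (r%:C *: x, r * a).
  by move=> h; have := lG r _ _ _ _ h Gz; rewrite !addr0.
pose S := [set t | exists y b, G (y, b) /\ t = b - nrm (y - x0)].
have SU y b : G (y, b) -> forall t, S t -> t <= nrm (y + x0) - b.
  move=> Gy t [y' [b' [Gy' ->]]].
  have := bG _ _ (lG 1 _ _ _ _ Gy Gy'); rewrite scale1r mul1r => h.
  have : nrm (y + y') <= nrm (y + x0) + nrm (y' - x0).
    by rewrite (_ : y + y' = (y + x0) + (y' - x0)) ?nrmD// addrACA subrr addr0.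
  by lra.
have S0 : S !=set0 by exists (0 - nrm (0 - x0)), 0, 0.
have Sub : has_sup S.
  by split=> //; exists (nrm (0 + x0) - 0) => t /(SU _ _ Gz).
have cl y b : G (y, b) -> b - nrm (y - x0) <= sup S.
  by move=> Gy; apply: (ub_le_sup (proj2 Sub)); exists y, b.
have cu y b : G (y, b) -> sup S <= nrm (y + x0) - b.
  by move=> Gy; apply: ge_sup => //; exact: SU Gy.
exists (sup S); split.
- move=> x a b [y [p [r [Gy [-> ->]]]]] [y' [p' [r' [Gy' [e ->]]]]].
  have Gd : G (y - y', p - p').
    by have := lG (-1) _ _ _ _ Gy' Gy; rewrite rmorphN1 scaleN1r mulN1r !(addrC (- _)).
  have [rr|rr] := eqVneq r r'.
    move: e; rewrite rr => /addIr e; move: Gy; rewrite e => Gy.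
    by rewrite (fG _ _ _ Gy Gy').
  have e' : y - y' = (r' - r)%:C *: x0.
    rewrite rmorphB scalerBl; apply/eqP.
    by rewrite subr_eq addrAC eq_sym subr_eq addrC eq_sym e.
  have rr0 : r' - r != 0 by rewrite subr_eq0 eq_sym.
  have := GZ (r' - r)^-1 _ _ Gd; rewrite e' scalerA -rmorphM /= mulVf// scale1r.
  by move/nG.
- move=> s x a y b [x1 [a1 [r1 [G1 [-> ->]]]]] [x2 [a2 [r2 [G2 [-> ->]]]]].
  exists (s%:C *: x1 + x2), (s * a1 + a2), (s * r1 + r2); split; first exact: lG.
  congr (_, _); last by ring.
  by rewrite rmorphD rmorphM /= scalerDr scalerDl scalerA addrACA.
- move=> x a [y [b [r [Gy [-> ->]]]]].
  have [r0|r0|->] := ltgtP r 0.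
  + have := cl _ _ (GZ (- r)^-1 _ _ Gy).
    have -> : (- r)^-1%:C *: y - x0 = (- r)^-1%:C *: (y + r%:C *: x0).
      rewrite scalerDr scalerA -rmorphM /= invrN mulNr mulVf ?lt_eqF//.
      by rewrite rmorphN1 scaleN1r.
    rewrite nrmZ ger0_norm; last by rewrite invr_ge0 oppr_ge0 ltW.
    rewrite -mulrBr.
    by rewrite ler_pdivrMl ?oppr_gt0//; lra.
  + have := cu _ _ (GZ r^-1 _ _ Gy).
    have -> : r^-1%:C *: y + x0 = r^-1%:C *: (y + r%:C *: x0).
      by rewrite scalerDr scalerA -rmorphM /= mulVf ?gt_eqF// scale1r.
    rewrite nrmZ ger0_norm; last by rewrite invr_ge0 ltW.
    rewrite -mulrBr.
    by rewrite ler_pdivlMl//; lra.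
  + by rewrite scale0r mul0r !addr0; exact: bG.
- by move=> _; exists v0, (nrm v0), 0; split=> //; rewrite scale0r mul0r !addr0.
Qed.

Theorem hahn_banach_norming : exists2 psi, bfun 1 psi & psi v0 = nrm v0.
Proof.
have [F hF tF|A [PA maxA]] := @Zorn_bigcup _ hb_graph.
  have two p q : (\bigcup_(G in F) G) p -> (\bigcup_(G in F) G) q ->
      exists2 G, F G & G p /\ G q.
    move=> [G1 F1 G1p] [G2 F2 G2q].
    have [h|h] := tF _ _ F1 F2; first by exists G2 => //; split => //; exact: h.
    by exists G1 => //; split => //; exact: h.
  split.
  - by move=> x a b h1 h2; have [G /hF[fG _ _ _] [] ] := two _ _ h1 h2; exact: fG.
  - move=> r x a y b h1 h2; have [G FG [g1 g2]] := two _ _ h1 h2.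
    by exists G => //; have [_ lG _ _] := hF _ FG; exact: lG.
  - by move=> x a [G /hF[_ _ bG _]]; exact: bG.
  - move=> [p [G FG Gp]]; exists G => //; have [_ _ _] := hF _ FG; apply.
    by exists p.
(* Otherwise the maximal graph is empty, hence properly contained in the graph over the line spanned
   by v0. *)
have A0 : A (v0, nrm v0).
  have [_ _ _ h] := PA; apply: contrapT => nA.
  apply: (maxA _ _ hb_graph_line); split.
    by move=> p Ap; exfalso; apply/nA/h; exists p.
  by move=> /(_ (v0, nrm v0)) /= hh; apply/nA/hh; exists 1; rewrite scale1r mul1r.
have totA x0 : exists a, A (x0, a).
  apply: contrapT => /forallNP nA.
  have [c hc] := hb_graph_extend PA A0 nA.
  apply: (maxA _ _ hc); split.
    by move=> [x a] Ap; exists x, a, 0; rewrite scale0r mul0r !addr0.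
  move=> /(_ (x0, c)) /= hh; apply: (nA c); apply: hh.
  exists 0, 0, 1; rewrite scale1r mul1r !add0r; split => //.
  have [_ lG _ _] := PA.
  by have := lG (-1) _ _ _ _ A0 A0; rewrite rmorphN1 scaleN1r mulN1r !addNr.
have [psi psiA] := @choice _ _ (fun x a => A (x, a)) totA.
have [fG lG bG _] := PA; exists psi; last exact: fG (psiA v0) A0.
have lpsi : rlin psi.
  by move=> r u v; apply: fG (psiA _) _; exact: lG.
split=> // u; rewrite mul1r ler_norml bG// andbT lerNl -(rlinN _ lpsi).
by rewrite -(nrmN u) bG.
Qed.

End HahnBanach.

Lemma nrm_le_bfun v K : (forall psi, bfun 1 psi -> psi v <= K) -> nrm v <= K.
Proof. by move=> h; have [psi /h + <-] := hahn_banach_norming v. Qed.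

Lemma eq_bfun u v : (forall psi, bfun 1 psi -> psi u = psi v) -> u = v.
Proof.
move=> h; apply/eqP; rewrite -subr_eq0; apply/eqP/nrm_eq0/le_anti.
rewrite nrm_ge0 andbT; apply: nrm_le_bfun => psi hp.
by rewrite rlinB ?h ?subrr//; case: hp.
Qed.

End RealNorm.

(** * Norm limits, and vectors given by their functionals *)

Section VectorLimits.
Context {R : realType} {X : completeNormedModType R[i]}.

Lemma cvg_nrmP {I : Type} {F : set_system I} {FF : Filter F} (f : I -> X) l :
  f @ F --> l <-> forall e : R, 0 < e -> \forall i \near F, nrm (l - f i) < e.
Proof.
split=> [/cvgrPdist_lt h e e0|h].
  have e0' : 0 < e%:C by rewrite ltcR.
  by have := h _ e0'; apply: filterS => i; rewrite nrmE ltcR.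
apply/cvgrPdist_lt => -[e e'] /=; rewrite ltcE /= => /andP[/eqP -> e0].
have := h _ e0; apply: filterS => i; rewrite nrmE.
by rewrite -[(_ +i* 0)]/(e%:C) ltcR.
Qed.

Lemma cauchy_nrm (y : nat -> X) :
  (forall e : R, 0 < e -> exists N, forall n, (N <= n)%N -> nrm (y N - y n) < e) ->
  cvg (y @ \oo).
Proof.
move=> h; apply/cauchy_cvgP; apply: cauchy_exP => -[e e'] /=.
rewrite ltcE /= => /andP[/eqP -> e0]; have [N hN] := h _ e0.
exists (y N); exists N => // n /= Nn.
rewrite -ball_normE /ball_ /= nrmE -[(_ +i* 0)]/(e%:C) ltcR; exact: hN.
Qed.

Lemma geometric_small (q e : R) : 0 < q < 1 -> 0 < e -> exists n : nat, q ^+ n < e.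
Proof.
move=> /andP[q0 q1] e0; have h : `|q| < 1 by rewrite gtr0_norm.
have [n _ hn] := (cvgrPdist_lt _ _).1 (cvg_expr h) _ e0; exists n.
by have := hn n (leqnn n); rewrite /= sub0r normrN gtr0_norm// exprn_gt0.
Qed.

Lemma geometric_limit (y : nat -> X) (c q : R) : 0 < q < 1 -> 0 <= c ->
  (forall n, nrm (y n.+1 - y n) <= c * q ^+ n) ->
  exists l, forall n, nrm (l - y n) <= c / (1 - q) * q ^+ n.
Proof.
move=> q01 c0 hy; have /andP[q0 q1] := q01; have q2 : 0 < 1 - q by rewrite subr_gt0.
set C := c / (1 - q); have C0 : 0 <= C by rewrite divr_ge0// ltW.
have cE : c = C * (1 - q) by rewrite divfK// gt_eqF.
have qn n : 0 <= q ^+ n by rewrite exprn_ge0// ltW.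
have dist n m : (n <= m)%N -> nrm (y m - y n) <= C * q ^+ n.
  move=> nm; apply: (@le_trans _ _ (C * (q ^+ n - q ^+ m))).
    elim: m nm => [|m IH]; first by rewrite leqn0 => /eqP ->; rewrite !subrr nrm0 mulr0.
    rewrite leq_eqVlt => /predU1P[->|]; first by rewrite !subrr nrm0 mulr0.
    rewrite ltnS => /IH h; rewrite -(subrKA (y m)) (le_trans (nrmD _ _))//.
    have := hy m; rewrite exprS cE; move: h; move: (nrm _) (nrm _) (q ^+ n) (q ^+ m) => *; lra.
  by rewrite ler_wpM2l// gerBl.
have /cvg_ex[l yl] : cvg (y @ \oo).
  apply: cauchy_nrm => e e0; have C1 : 0 < C + 1 by rewrite ltr_wpDl.
  have [N hN] := geometric_small q01 (divr_gt0 e0 C1); exists N => n Nn.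
  rewrite nrmB (le_lt_trans (dist _ _ Nn))//; move: hN; rewrite ltr_pdivlMr// mulrC.
  by apply: le_lt_trans; rewrite ler_wpM2r// lerDl.
exists l => n; apply/ler_addgt0Pl => e e0; near \oo => m.
rewrite -(subrKA (y m)) (le_trans (nrmD _ _))// lerD//.
  by apply: ltW; near: m; exact: ((cvg_nrmP _ _).1 yl).
by apply: dist; near: m; exact: nbhs_infty_ge.
Unshelve. all: by end_near. Qed.

Lemma bfun_cvg {psi : X -> R} {C} (y : nat -> X) l : bfun C psi ->
  y @ \oo --> l -> (psi \o y) @ \oo --> psi l.
Proof.
move=> [lp bp] /cvg_nrmP h; apply/cvgrPdist_lt => e e0.
have C0 : 0 < `|C| + 1 by rewrite ltr_wpDl.
have := h (e / (`|C| + 1)); rewrite divr_gt0// => /(_ isT).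
apply: filterS => n hn; rewrite /= -rlinB// (le_lt_trans (bp _))//.
apply: (@le_lt_trans _ _ ((`|C| + 1) * nrm (l - y n))).
  by rewrite ler_wpM2r ?nrm_ge0// (le_trans (ler_norm _))// lerDl.
by rewrite mulrC -ltr_pdivlMr.
Qed.

Lemma bfun_weight {psi : X -> R} {C} : bfun C psi -> 0 < C ->
  bfun 1 (fun x => C^-1 * psi x).
Proof.
move=> [lp bp] C0; split=> [r u v|u]; first by rewrite lp; ring.
by rewrite normrM (ger0_norm (ltW _)) ?invr_gt0// mul1r ler_pdivrMl.
Qed.

(** Approximation uniform over the unit ball of the dual is, by Hahn-Banach, the Cauchy property in
    norm; the limit then represents I. This is the substitute for a vector-valued integral. *)
Lemma vector_of_functional (I : (X -> R) -> R) (y : nat -> X) (e : nat -> R) :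
    (forall psi n, bfun 1 psi -> `|psi (y n) - I psi| <= e n) ->
    e @ \oo --> 0 ->
  exists2 l, y @ \oo --> l & forall psi, bfun 1 psi -> psi l = I psi.
Proof.
move=> hy /cvgrPdist_lt e0.
have cy : cvg (y @ \oo).
  apply: cauchy_nrm => d d0.
  have d3 : 0 < d / 3 by rewrite divr_gt0.
  have [N _ hN] := e0 _ d3; exists N => n Nn.
  apply: (@le_lt_trans _ _ (d / 3 + d / 3)); last by lra.
  apply: nrm_le_bfun => psi hp; rewrite rlinB; last by case: hp.
  have := hN N (leqnn N); have := hN n Nn; rewrite /= !sub0r !normrN => en eN.
  have := hy psi N hp; have := hy psi n hp.
  by rewrite !ler_norml; move: en eN; rewrite !ltr_norml; lra.
have [l yl] := (cvg_ex _).1 cy.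
exists l => // psi hp; have h1 := bfun_cvg hp yl.
have h2 : (psi \o y) @ \oo --> I psi.
  apply/cvgrPdist_le => d d0; have := e0 _ d0; apply: filterS => n.
  rewrite sub0r normrN distrC => en; rewrite (le_trans (hy _ _ hp))//.
  exact: ltW (le_lt_trans (ler_norm _) en).
exact: (cvg_unique _ h1 h2).
Qed.

End VectorLimits.

(** * Expectations under laws and their transforms at integers *)

Section LawCalculus.
Context {R : realType}.
Implicit Types (P : probability R R) (F G : R -> R).

Lemma ev_cst P c : ev P (fun=> c) = c.
Proof. by rewrite /ev Rintegral_cst// [X in fine X]probability_setT mulr1. Qed.

Lemma evD P F G : bmeas setT F -> bmeas setT G ->
  ev P (fun s => F s + G s) = ev P F + ev P G.
Proof. exact: bintD. Qed.

Lemma evB P F G : bmeas setT F -> bmeas setT G ->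
  ev P (fun s => F s - G s) = ev P F - ev P G.
Proof. exact: bintB. Qed.

Lemma evZ P c F : bmeas setT F -> ev P (fun s => c * F s) = c * ev P F.
Proof. exact: bintZ. Qed.

Lemma ev_sum P n (f : 'I_n -> R -> R) : (forall i, bmeas setT (f i)) ->
  ev P (fun s => \sum_(i < n) f i s) = \sum_(i < n) ev P (f i).
Proof. by move=> bf; have [] := bint_sum P measurableT bf. Qed.

Lemma ev_le P F G : bmeas setT F -> bmeas setT G -> (forall s, F s <= G s) ->
  ev P F <= ev P G.
Proof. by move=> bF bG FG; apply: bint_le. Qed.

Lemma ev_norm P F : bmeas setT F -> `|ev P F| <= ev P (fun s => `|F s|).
Proof. by move=> bF; apply: bint_norm. Qed.

Lemma ev_bound P F K : measurable_fun setT F -> (forall s, `|F s| <= K) ->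
  `|ev P F| <= K.
Proof.
move=> mF FK; have := @bint_bound _ _ _ P _ measurableT F K mF (fun s _ => FK s).
by rewrite [X in fine X]probability_setT mulr1.
Qed.

Lemma bcont_bmeas F : bcont F -> bmeas setT F.
Proof.
move=> [cF [K FK] _]; split; first exact: continuous_measurable_fun.
by exists K => s _.
Qed.

Lemma bcontD F G : bcont F -> bcont G -> bcont (fun s => F s + G s).
Proof.
move=> [c1 [K1 k1] m1] [c2 [K2 k2] m2]; split.
- by move=> s; apply: cvgD; [exact: c1|exact: c2].
- by exists (K1 + K2) => s; rewrite (le_trans (ler_normD _ _))// lerD.
- by move=> s; rewrite m1 m2.
Qed.

Lemma bcontZ c F : bcont F -> bcont (fun s => c * F s).
Proof.
move=> [c1 [K1 k1] m1]; split.
- by move=> s; apply: cvgM; [exact: cvg_cst|exact: c1].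
- by exists (`|c| * K1) => s; rewrite normrM ler_wpM2l.
- by move=> s; rewrite m1.
Qed.

Lemma good_ev P : good (ev P).
Proof.
have := @good_measure _ _ _ P setT id (fun=> 1) measurableT (@measurable_id _ _ _)
  (bmeas_cst _ 1).
congr good; apply/funext => F; rewrite /ev.
by apply: eq_Rintegral => s _; rewrite mulr1.
Qed.

Lemma lap_conv P Q j : ev (conv P Q) (ex j) = ev P (ex j) * ev Q (ex j).
Proof.
rewrite conv_int; last exact: bcont_ex.
rewrite mulrC -evZ; last exact: bcont_bmeas (bcont_ex j).
congr ev; apply/funext => s; rewrite [RHS]mulrC -evZ; last exact: bcont_bmeas (bcont_ex j).
by congr ev; apply/funext => r; rewrite exD.
Qed.

Lemma lap_scaled (a : R) j : 0 < a -> ev (expd_scaled a) (ex j.+1) = (1 + a * j.+1%:R)^-1.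
Proof.
move=> a0; have aj : 0 < a * j.+1%:R by rewrite mulr_gt0 ?ltr0n.
rewrite scaled_int; last exact: bcont_ex.
have := expd_kc 0 aj; rewrite expr0n addr0 expr2 invfM mulrA mulfV ?mul1r; last first.
  by rewrite gt_eqF// addr_gt0.
move=> <-; congr ev; apply/funext => s.
rewrite /ex /kc mul0r cos0 mulr1 maxr0_id ?mulr_ge0 ?maxr0_ge0 ?ltW//.
by rewrite mulrA (mulrC a).
Qed.

Lemma lap_unif (t : R) j : 0 < t -> ev (unif_scaled t) (ex j.+1) =
  (1 - expR (- (j.+1%:R * t))) / (t * j.+1%:R).
Proof.
move=> t0; have tj : 0 < t * j.+1%:R by rewrite mulr_gt0 ?ltr0n.
rewrite unif_scaled_int; last exact: bcont_ex.
rewrite unif_int; last first.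
  apply: (bmeas_bcont measurableT (bcont_ex j.+1)); exact: mulrl_measurable.
pose c := t * j.+1%:R.
pose G (u : R) := - (c^-1 * expR (- (c * u))).
transitivity (\int[leb]_(u in `[0, 1]) expR (- (c * u))).
  apply: eq_Rintegral => u; rewrite inE /= in_itv /= => /andP[u0 _].
  rewrite /ex maxr0_id; last exact: mulr_ge0 (ltW t0) u0.
  by rewrite /c mulrA (mulrC _ t).
have dG (u : R) : is_derive u 1 G (expR (- (c * u))).
  by apply: is_derive_eq; rewrite /GRing.scale /=; field; rewrite gt_eqF.
rewrite (seg_ftc (F := G) (@ltr01 R))//.
- by rewrite /G mulr0 oppr0 expR0 /c !mulr1 (mulrC _ t); field; rewrite !gt_eqF ?ltr0n.
- move=> u _; apply: continuous_comp; last exact: continuous_expR.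
  by apply: continuousN; apply: cvgM; [exact: cvg_cst|exact: cvg_id].
Qed.

Lemma unif_eq (f g : R -> R) : bmeas setT f -> bmeas setT g ->
  (forall u, 0 < u -> u <= 1 -> f u = g u) -> ev unif f = ev unif g.
Proof. by move=> bf bg fg; rewrite !unif_int//; apply: seg_eq => //; case: bf. Qed.

Lemma seg_comb (f g h : R -> R) (a b c : R) :
  leb.-integrable `[a, b] (EFin \o f) ->
  leb.-integrable `[a, b] (EFin \o g) ->
  leb.-integrable `[a, b] (EFin \o h) ->
  \int[leb]_(u in `[a, b]) (c * (f u - g u + h u)) =
  c * (\int[leb]_(u in `[a, b]) f u -
    \int[leb]_(u in `[a, b]) g u +
    \int[leb]_(u in `[a, b]) h u).
Proof.
move=> fi gi hi.
have fgi : leb.-integrable `[a, b] (EFin \o (fun u => f u - g u)).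
  exact: (integrableB _ fi gi).
have fghi : leb.-integrable `[a, b] (EFin \o (fun u => f u - g u + h u)).
  exact: (integrableD _ fgi hi).
by rewrite (RintegralZl c _ fghi)// (RintegralD _ fgi hi)// (RintegralB _ fi gi).
Qed.

Lemma bmeas_indic (A : set R) : measurable A -> bmeas setT (\1_A : R -> R).
Proof.
move=> mA; split; first exact: measurable_indic.
by exists 1 => s _; rewrite indicE; case: (_ \in _); rewrite ?normr1 ?normr0.
Qed.

Lemma unif_bound (f : R -> R) K : bmeas setT f -> 0 <= K ->
  (forall u, 0 < u -> u <= 1 -> `|f u| <= K) -> `|ev unif f| <= K.
Proof.
move=> bf K0 fK.
have bg : bmeas setT (fun u => f u * \1_(`]0, 1]%classic : set R) u).
  by apply: bmeasM => //; apply: bmeas_indic.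
rewrite (unif_eq bf bg); last first.
  by move=> u u0 u1; rewrite indicE mem_set ?mulr1//= in_itv /= u0.
apply: ev_bound => [|u]; first by case: bg.
rewrite indicE; case: (boolP (u \in _)) => [|_]; last by rewrite mulr0 normr0.
by rewrite inE /= in_itv /= mulr1 => /andP[u0 u1]; exact: fK.
Qed.

Definition cell (m k : nat) (s : R) : R :=
  \1_(`[k%:R, k.+1%:R[%classic : set R) (m%:R * Num.max s 0).

Lemma bmeas_cell m k : bmeas setT (cell m k).
Proof.
split; last by exists 1 => s _; rewrite /cell indicE; case: (_ \in _); rewrite ?normr1 ?normr0.
by apply: measurableT_comp; [exact: measurable_indic|exact: measurable_scale].
Qed.

(** The m^2 cells of width 1/m cover [0, m[: the single parameter m both refines the mesh and
    exhausts the half-line. *)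
Definition step (m : nat) (c : nat -> R) (s : R) : R :=
  \sum_(k < m ^ 2) c k * cell m k s.

Lemma stepE m c s : (0 < m)%N -> Num.max s 0 < m%:R ->
  exists2 k, step m c s = c k & k%:R <= m%:R * Num.max s 0 < k.+1%:R.
Proof.
move=> m0 sm; set r := m%:R * Num.max s 0.
have r0 : 0 <= r by rewrite mulr_ge0 ?maxr0_ge0.
have /andP[k1 k2] := truncn_itv r0.
set k := Num.truncn r in k1 k2.
have km : (k < m ^ 2)%N.
  rewrite -(ltr_nat R) (le_lt_trans k1)// natrX expr2 ltr_pM2l//.
  by rewrite ltr0n.
exists k; last by rewrite k1.
rewrite /step (bigD1 (Ordinal km))//= {1}/cell indicE mem_set ?mulr1; last first.
  by rewrite /= in_itv /= k1.
rewrite big1 ?addr0// => i /eqP ik; rewrite /cell indicE memNset ?mulr0//= in_itv /=.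
move=> h; apply: ik; apply/val_inj => /=.
by rewrite -(truncn_def h).
Qed.

Lemma step_out m c s : m%:R <= s -> step m c s = 0.
Proof.
move=> ms; apply: big1 => k _; rewrite /cell indicE memNset ?mulr0//= in_itv /=.
have s0 : 0 <= s by rewrite (le_trans _ ms).
rewrite maxr0_id// => /andP[_]; apply/negP; rewrite -leNgt.
apply: (@le_trans _ _ (m%:R * m%:R)); last by rewrite ler_wpM2l.
by rewrite -natrM ler_nat mulnn; exact: ltn_ord.
Qed.

Lemma bmeas_step m c : bmeas setT (step m c).
Proof.
have [] // := @bint_sum _ _ _ (@unif R) setT measurableT (m ^ 2)%N
  (fun (k : 'I__) s => c k * cell m k s).
by move=> k; apply: bmeasZ; exact: bmeas_cell.
Qed.

Lemma ev_tail P : (fun n => ev P (\1_(`[n.+1%:R, +oo[%classic : set R))) @ \oo --> 0.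
Proof.
have -> : 0 = ev P (fun=> 0) by rewrite ev_cst.
apply: (@bint_dct _ _ _ P setT measurableT (fun n => \1_(`[n.+1%:R, +oo[%classic : set R))
  _ 1).
- by move=> n; exact: measurable_indic.
- exact: measurable_cst.
- move=> n s _; rewrite indicE; case: (_ \in _) => //=.
    by rewrite normr1.
  by rewrite normr0.
move=> s _; apply/cvgrPdist_le => e e0; near=> n.
rewrite indicE memNset ?subrr ?normr0 ?ltW//= in_itv /= andbT.
apply/negP; rewrite -ltNge (@lt_trans _ _ n%:R) ?ltr_nat//.
by near: n; exact: nbhs_infty_gtr.
Unshelve. all: by end_near. Qed.

Lemma expR_lnN (u : R) : 0 < u -> expR (- ln u) = u^-1.
Proof. by move=> u0; rewrite expRN lnK. Qed.

End LawCalculus.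

(** * Complex Laplace transforms and the logarithm *)

Section ComplexLaplace.
Context {R : realType}.
Implicit Types (P Q : probability R R) (z : R[i]).

Definition lap P z : R[i] :=
  ev P (kc (complex.Re z) (complex.Im z)) +i* ev P (ks (complex.Re z) (complex.Im z)).

Lemma complex_eqP (z w : R[i]) : complex.Re z = complex.Re w ->
  complex.Im z = complex.Im w -> z = w.
Proof. by move: z w => [a b] [c d] /= -> ->. Qed.

Lemma kcD (a b s r : R) : kc a b (Num.max s 0 + Num.max r 0) =
  kc a b s * kc a b r + - (ks a b s * ks a b r).
Proof.
rewrite /kc /ks [Num.max (_ + _) 0]maxr0_id ?addr_ge0 ?maxr0_ge0//.
rewrite !mulrDr opprD expRD cosD; ring.
Qed.

Lemma ksD (a b s r : R) : ks a b (Num.max s 0 + Num.max r 0) =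
  kc a b s * ks a b r + ks a b s * kc a b r.
Proof.
rewrite /kc /ks [Num.max (_ + _) 0]maxr0_id ?addr_ge0 ?maxr0_ge0//.
rewrite !mulrDr opprD expRD sinD; ring.
Qed.

Lemma lap_convE P Q z : 0 < complex.Re z -> lap (conv P Q) z = lap P z * lap Q z.
Proof.
move: z => [a b] /= a0; rewrite /lap /=.
have bc := bcont_kc b (ltW a0); have bs := bcont_ks b (ltW a0).
have mc := bcont_bmeas bc; have ms := bcont_bmeas bs.
apply: complex_eqP => /=.
- rewrite (conv_int _ _ bc).
  rewrite (_ : (fun s => ev Q _) = fun s => ev Q (kc a b) * kc a b s -
      ev Q (ks a b) * ks a b s).
    rewrite evB ?evZ//; [by ring|exact: bmeasZ|exact: bmeasZ].
  apply/funext => s.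
  rewrite (_ : (fun r => _) = fun r => kc a b s * kc a b r - ks a b s * ks a b r); last first.
    by apply/funext => r; rewrite kcD.
  by rewrite evB ?evZ//; [ring|exact: bmeasZ|exact: bmeasZ].
- rewrite (conv_int _ _ bs).
  rewrite (_ : (fun s => ev Q _) = fun s => ev Q (ks a b) * kc a b s +
      ev Q (kc a b) * ks a b s).
    rewrite evD ?evZ//; [by ring|exact: bmeasZ|exact: bmeasZ].
  apply/funext => s.
  rewrite (_ : (fun r => _) = fun r => kc a b s * ks a b r + ks a b s * kc a b r); last first.
    by apply/funext => r; rewrite ksD.
  by rewrite evD ?evZ//; [ring|exact: bmeasZ|exact: bmeasZ].
Qed.

Lemma kc_scale (c a b s : R) : 0 <= c -> kc a b (c * Num.max s 0) = kc (c * a) (c * b) s.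
Proof.
move=> c0; rewrite /kc [Num.max (c * _) 0]maxr0_id ?mulr_ge0 ?maxr0_ge0//.
by rewrite !mulrA (mulrC a) (mulrC b).
Qed.

Lemma ks_scale (c a b s : R) : 0 <= c -> ks a b (c * Num.max s 0) = ks (c * a) (c * b) s.
Proof.
move=> c0; rewrite /ks [Num.max (c * _) 0]maxr0_id ?mulr_ge0 ?maxr0_ge0//.
by rewrite !mulrA (mulrC a) (mulrC b).
Qed.

Lemma expd_scaled_kc (c a b : R) : 0 < c -> 0 < a -> ev (expd_scaled c) (kc a b) =
  (1 + c * a) / ((1 + c * a) ^+ 2 + (c * b) ^+ 2).
Proof.
move=> c0 a0; rewrite (scaled_int _ (bcont_kc b (ltW a0))) -expd_kc ?mulr_gt0//.
by congr ev; apply/funext => s; rewrite kc_scale// ltW.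
Qed.

Lemma expd_scaled_ks (c a b : R) : 0 < c -> 0 < a -> ev (expd_scaled c) (ks a b) =
  - (c * b) / ((1 + c * a) ^+ 2 + (c * b) ^+ 2).
Proof.
move=> c0 a0; rewrite (scaled_int _ (bcont_ks b (ltW a0))) -expd_ks ?mulr_gt0//.
by congr ev; apply/funext => s; rewrite ks_scale// ltW.
Qed.

Lemma lap_exp z : 0 < complex.Re z -> lap (expd_scaled 1) z = (1 + z)^-1.
Proof.
move: z => [a b] /= a0; rewrite /lap /= expd_scaled_kc// expd_scaled_ks// !mul1r.
by apply: complex_eqP => /=; rewrite add0r// mulNr.
Qed.

Lemma unif_ftc (F f g : R -> R) : bmeas setT g ->
  (forall u, 0 < u -> u <= 1 -> g u = f u) ->
  (forall u : R, 0 <= u -> is_derive u 1 F (f u)) ->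
  (forall u : R, 0 <= u -> {for u, continuous f}) -> ev unif g = F 1 - F 0.
Proof.
move=> bg gf dF cf; rewrite unif_int// -(seg_ftc ltr01 dF cf).
by apply: seg_eq => //; case: bg.
Qed.

Lemma div_quot (v w c : R) : v != 0 -> w != 0 -> (v / w)^-1 * (c / w) = c / v.
Proof. by move=> v0 w0; field; rewrite v0 w0. Qed.

Section LogDerivative.
Variables (A B : R -> R) (u dA dB : R).
Hypotheses (hA : is_derive u 1 A dA) (hB : is_derive u 1 B dB) (A0 : 0 < A u).

Let N (x : R) := A x ^+ 2 + B x ^+ 2.

Let N0 : 0 < N u.
Proof. by rewrite /N ltr_pwDl ?sqr_ge0// exprn_gt0. Qed.

(** Real part of the logarithmic derivative (A' + i B')/(A + i B); [is_derive_arg] is the imaginary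
    part, the argument being atan (B/A) because A > 0. *)
Lemma is_derive_lnN : is_derive u 1 (fun x => ln (N x) / 2) ((A u * dA + B u * dB) / N u).
Proof.
have dN : is_derive u 1 N (2 * (A u * dA + B u * dB)).
  by apply: is_derive_eq; rewrite /GRing.scale /=; ring.
have dl := is_derive1_comp (is_derive1_ln N0) dN.
by apply: is_derive_eq; rewrite /GRing.scale /=; field; rewrite gt_eqF.
Qed.

Lemma is_derive_arg : is_derive u 1 (fun x => atan (B x / A x)) ((A u * dB - B u * dA) / N u).
Proof.
have un : A u != 0 by rewrite gt_eqF.
have dV := is_deriveV un hA.
have dq : is_derive u 1 (fun x => B x * (A x)^-1) ((A u * dB - B u * dA) / A u ^+ 2).
  by apply: is_derive_eq; rewrite /GRing.scale /=; field; exact: un.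
have D1 : A u ^+ 2 + B u ^+ 2 != 0 by rewrite gt_eqF.
have := is_derive1_comp (is_derive1_atan _) dq; congr is_derive; rewrite /N.
move: un D1; move: (A u) (B u) => r s r0 D1.
have -> : 1 + (s / r) ^+ 2 = (r ^+ 2 + s ^+ 2) / r ^+ 2 by field.
exact: div_quot D1 (expf_neq0 2 r0).
Qed.

Lemma continuous_divN (p : R -> R) dp : is_derive u 1 p dp ->
  {for u, continuous (fun x => p x / N x)}.
Proof.
move=> hp; apply: cvgM.
  by apply: differentiable_continuous; apply/derivable1_diffP; have [] := hp.
apply: cvgV; first by rewrite gt_eqF.
apply: differentiable_continuous; apply/derivable1_diffP; exact: ex_derive.
Qed.

End LogDerivative.

Section LogTransforms.
Variables (a b : R).
Hypothesis a0 : 0 < a.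
Let z : R[i] := a +i* b.
Let N := a ^+ 2 + b ^+ 2.

Let N0 : N != 0.
Proof. by rewrite gt_eqF// ltr_pwDl ?sqr_ge0// exprn_gt0. Qed.

Let scale_pos (u : R) : 0 <= u -> 0 < 1 + u * a.
Proof. by move=> u0; rewrite ltr_pwDl// mulr_ge0// ltW. Qed.

Let D (u : R) := (1 + u * a) ^+ 2 + (u * b) ^+ 2.
Let D0 (u : R) : 0 <= u -> 0 < D u.
Proof. by move=> u0; rewrite /D ltr_pwDl ?sqr_ge0// exprn_gt0// scale_pos. Qed.
Let Lr (u : R) := ln (D u) / 2.
Let Li (u : R) := atan ((u * b) / (1 + u * a)).

Let dscale (c u : R) : is_derive u 1 (fun u : R => u * c) c.
Proof. by apply: is_derive_eq; rewrite /GRing.scale /=; ring. Qed.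

Let dscale1 (u : R) : is_derive u 1 (fun u : R => 1 + u * a) a.
Proof. by apply: is_derive_eq; rewrite /GRing.scale /=; ring. Qed.

Let dLr (u : R) : 0 <= u -> is_derive u 1 Lr (((1 + u * a) * a + u * b * b) / D u).
Proof. by move=> u0; exact: is_derive_lnN (dscale1 u) (dscale b u) (scale_pos u0). Qed.

Let dLi (u : R) : 0 <= u -> is_derive u 1 Li (((1 + u * a) * b - u * b * a) / D u).
Proof. by move=> u0; exact: is_derive_arg (dscale1 u) (dscale b u) (scale_pos u0). Qed.

Let cont_quot (p : R -> R) (u dp : R) : 0 <= u -> is_derive u 1 p dp ->
  {for u, continuous (fun u : R => p u / D u)}.
Proof. by move=> u0 hp; exact: (continuous_divN (dscale1 u) (dscale b u) (scale_pos u0) hp). Qed.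

Let Lr0 : Lr 0 = 0. Proof. by rewrite /Lr /D !mul0r addr0 expr1n expr0n addr0 ln1 mul0r. Qed.
Let Li0 : Li 0 = 0. Proof. by rewrite /Li !mul0r atan0. Qed.

(** With z = a + ib, 1/(1+uz) has the primitive log(1+uz)/z in u; this is its real part, and
    [low_ks] its imaginary part. *)
Lemma low_kc : ev low_law (kc a b) = (a * Lr 1 + b * Li 1) / N.
Proof.
have [bm ->] := low_int (bcont_kc b (ltW a0)).
pose G (u : R) := (a * Lr u + b * Li u) / N.
transitivity (G 1 - G 0); last by rewrite /G Lr0 Li0 !mulr0 addr0 mul0r subr0.
apply: (unif_ftc (f := fun u => (1 + u * a) / D u) bm).
- by move=> u u0 _; rewrite expd_scaled_kc.
- move=> u u0; have d1 := dLr u0; have d2 := dLi u0.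
  apply: is_derive_eq; rewrite /GRing.scale /=.
  have := D0 u0; move: N0; rewrite /N => n0 /lt0r_neq0 d0.
  by field; rewrite n0 d0.
- by move=> u u0; apply: cont_quot (u0) _; exact: ex_derive.
Qed.

Lemma low_ks : ev low_law (ks a b) = (a * Li 1 - b * Lr 1) / N.
Proof.
have [bm ->] := low_int (bcont_ks b (ltW a0)).
pose G (u : R) := (a * Li u - b * Lr u) / N.
transitivity (G 1 - G 0); last by rewrite /G Lr0 Li0 !mulr0 subr0 mul0r subr0.
apply: (unif_ftc (f := fun u => - (u * b) / D u) bm).
- by move=> u u0 _; rewrite expd_scaled_ks.
- move=> u u0; have d1 := dLr u0; have d2 := dLi u0.
  apply: is_derive_eq; rewrite /GRing.scale /=.
  have := D0 u0; move: N0; rewrite /N => n0 /lt0r_neq0 d0.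
  by field; rewrite n0 d0.
- by move=> u u0; apply: cont_quot (u0) _; exact: ex_derive.
Qed.

Let shift_pos (u : R) : 0 <= u -> 0 < u + a.
Proof. by move=> u0; rewrite ltr_wpDl. Qed.

Let E (u : R) := (u + a) ^+ 2 + b ^+ 2.
Let E0 (u : R) : 0 <= u -> 0 < E u.
Proof. by move=> u0; rewrite /E ltr_pwDl ?sqr_ge0// exprn_gt0// shift_pos. Qed.
Let Hr (u : R) := ln (E u) / 2.
Let Hi (u : R) := atan (b / (u + a)).

Let dshift (u : R) : is_derive u 1 (fun u : R => u + a) 1.
Proof. by apply: is_derive_eq; rewrite /GRing.scale /=; ring. Qed.

Let dHr (u : R) : 0 <= u -> is_derive u 1 Hr (((u + a) * 1 + b * 0) / E u).
Proof. by move=> u0; exact: is_derive_lnN (dshift u) (is_derive_cst b u 1) (shift_pos u0). Qed.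

Let dHi (u : R) : 0 <= u -> is_derive u 1 Hi (((u + a) * 0 - b * 1) / E u).
Proof. by move=> u0; exact: is_derive_arg (dshift u) (is_derive_cst b u 1) (shift_pos u0). Qed.

Let cont_quotE (p : R -> R) (u dp : R) : 0 <= u -> is_derive u 1 p dp ->
  {for u, continuous (fun u : R => p u / E u)}.
Proof. by move=> u0 hp; exact: (continuous_divN (dshift u) (is_derive_cst b u 1) (shift_pos u0) hp). Qed.

(** With z = a + ib, u/(u+z) has the primitive u - z log(u+z) in u; real part here, imaginary part
    in [high_ks]. *)
Lemma high_kc : ev high_law (kc a b) = 1 - a * (Hr 1 - Hr 0) + b * (Hi 1 - Hi 0).
Proof.
have [bm ->] := high_int (bcont_kc b (ltW a0)).
pose G (u : R) := u - a * Hr u + b * Hi u.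
transitivity (G 1 - G 0); last by rewrite /G; ring.
apply: (unif_ftc (f := fun u => u * (u + a) / E u) bm).
- move=> u u0 _; rewrite expR_lnN// expd_scaled_kc ?invr_gt0//.
  have -> : (1 + u^-1 * a) ^+ 2 + (u^-1 * b) ^+ 2 = E u / u ^+ 2.
    by rewrite /E; field; rewrite gt_eqF.
  move: (E u) (lt0r_neq0 (E0 (ltW u0))) => e e0.
  by field; rewrite (gt_eqF u0) e0.
- move=> u u0; have d1 := dHr u0; have d2 := dHi u0.
  apply: is_derive_eq; rewrite /GRing.scale /=.
  have := E0 u0; rewrite /E => /lt0r_neq0 e0.
  by field; rewrite e0.
- by move=> u u0; apply: cont_quotE (u0) _; exact: ex_derive.
Qed.

Lemma high_ks : ev high_law (ks a b) = - a * (Hi 1 - Hi 0) - b * (Hr 1 - Hr 0).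
Proof.
have [bm ->] := high_int (bcont_ks b (ltW a0)).
pose G (u : R) := - a * Hi u - b * Hr u.
transitivity (G 1 - G 0); last by rewrite /G; ring.
apply: (unif_ftc (f := fun u => - (b * u) / E u) bm).
- move=> u u0 _; rewrite expR_lnN// expd_scaled_ks ?invr_gt0//.
  have -> : (1 + u^-1 * a) ^+ 2 + (u^-1 * b) ^+ 2 = E u / u ^+ 2.
    by rewrite /E; field; rewrite gt_eqF.
  move: (E u) (lt0r_neq0 (E0 (ltW u0))) => e e0.
  by field; rewrite (gt_eqF u0) e0.
- move=> u u0; have d1 := dHr u0; have d2 := dHi u0.
  apply: is_derive_eq; rewrite /GRing.scale /=.
  have := E0 u0; rewrite /E => /lt0r_neq0 e0.
  by field; rewrite e0.
- by move=> u u0; apply: cont_quotE (u0) _; exact: ex_derive.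
Qed.

End LogTransforms.

Lemma clogE (a b : R) : 0 < a -> clog (a +i* b) = (ln (a ^+ 2 + b ^+ 2) / 2) +i* atan (b / a).
Proof.
move=> a0; have N0 : 0 < a ^+ 2 + b ^+ 2 by rewrite ltr_pwDl ?sqr_ge0// exprn_gt0.
rewrite /clog /=; set s := Num.sqrt _.
have s0 : 0 < s by rewrite sqrtr_gt0.
apply: complex_eqP => /=; last by ring.
by rewrite -(sqr_sqrtr (ltW N0)) -/s lnXn//; field.
Qed.

Lemma lap_low z : 0 < complex.Re z -> lap low_law z = clog (1 + z) / z.
Proof.
move: z => [a b] /= a0; rewrite /lap /= (low_kc b a0) (low_ks b a0).
have -> : 1 + (a +i* b) = (1 + a) +i* b by apply: complex_eqP => /=; rewrite ?add0r.
rewrite clogE ?addr_gt0//; have N0 : a ^+ 2 + b ^+ 2 != 0.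
  by rewrite gt_eqF// ltr_pwDl ?sqr_ge0// exprn_gt0.
rewrite !mul1r; apply: complex_eqP => /=; by field.
Qed.

Lemma lap_high z : 0 < complex.Re z ->
  lap high_law z = 1 - z * (clog (1 + z) - clog z).
Proof.
move: z => [a b] /= a0; rewrite /lap /= (high_kc b a0) (high_ks b a0).
have -> : 1 + (a +i* b) = (1 + a) +i* b by apply: complex_eqP => /=; rewrite ?add0r.
rewrite !clogE ?addr_gt0// !add0r; apply: complex_eqP => /=; ring.
Qed.

(** Write log z = log(1+z) - (log(1+z) - log z) and multiply by z/(1+z)^2: the first term is z^2
    q/(1+z)^2 with z/(1+z) = 1 - e, and z times the bracket is 1 - n. The squares are expanded so
    that each term is the transform of a law. *)
Lemma lap_elog z : 0 < complex.Re z ->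
  let E := lap (expd_scaled 1) z in let Q := lap low_law z in
  Q - 2 * (E * Q) + E * (E * Q) - E * E + E * (E * lap high_law z) = elog z.
Proof.
move=> z0 /=; rewrite lap_exp// lap_low// lap_high// /elog /ereg.
have n0 : z != 0 by apply: contraTneq z0 => ->; rewrite ltxx.
have n1 : 1 + z != 0.
  apply: contraTneq z0 => /(congr1 (@complex.Re R)); move: z {n0} => [a b] /= h.
  by rewrite -leNgt; move: h; lra.
by field; rewrite n0 n1.
Qed.

Lemma lap_ereg z : 0 < complex.Re z ->
  let E := lap (expd_scaled 1) z in E - E * E = ereg z.
Proof.
move=> z0 /=; rewrite lap_exp// /ereg.
have n1 : 1 + z != 0.
  apply: contraTneq z0 => /(congr1 (@complex.Re R)); move: z => [a b] /= h.
  by rewrite -leNgt; move: h; lra.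
by field; rewrite n1.
Qed.

End ComplexLaplace.

(** * Signed combinations of laws *)

Section Combinations.
Context {R : realType}.
Implicit Types (P : probability R R) (s : seq (R * probability R R)).

Definition ev_comb s F : R := \sum_(p <- s) p.1 * ev p.2 F.

Definition lap_comb s z : R[i] := \sum_(p <- s) p.1%:C * lap p.2 z.

Lemma good_ev_comb s : good (ev_comb s).
Proof.
elim: s => [|[c P] s IH].
  have g := @good_ev R unif; have := good_comb (a := -1) g g; congr good.
  by apply/funext => F; rewrite /ev_comb big_nil mulN1r subrr.
have := good_comb (a := c) IH (@good_ev R P); congr good.
by apply/funext => F; rewrite /ev_comb big_cons addrC.
Qed.

Lemma kc_ex (j : nat) : kc (j%:R : R) 0 = ex j.
Proof. by apply/funext => s; rewrite /kc mul0r cos0 mulr1. Qed.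

Lemma ks_ex (j : nat) : ks (j%:R : R) 0 = fun=> 0.
Proof. by apply/funext => s; rewrite /ks mul0r sin0 mulr0 oppr0. Qed.

Lemma lap_ex P (j : nat) : lap P (j.+1%:R : R)%:C = (ev P (ex j.+1))%:C.
Proof. by rewrite /lap /= kc_ex ks_ex ev_cst. Qed.

Lemma lap_comb_ex s (j : nat) : lap_comb s (j.+1%:R : R)%:C = (ev_comb s (ex j.+1))%:C.
Proof.
rewrite /lap_comb /ev_comb rmorph_sum; apply: eq_bigr => p _.
by rewrite lap_ex rmorphM.
Qed.

(* The expansions of (1 - E)^2 Q - E^2 (1 - N) and E - E^2, with convolution as product. *)
Definition log_comb (E Q N : probability R R) : seq (R * probability R R) :=
  [:: (1, Q); (-2, conv E Q); (1, conv E (conv E Q)); (-1, conv E E); (1, conv E (conv E N))].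

Definition reg_comb (E : probability R R) : seq (R * probability R R) :=
  [:: (1, E); (-1, conv E E)].

Lemma lap_log_comb E Q N z : 0 < complex.Re z ->
  lap_comb (log_comb E Q N) z = lap Q z - 2 * (lap E z * lap Q z) +
    lap E z * (lap E z * lap Q z) - lap E z * lap E z + lap E z * (lap E z * lap N z).
Proof.
move=> z0; rewrite /lap_comb !big_cons big_nil /= !lap_convE//.
move: (lap Q z) (lap N z) (lap E z) => [q1 q2] [n1 n2] [e1 e2].
by apply: complex_eqP => /=; ring.
Qed.

Lemma lap_reg_comb E z : 0 < complex.Re z ->
  lap_comb (reg_comb E) z = lap E z - lap E z * lap E z.
Proof.
move=> z0; rewrite /lap_comb !big_cons big_nil /= !lap_convE//.
move: (lap E z) => [e1 e2].
by apply: complex_eqP => /=; ring.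
Qed.

Definition elog_comb := log_comb (expd_scaled 1) low_law high_law.
Definition ereg_comb := reg_comb (expd_scaled 1).

Lemma lap_elog_comb z : 0 < complex.Re z -> elog z = lap_comb elog_comb z.
Proof. by move=> z0; rewrite /elog_comb lap_log_comb// -lap_elog. Qed.

Lemma lap_ereg_comb z : 0 < complex.Re z -> ereg z = lap_comb ereg_comb z.
Proof. by move=> z0; rewrite /ereg_comb lap_reg_comb// -lap_ereg. Qed.

End Combinations.

(** * Bounded densities with respect to one finite measure *)

Section Densities.
Context {R : realType}.
Implicit Types (mu nu : {finite_measure set R -> \bar R}).

(** The Radon-Nikodym derivative is at most 1 almost everywhere: on the set B where it exceeds 1,
    the integral of f - 1 is nu B - mu B <= 0, so B is null. It can therefore be cut at 1, which
    gives the bounded density demanded by [hp]. *)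
Lemma bounded_density mu nu :
  (forall A, measurable A -> (nu A <= mu A)%E) ->
  exists2 h : R -> R, bmeas setT h &
    forall F : R -> R, bmeas setT F -> \int[nu]_s F s = \int[mu]_s (F s * h s).
Proof.
move=> le_nu.
have numu : nu `<< mu.
  apply/null_content_dominatesP => A mA A0; apply/eqP.
  by rewrite -measure_le0 -A0 le_nu.
pose f := Radon_Nikodym_SigmaFinite.f nu mu.
have f0 x : (0 <= f x)%E by exact: Radon_Nikodym_SigmaFinite.f_ge0.
have ff x : f x \is a fin_num by exact: Radon_Nikodym_SigmaFinite.f_fin_num.
have fi : mu.-integrable setT f by exact: Radon_Nikodym_SigmaFinite.f_integrable.
have mf : measurable_fun setT f by exact: measurable_int fi.
pose B := [set x | (1 < f x)%E].
have mB : measurable B.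
  by rewrite /B -[X in measurable X]setTI; exact: emeasurable_fun_o_infty.
have B0 : mu B = 0%E.
  have fiB : mu.-integrable B f by exact: integrableS fi.
  have i1 : mu.-integrable B (cst 1%E) by exact: finite_measure_integrable_cst.
  have mg : measurable_fun B (fun x => f x - 1)%E.
    apply: measurable_int (_ : mu.-integrable B _); exact: integrableB.
  have int0 : (\int[mu]_(x in B) `|f x - 1| = 0)%E.
    rewrite (eq_integral (fun x => f x - 1)%E); last first.
      by move=> x; rewrite inE => Bx; rewrite gee0_abs// sube_ge0 ?ltW.
    apply/eqP; rewrite eq_le; apply/andP; split; last first.
      by apply: integral_ge0 => x Bx; rewrite sube_ge0 ?ltW.
    rewrite integralB// integral_cst// mul1e -Radon_Nikodym_SigmaFinite.f_integral//.
    by rewrite sube_le0 le_nu.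
  have [/(_ int0) [N [mN N0 BN]] _] := ae_eq_integral_abs mu mB mg.
  apply/eqP; rewrite -measure_le0 -N0 le_measure ?inE//.
  apply: subset_trans BN => x Bx /= /(_ Bx).
  move: Bx; rewrite /B /= -(fineK (ff x)) lte_fin => h1 [] h2.
  by move: h1 h2; lra.
pose h x := Num.min (fine (f x)) 1.
exists h.
  split; last first.
    exists 1 => x _; rewrite ger0_norm ?ge_min ?lexx ?orbT//.
    by rewrite le_min ler01 fine_ge0.
  by apply: measurable_minr => //; apply: measurableT_comp.
move=> F bF; rewrite /Rintegral; congr fine.
have Fi := bmeas_integrable nu measurableT bF.
rewrite -(Radon_Nikodym_change_of_variables numu measurableT Fi).
have mF : measurable_fun setT (EFin \o F) := measurable_int _ Fi.
have mh : measurable_fun setT h.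
  by apply: measurable_minr => //; apply: measurableT_comp.
have fh : ae_eq mu setT (Radon_Nikodym (charge_of_finite_measure nu) mu) (EFin \o h).
  apply: ae_eq_trans (ae_eq_sym (ae_eq_Radon_Nikodym_SigmaFinite numu measurableT)) _.
  exists B; split=> // x /= /not_implyP[_ fx]; rewrite /B /= ltNge; apply/negP => fx1; apply: fx.
  rewrite /h /= min_l ?fineK//.
  by rewrite -lee_fin fineK.
apply: ae_eq_integral => //.
- apply: emeasurable_funM => //; apply: measurable_int (Radon_Nikodym_integrable _) => //.
- by apply/measurable_EFinP; apply: measurable_funM => //; case: bF.
rewrite [X in ae_eq _ _ _ X](_ : _ = ((EFin \o F) \* (EFin \o h))%E).
  exact: ae_eqe_mul2l.
by apply/funext => s.
Qed.

Section MeasureSum.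
Variables mu nu : {finite_measure set R -> \bar R}.

Definition measure_sum : set R -> \bar R := measure_add mu nu.

HB.instance Definition _ := Measure.on measure_sum.

Let fin_num_measure_sum : fin_num_fun measure_sum.
Proof.
move=> A mA; rewrite /measure_sum measure_addE fin_numD.
by rewrite !fin_num_measure.
Qed.

HB.instance Definition _ := @Measure_isFinite.Build _ _ _ measure_sum fin_num_measure_sum.

End MeasureSum.

(** The sum of the measures involved dominates each of them; the dominating measure grows by one law
    at a time, and the density obtained so far is rewritten with respect to the new one. *)
Lemma ev_comb_density s : exists (mu : {finite_measure set R -> \bar R}) (h : R -> R),
  bmeas setT h /\ forall F, bmeas setT F -> ev_comb s F = \int[mu]_r (F r * h r).
Proof.
elim: s => [|[c P] s [mu [h [bh hE]]]].
  exists (@unif R), (fun=> 0); split=> [|F bF]; first exact: bmeas_cst.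
  rewrite /ev_comb big_nil -[LHS](ev_cst (@unif R)) /ev; apply: eq_Rintegral => r _.
  by rewrite mulr0.
have [|h1 b1 e1] := @bounded_density (measure_sum mu P) mu.
  by move=> A mA; change (mu A <= measure_add mu P A)%E; rewrite measure_addE leeDl.
have [|h2 b2 e2] := @bounded_density (measure_sum mu P) P.
  by move=> A mA; change (P A <= measure_add mu P A)%E; rewrite measure_addE leeDr.
exists (measure_sum mu P), (fun r => h r * h1 r + c * h2 r); split.
  by apply: bmeasD; [exact: bmeasM|exact: bmeasZ].
move=> F bF; rewrite /ev_comb big_cons /= -/(ev_comb s F) hE// /ev e2//.
have bFh : bmeas setT (fun r => F r * h r) by exact: bmeasM.
rewrite (e1 _ bFh) -bintZ//; last exact: bmeasM.
rewrite -bintD//; last 2 first.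
- by apply: bmeasZ; exact: bmeasM.
- exact: bmeasM.
by apply: eq_Rintegral => r _; ring.
Qed.

Lemma ev_comb_pos s F : bmeas setT F -> (forall p, List.In p s -> nonneg_law p.2) ->
  ev_comb s (fun r => F r * \1_(`[0, +oo[%classic : set R) r) = ev_comb s F.
Proof.
move=> bF; have bFD : bmeas setT (fun r => F r * \1_(`[0, +oo[%classic : set R) r).
  by apply: bmeasM => //; exact: bmeas_indic.
elim: s => [|p s IH] hs; first by rewrite /ev_comb !big_nil.
rewrite /ev_comb !big_cons -!/(ev_comb s _) IH; last by move=> q qs; apply: hs; right.
congr (_ * _ + _); have hp := hs p (or_introl erefl).
rewrite -(hp _ bF) -(hp _ bFD); congr ev; apply/funext => r.
by rewrite indicE mem_set ?mulr1//= in_itv /= maxr0_ge0.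
Qed.

Lemma ev_comb_pos_density s : (forall p, List.In p s -> nonneg_law p.2) ->
  exists (mu : {finite_measure set R -> \bar R}) (h : R -> R),
  bmeas setT h /\ forall F, bmeas setT F ->
    ev_comb s F = \int[mu]_(r in `[0, +oo[) (F r * h r).
Proof.
move=> hs; have [mu [h [bh hE]]] := ev_comb_density s.
exists mu, h; split=> // F bF.
rewrite -(ev_comb_pos bF hs) hE; last by apply: bmeasM => //; exact: bmeas_indic.
rewrite [RHS]Rintegral_mkcond; apply: eq_Rintegral => r _.
by rewrite patchE indicE; case: ifP => _; rewrite ?mulr1// mulr0 mul0r.
Qed.

End Densities.

(** * The Hille-Phillips calculus of probability laws *)

Section Semigroup.
Context {R : realType} {X : completeNormedModType R[i]}.
Variables (T : R -> X -> X) (M : R).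
Hypothesis M1 : 1 <= M.
Hypothesis T_linear : forall s (a : R[i]) (u v : X), T s (a *: u + v) = a *: T s u + T s v.
Hypothesis T0 : forall x, T 0 x = x.
Hypothesis TD : forall s t, 0 <= s -> 0 <= t -> forall x, T (s + t) x = T s (T t x).
Hypothesis T_cont0 : forall x, (fun s => T s x) @ 0^'+ --> x.
Hypothesis T_bound : forall s, 0 <= s -> forall x, nrm (T s x) <= M * nrm x.
Implicit Types (psi : X -> R) (P : probability R R) (x : X).

Let M0 : 0 <= M. Proof. exact: le_trans M1. Qed.

Lemma T_lin_add s u v : T s (u + v) = T s u + T s v.
Proof. by rewrite -[u]scale1r T_linear !scale1r. Qed.

Lemma T_lin0 s : T s 0 = 0.
Proof. by apply: (addrI (T s 0)); rewrite -T_lin_add !addr0. Qed.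

Lemma T_linZ s a u : T s (a *: u) = a *: T s u.
Proof. by rewrite -[a *: u]addr0 T_linear T_lin0 addr0. Qed.

Lemma T_linB s u v : T s (u - v) = T s u - T s v.
Proof. by rewrite T_lin_add -scaleN1r T_linZ scaleN1r. Qed.

(** Orbits are uniformly continuous on the whole half-line: T(a+b)x - T(a)x = T(a)(T(b)x - x), and
    T(a) is bounded by M. *)
Lemma T_modulus x e : 0 < e -> exists2 d, 0 < d & forall s r, 0 <= s -> 0 <= r ->
  `|s - r| < d -> nrm (T s x - T r x) <= e.
Proof.
move=> e0; have eM : 0 < e / M by rewrite divr_gt0// (lt_le_trans ltr01).
have [d /= d0 hd] := (cvg_nrmP _ _).1 (@T_cont0 x) _ eM.
exists d => // s r s0 r0.
have h a b : 0 <= a -> 0 < b -> b < d -> nrm (T (a + b) x - T a x) <= e.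
  move=> a0 b0 bd; rewrite TD ?(ltW b0)// -T_linB (le_trans (T_bound a0 _))//.
  rewrite mulrC -ler_pdivlMr ?(lt_le_trans ltr01)// nrmB ltW//.
  by apply: hd => //=; rewrite sub0r normrN gtr0_norm.
have [sr|sr|->] := ltgtP s r; last by move=> _; rewrite subrr nrm0 ltW.
- rewrite ltr0_norm ?subr_lt0// opprB => srd; rewrite nrmB.
  by have := h s (r - s) s0; rewrite subrKC subr_gt0; apply.
- rewrite gtr0_norm ?subr_gt0// => srd.
  by have := h r (s - r) r0; rewrite subrKC subr_gt0; apply.
Qed.

Definition orb psi x (s : R) : R := psi (T (Num.max s 0) x).

Lemma orb_bound psi C x s : 0 <= C -> bfun C psi -> `|orb psi x s| <= C * M * nrm x.
Proof.
move=> C0 [_ bp]; rewrite (le_trans (bp _))// -mulrA ler_wpM2l//.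
by apply: T_bound; exact: maxr0_ge0.
Qed.

Lemma bcont_orb psi C x : 0 <= C -> bfun C psi -> bcont (orb psi x).
Proof.
move=> C0 hp; have [lp bp] := hp; split.
- move=> s; apply/cvgrPdist_le => e e0.
  have C1 : 0 < C + 1 by rewrite ltr_wpDl.
  have [d d0 hd] := T_modulus x (divr_gt0 e0 C1).
  apply: filterS ((cvgrPdist_lt _ _).1 (@continuous_maxr0 R s) _ d0) => t hst.
  have h := hd _ _ (maxr0_ge0 _) (maxr0_ge0 _) hst.
  rewrite -rlinB// (le_trans (bp _))//.
  apply: (@le_trans _ _ ((C + 1) * (e / (C + 1)))).
    by apply: ler_pM => //; [exact: nrm_ge0|rewrite lerDl].
  by rewrite mulrC divfK// gt_eqF.
- by exists (C * M * nrm x) => s; exact: orb_bound.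
- by move=> s; rewrite /orb max00.
Qed.

Lemma bfun_T psi C s : 0 <= C -> 0 <= s -> bfun C psi -> bfun (C * M) (psi \o T s).
Proof.
move=> C0 s0 [lp bp]; split=> [r u v|u] /=; first by rewrite T_linear lp.
by rewrite (le_trans (bp _))// -mulrA ler_wpM2l// T_bound.
Qed.

Definition op_sum P x m : X :=
  \sum_(k < m ^ 2) (ev P (cell m k))%:C *: T (k%:R / m%:R) x.

Lemma op_sumE P x m psi : rlin psi ->
  psi (op_sum P x m) = ev P (step m (fun k => psi (T (k%:R / m%:R) x))).
Proof.
move=> lp; rewrite /op_sum (rlin_sum _ lp).
rewrite /step ev_sum => [|k]; last exact: bmeasZ _ (bmeas_cell m k).
apply: eq_bigr => k _; rewrite (rlinZ _ _ lp) evZ 1?mulrC//.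
exact: bmeas_cell.
Qed.

(** The modulus of continuity at 1/(m+1) as a null sequence free of psi, the form of error
    [vector_of_functional] expects. *)
Lemma T_modulus_seq x : exists2 w : nat -> R, w @ \oo --> 0 &
  forall m s r, 0 <= s -> 0 <= r -> `|s - r| < m.+1%:R^-1 -> nrm (T s x - T r x) <= w m.
Proof.
pose S m := [set t | exists s r, [/\ 0 <= s, 0 <= r, `|s - r| < m.+1%:R^-1 &
  t = nrm (T s x - T r x)]].
have ubS m t : S m t -> t <= M * nrm x + M * nrm x.
  by move=> [s [r [s0 r0 _ ->]]]; rewrite (le_trans (nrm_dist _ _))// lerD// T_bound.
have S0 m : S m 0.
  by exists 0, 0; split; rewrite // ?subrr ?normr0 ?invr_gt0 ?ltr0n// nrm0.
have hS m : has_sup (S m) by split; [exists 0|exists (M * nrm x + M * nrm x); exact: ubS].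
exists (fun m => sup (S m)); last first.
  by move=> m s r s0 r0 sr; apply: (ub_le_sup (proj2 (hS m))); exists s, r.
apply/cvgrPdist_le => e e0; have [d d0 hd] := T_modulus x e0.
near=> m; rewrite sub0r normrN ger0_norm; last exact: (ub_le_sup (proj2 (hS m))).
apply: ge_sup; first by exists 0.
move=> t [s [r [s0 r0 sr ->]]]; apply: hd => //; apply: lt_trans sr _.
rewrite -[ltRHS]invrK ltf_pV2 ?posrE ?ltr0n ?invr_gt0//.
rewrite (@lt_trans _ _ m%:R) ?ltr_nat//.
near: m; exact: nbhs_infty_gtr.
Unshelve. all: by end_near. Qed.

(* Sums over step functions converge to the integral uniformly over the unit ball
   of the dual, hence in norm by the Hahn-Banach theorem. *)
Lemma op_exists P x : exists y : X,
  forall psi, bfun 1 psi -> psi y = ev P (orb psi x).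
Proof.
have [w w0 hw] := T_modulus_seq x.
(* Two errors: the oscillation of the orbit inside a cell, and the tail beyond m+1, where the step
   function vanishes. *)
pose e m := w m + M * nrm x * ev P (\1_(`[m.+1%:R, +oo[%classic : set R)).
have e0 : e @ \oo --> 0.
  rewrite -[X in _ --> X](addr0 0) -[X in _ --> _ + X](mulr0 (M * nrm x)).
  by apply: cvgD => //; apply: cvgM; [exact: cvg_cst|exact: ev_tail].
suff h psi m : bfun 1 psi ->
    `|psi (op_sum P x m.+1) - ev P (orb psi x)| <= e m.
  by have [l _ hl] := vector_of_functional h e0; exists l.
move=> hp; have lp := bfun_rlin hp.
have bo := bcont_bmeas (bcont_orb x ler01 hp).
have bs := bmeas_step m.+1 (fun k => psi (T (k%:R / m.+1%:R) x)).
have b1 : bmeas setT (\1_(`[m.+1%:R, +oo[%classic : set R) : R -> R) by exact: bmeas_indic.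
have hn := ev_norm P (bmeasB bs bo).
rewrite (op_sumE _ _ _ lp) -(evB P bs bo); apply: (le_trans hn).
rewrite /e -(ev_cst P (w m)) -evZ// -evD//; last 2 first.
- exact: bmeas_cst.
- exact: bmeasZ.
apply: ev_le; first by apply: bmeas_norm => //; exact: bmeasB.
  by apply: bmeasD; [exact: bmeas_cst|exact: bmeasZ].
move=> s; rewrite indicE; have [ms|sm] := leP m.+1%:R s.
  rewrite mem_set ?mulr1; last by rewrite /= in_itv /= ms.
  rewrite step_out// sub0r normrN ler_wpDl//; last first.
    by have := orb_bound x s ler01 hp; rewrite mul1r.
  by apply: le_trans (hw m 0 0 _ _ _); rewrite ?nrm_ge0 ?subrr ?normr0 ?invr_gt0.
have sm' : Num.max s 0 < m.+1%:R by rewrite gt_max sm ltr0n.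
have [k -> /andP[k1 k2]] := stepE (fun k => psi (T (k%:R / m.+1%:R) x)) (ltn0Sn m) sm'.
rewrite -rlinB// ler_wpDr//.
  by rewrite mulr_ge0 ?ler0n// mulr_ge0// nrm_ge0.
have [_ bp] := hp; rewrite (le_trans (bp _))// mul1r.
apply: hw => //; first exact: maxr0_ge0.
have mp : 0 < m.+1%:R :> R by rewrite ltr0n.
rewrite distrC ger0_norm; last by rewrite subr_ge0 ler_pdivrMr// mulrC.
rewrite -(ltr_pM2l mp) mulrBr mulfV ?gt_eqF// mulrCA mulfV ?gt_eqF// mulr1.
by rewrite ltrBlDr nat1r.
Qed.

Definition op P x : X := projT1 (cid (op_exists P x)).

Lemma op_ev P x psi C : bfun C psi -> psi (op P x) = ev P (orb psi x).
Proof.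
move=> hp; have C1 : 0 < `|C| + 1 by rewrite ltr_wpDl.
have hp1 : bfun (`|C| + 1) psi.
  by apply: bfun_ler hp; rewrite (le_trans (ler_norm _))// lerDl.
have := projT2 (cid (op_exists P x)) _ (bfun_weight hp1 C1); rewrite -/(op P x).
rewrite [orb _ _](_ : _ = fun s => (`|C| + 1)^-1 * orb psi x s)// evZ.
  by move/mulfI; apply; rewrite invr_eq0 gt_eqF.
exact: bcont_bmeas (bcont_orb x (ltW C1) hp1).
Qed.

Opaque op.

Lemma eq_op P x y : (forall psi, bfun 1 psi -> psi y = ev P (orb psi x)) ->
  y = op P x.
Proof. by move=> h; apply: eq_bfun => psi hp; rewrite h// (op_ev _ _ hp). Qed.

Lemma bfun_norm_ge0 psi C : bfun C psi -> bfun `|C| psi.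
Proof. exact/bfun_ler/ler_norm. Qed.

Lemma bfun_scale psi C (a : R[i]) : bfun C psi ->
  bfun (`|C| * Normc.normc a) (fun x => psi (a *: x)).
Proof.
move=> /bfun_norm_ge0 [lp bp]; split=> [r u v|u].
  by rewrite scalerDr scalerA mulrC -scalerA lp.
by rewrite (le_trans (bp _))// nrmZc mulrA.
Qed.

Lemma op_linear P (a : R[i]) u v : op P (a *: u + v) = a *: op P u + op P v.
Proof.
apply/esym/eq_op => psi hp; have lp := bfun_rlin hp.
have hs := bfun_scale a hp.
rewrite (rlinD _ _ lp) (op_ev P u hs) (op_ev P v hp) -evD; last 2 first.
- by apply: bcont_bmeas; apply: bcont_orb hs; rewrite normr1 mul1r normc_ge0.
- exact: bcont_bmeas (bcont_orb v ler01 hp).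
by congr ev; apply/funext => s; rewrite /orb T_linear rlinD.
Qed.

Lemma opD P u v : op P (u + v) = op P u + op P v.
Proof. by rewrite -[u]scale1r op_linear !scale1r. Qed.

Lemma op0 P : op P 0 = 0.
Proof. by apply: (addrI (op P 0)); rewrite -opD !addr0. Qed.

Lemma opZ P a u : op P (a *: u) = a *: op P u.
Proof. by rewrite -[a *: u]addr0 op_linear op0 addr0. Qed.

Lemma opB P u v : op P (u - v) = op P u - op P v.
Proof. by rewrite opD -scaleN1r opZ scaleN1r. Qed.

Lemma op_bound P x : nrm (op P x) <= M * nrm x.
Proof.
apply: nrm_le_bfun => psi hp; rewrite (op_ev P x hp).
rewrite (le_trans (ler_norm _))//; apply: ev_bound.
  by have [] := bcont_bmeas (bcont_orb x ler01 hp).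
by move=> s; have := orb_bound x s ler01 hp; rewrite mul1r.
Qed.

Lemma bfun_op psi C P : 0 <= C -> bfun C psi -> bfun (C * M) (psi \o op P).
Proof.
move=> C0 [lp bp]; split=> [r u v|u] /=; first by rewrite op_linear lp.
by rewrite (le_trans (bp _))// -mulrA ler_wpM2l// op_bound.
Qed.

(** The composition of psi with B is again a bounded functional, and B passes under the expectation
    by commuting with each T s. *)
Lemma op_commute P (B : X -> X) K : 0 <= K ->
  (forall (r : R) u v, B (r%:C *: u + v) = r%:C *: B u + B v) ->
  (forall u, nrm (B u) <= K * nrm u) ->
  (forall s u, 0 <= s -> B (T s u) = T s (B u)) ->
  forall x, B (op P x) = op P (B x).
Proof.
move=> K0 lB bB cB x; apply: eq_op => psi hp.
have [lp bp] := hp.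
have hB : bfun K (psi \o B).
  split=> [r u v|u] /=; first by rewrite lB lp.
  by rewrite (le_trans (bp _))// mul1r.
rewrite -[LHS]/((psi \o B) (op P x)) (op_ev P x hB); congr ev; apply/funext => s.
by rewrite /orb /= cB// maxr0_ge0.
Qed.

Lemma op_T P s x : 0 <= s -> T s (op P x) = op P (T s x).
Proof.
move=> s0; apply: (@op_commute P (T s) M) => //.
- by move=> u; exact: T_bound.
- by move=> r u r0; rewrite -!TD// addrC.
Qed.

Lemma op_comm P Q x : op P (op Q x) = op Q (op P x).
Proof.
apply: (@op_commute Q (op P) M) => //.
- by move=> r u v; rewrite op_linear.
- by move=> u; exact: op_bound.
- by move=> s u s0; rewrite op_T.
Qed.

Lemma op_conv P Q x : op (conv P Q) x = op P (op Q x).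
Proof.
apply/esym/eq_op => psi hp; rewrite conv_int; last exact: bcont_orb ler01 hp.
rewrite (op_ev P _ hp); congr ev; apply/funext => s; rewrite /orb.
have s0 := maxr0_ge0 s.
have hT := bfun_T ler01 s0 hp.
rewrite -[LHS]/((psi \o T (Num.max s 0)) (op Q x)) (op_ev Q x hT); congr ev; apply/funext => r.
by rewrite /orb [Num.max (_ + _) 0]maxr0_id ?addr_ge0 ?maxr0_ge0// TD ?maxr0_ge0.
Qed.

(** Transfer principle: a linear relation between Laplace transforms at the positive integers holds
    for orbits, hence for the operators. *)
Lemma good_orb L x psi : good L -> (forall j, L (ex j.+1) = 0) -> bfun 1 psi ->
  L (orb psi x) = 0.
Proof. by move=> gL L0 hp; exact: good_eq0 gL (bcont_orb x ler01 hp) L0. Qed.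

(** The resolvent (1 + aA)^-1, as [expd_scaled a] has transform 1/(1+az). The J_u of the overview is
    [res u^-1]. *)
Definition res a x := op (expd_scaled a) x.
Definition cesaro t x := op (unif_scaled t) x.

(** Both sides have the symbol acz/((1+az)(1+cz)). *)
Lemma res_resolvent (a c : R) x : 0 < a -> 0 < c ->
  a%:C *: (res a x - res c (res a x)) = c%:C *: (res c x - res c (res a x)).
Proof.
move=> a0 c0; apply: eq_bfun => psi hp; have lp := bfun_rlin hp.
set Pa := expd_scaled a; set Pc := expd_scaled c.
pose L F := (ev Pa F + (c / a - 1) * ev (conv Pc Pa) F) + - (c / a) * ev Pc F.
have h : L (orb psi x) = 0.
  apply: good_orb => //.
    by apply: good_comb; [apply: good_comb|]; exact: good_ev.
  move=> j; rewrite /L lap_conv !lap_scaled//.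
  have j0 : 0 < j.+1%:R :> R by rewrite ltr0n.
  by field; rewrite !gt_eqF// ?addr_gt0// ?mulr_gt0.
rewrite /res -op_conv -/Pa -/Pc.
move: (op_ev Pa x hp) (op_ev Pc x hp) (op_ev (conv Pc Pa) x hp).
move: (op Pa x) (op Pc x) (op (conv Pc Pa) x) => u v w hu hv hw.
rewrite 2!(rlinZ _ _ lp) 2!(rlinB _ _ lp) hu hv hw.
apply/eqP; rewrite -subr_eq0; apply/eqP; transitivity (a * L (orb psi x)).
  rewrite /L; move: (ev Pa _) (ev Pc _) (ev (conv _ _) _) => e1 e2 e3.
  by field; rewrite gt_eqF.
by rewrite h mulr0.
Qed.

(** The relation z - T(t)z = t C_t(A) A z for z = (1+aA)^-1 x, with A z written as (x - z)/a so that
    only laws occur. It holds before anything is known about the generator. *)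
Lemma res_cesaro (a t : R) x : 0 < a -> 0 < t ->
  res a x - T t (res a x) = (t / a)%:C *: (cesaro t x - cesaro t (res a x)).
Proof.
move=> a0 t0; apply: eq_bfun => psi hp; have lp := bfun_rlin hp.
set Pa := expd_scaled a; set Ut := unif_scaled t.
(* Applying T t to [res a x] shifts the law by t, that is, multiplies its transform by exp(-tz). *)
pose S F := ev Pa (fun s => F (t + Num.max s 0)).
have gS : good S.
  have mt : measurable_fun setT (fun s : R => t + Num.max s 0).
    apply: continuous_measurable_fun => s.
    by apply: cvgD; [exact: cvg_cst|exact: continuous_maxr0].
  have := @good_measure _ _ _ Pa _ _ _ measurableT mt (bmeas_cst setT 1).
  by congr good; apply/funext => F; rewrite /S /ev; apply: eq_Rintegral => s _; rewrite mulr1.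
pose L F := ((ev Pa F + -1 * S F) + - (t / a) * ev Ut F) + (t / a) * ev (conv Ut Pa) F.
have SE j : S (ex j) = expR (- (j%:R * t)) * ev Pa (ex j).
  rewrite /S -evZ; last exact: bcont_bmeas (bcont_ex _).
  congr ev; apply/funext => s.
  by rewrite -{1}(maxr0_id (ltW t0)) exD /ex [Num.max t 0]maxr0_id ?ltW.
have h : L (orb psi x) = 0.
  apply: good_orb => //.
    apply: good_comb; last exact: good_ev.
    apply: good_comb; last exact: good_ev.
    by apply: good_comb => //; exact: good_ev.
  move=> j; rewrite /L lap_conv SE (lap_scaled j a0) (lap_unif j t0).
  have j0 : 0 < j.+1%:R :> R by rewrite ltr0n.
  by field; rewrite !gt_eqF// ?addr_gt0// ?mulr_gt0.
have ES : psi (T t (res a x)) = S (orb psi x).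
  rewrite /res op_T ?(ltW t0)// (op_ev _ _ hp); congr ev; apply/funext => s.
  rewrite /orb [Num.max (t + _) 0]maxr0_id ?addr_ge0 ?maxr0_ge0 ?(ltW t0)//.
  by rewrite -TD ?maxr0_ge0 ?(ltW t0)// addrC.
move: ES; rewrite /cesaro /res -op_conv -/Pa -/Ut.
move: (op_ev Pa x hp) (op_ev Ut x hp) (op_ev (conv Ut Pa) x hp).
move: (op Ut x) (op (conv Ut Pa) x) (T t (op Pa x)) (op Pa x) => u v w z hz hu hv hw.
rewrite (rlinB _ _ lp) (rlinZ _ _ lp) (rlinB _ _ lp) hu hv hw hz.
apply/eqP; rewrite -subr_eq0; apply/eqP; rewrite -[RHS]h /L.
move: (ev Pa _) (ev Ut _) (ev (conv _ _) _) (S _) => e1 e2 e3 e4; ring.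
Qed.

Lemma cesaro_dist x e t : 0 < t -> 0 <= e ->
  (forall s, 0 <= s -> s <= t -> nrm (T s x - x) <= e) -> nrm (cesaro t x - x) <= e.
Proof.
move=> t0 e0 he; apply: nrm_le_bfun => psi hp; have lp := bfun_rlin hp.
have bo := bcont_orb x ler01 hp.
have bt : bmeas setT (fun u => orb psi x (t * u)).
  by apply: (bmeas_bcont measurableT bo); exact: mulrl_measurable.
rewrite (rlinB _ _ lp) /cesaro (op_ev _ _ hp) (unif_scaled_int _ bo).
rewrite -(ev_cst unif (psi x)) -evB//; last exact: bmeas_cst.
rewrite (le_trans (ler_norm _))//; apply: unif_bound => //.
  by apply: bmeasB => //; exact: bmeas_cst.
move=> u u0 u1; have tu : 0 <= t * u by rewrite mulr_ge0 ?ltW.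
rewrite /orb -(rlinB _ _ lp) maxr0_id// (le_trans (bfun1_le _ hp))// he//.
by rewrite ler_piMr// ltW.
Qed.

Lemma cesaro_near x (e : R) : 0 < e -> exists2 d, 0 < d &
  forall t, 0 < t -> t < d -> nrm (cesaro t x - x) <= e.
Proof.
move=> e0; have [d d0 hd] := T_modulus x e0; exists d => // t t0 td.
apply: cesaro_dist => // [|s s0 st]; first exact: ltW.
by rewrite -{2}(T0 x); apply: hd => //; rewrite subr0 ger0_norm// (le_lt_trans st).
Qed.

Lemma nrm_small (v : X) K : (forall e : R, 0 < e -> nrm v <= K * e) -> v = 0.
Proof.
move=> h; apply: nrm_eq0; apply/le_anti; rewrite nrm_ge0 andbT.
apply/ler_addgt0Pl => e e0; rewrite addr0.
have K1 : 0 < `|K| + 1 by rewrite ltr_wpDl.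
rewrite (le_trans (h (e / (`|K| + 1)) _)) ?divr_gt0//.
rewrite mulrA ler_pdivrMr// mulrC ler_pM2l//.
by rewrite (le_trans (ler_norm K))// lerDl.
Qed.

(** For the difference quotient q at time t, [res_cesaro] gives a res_a q = C_t z - C_t (res_a z);
    now let t tend to 0. The constant a M + 2 counts the error of q and one error for each Cesaro
    mean. *)
Lemma res_gen_eq (a : R) z w : 0 < a -> gen T z w -> a%:C *: res a w = z - res a z.
Proof.
move=> a0 gz; apply/eqP; rewrite -subr_eq0; apply/eqP.
apply: (@nrm_small _ (a * M + 2)) => e e0.
have [d1 /= d10 h1] := (cvg_nrmP _ _).1 gz _ e0.
have [d2 d20 h2] := cesaro_near z e0.
have [d3 d30 h3] := cesaro_near (res a z) e0.
pose t := Num.min (d1 / 2) (Num.min (d2 / 2) (d3 / 2)).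
have t0 : 0 < t by rewrite !lt_min !divr_gt0.
have [t1 t2 t3] : [/\ t < d1, t < d2 & t < d3].
  have k (r : R) : 0 < r -> r / 2 < r by move=> r0; rewrite ltr_pdivrMr// ltr_pMr// ltr1n.
  by split; rewrite !gt_min ?k ?orbT.
have {h1} := h1 t; rewrite /= sub0r normrN gtr0_norm// => /(_ t1 t0).
have {h2} := h2 t t0 t2; have {h3} := h3 t t0 t3.
set q := (t^-1)%:C *: (z - T t z) => h3 h2 h1.
have Eq : a%:C *: res a q = cesaro t z - cesaro t (res a z).
  rewrite /q /res opZ opB -op_T ?ltW// -/(res a z) res_cesaro// !scalerA -!rmorphM /=.
  by rewrite (_ : a * t^-1 * (t / a) = 1) ?scale1r//; field; rewrite !gt_eqF.
have Bq : nrm (a%:C *: res a (w - q)) <= a * (M * e).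
  rewrite nrmZ gtr0_norm// ler_pM2l// (le_trans (op_bound _ _))//.
  by rewrite ler_wpM2l// ltW.
have Dq : a%:C *: res a (w - q) = a%:C *: res a w - a%:C *: res a q.
  by rewrite /res opB scalerBr.
move: Bq Dq; rewrite Eq.
move: h2 h3; move: (res a (w - q)) (res a w) (res a z) (cesaro t z) (cesaro t (res a z)).
move=> r1 r2 r3 r4 r5 h2 h3 Bq Dq.
apply: nrm_le_bfun => psi hp; have lp := bfun_rlin hp.
have := congr1 psi Dq; rewrite !(rlinB _ _ lp) => Ep.
have := bfun1_le (a%:C *: r1) hp; have := bfun1_le (r4 - z) hp.
have := bfun1_le (r5 - r3) hp; rewrite !(rlinB _ _ lp) !ler_norml.
by lra.
Qed.

Lemma gen_of_cesaro z w :
  (forall t, 0 < t -> z - T t z = t%:C *: cesaro t w) -> gen T z w.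
Proof.
move=> h; apply/cvg_nrmP => e e0.
have [d d0 hd] := cesaro_near w (divr_gt0 e0 (ltr0n R 2)).
near=> t; have t0 : 0 < t by near: t; exact: nbhs_right_gt.
rewrite h// scalerA -rmorphM /= mulVf ?gt_eqF// scale1r nrmB.
apply: le_lt_trans (hd t t0 _) _; last by rewrite ltr_pdivrMr// ltr_pMr// ltr1n.
by near: t; exact: nbhs_right_lt.
Unshelve. all: by end_near. Qed.

Lemma cesaroZ (t : R) (a : R[i]) u : cesaro t (a *: u) = a *: cesaro t u.
Proof. exact: opZ. Qed.

Lemma cesaroB (t : R) u v : cesaro t (u - v) = cesaro t u - cesaro t v.
Proof. exact: opB. Qed.

Lemma gen_res (a : R) x : 0 < a -> gen T (res a x) (a^-1%:C *: (x - res a x)).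
Proof.
move=> a0; apply: gen_of_cesaro => t t0.
by rewrite res_cesaro// cesaroZ cesaroB scalerA -rmorphM.
Qed.

Lemma gen_fixed c : (forall t, 0 <= t -> T t c = c) -> gen T c 0.
Proof.
move=> h; apply: gen_of_cesaro => t t0; rewrite h ?ltW// subrr.
by rewrite -[X in cesaro t X](scale0r 0) cesaroZ !scale0r scaler0.
Qed.

Lemma res_fixed (a : R) c : 0 < a -> res a c = c -> forall t, 0 <= t -> T t c = c.
Proof.
move=> a0 h t; rewrite le_eqVlt => /predU1P[<-//|t0].
have := @res_cesaro a t c a0 t0; rewrite h subrr scaler0 => /eqP.
by rewrite subr_eq0 => /eqP.
Qed.

(** * Riemann sums for the Cesaro mean *)

Section RiemannSums.
Variable (t : R) (x : X).
Hypothesis t0 : 0 < t.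
Variable (psi : X -> R).
Hypothesis hp : bfun 1 psi.

Let f (u : R) := orb psi x (t * u).

Let f_cont : continuous f.
Proof.
have [c _ _] := bcont_orb x ler01 hp => u.
by apply: continuous_comp; [apply: cvgM; [exact: cvg_cst|exact: cvg_id]|exact: c].
Qed.

Let f_int (a b : R) : leb.-integrable `[a, b] (EFin \o f).
Proof.
apply: continuous_compact_integrable; first exact: segment_compact.
exact: continuous_subspaceT.
Qed.

Lemma riemann_sum_dist n e m : (m <= n.+1)%N ->
  (forall s r, 0 <= s -> 0 <= r -> `|s - r| <= t / n.+1%:R -> nrm (T s x - T r x) <= e) ->
  `|\int[leb]_(u in `[0, m%:R / n.+1%:R]) f u -
    n.+1%:R^-1 * \sum_(k < m) psi (T (k%:R * t / n.+1%:R) x)| <= m%:R / n.+1%:R * e.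
Proof.
move=> mn he; have n0 : 0 < n.+1%:R :> R by rewrite ltr0n.
elim: m mn => [|m IH] mn.
  by rewrite big_ord0 mulr0 mul0r set_itv1 Rintegral_set1 subrr normr0 mul0r.
set c := psi (T (m%:R * t / n.+1%:R) x).
rewrite big_ord_recr /= -/c.
have mm : m%:R / n.+1%:R <= m.+1%:R / n.+1%:R :> R.
  by rewrite ler_pM2r ?invr_gt0// ler_nat.
have n10 : 0 <= n.+1%:R^-1 :> R by rewrite invr_ge0 ltW.
have m0 : 0 <= m%:R / n.+1%:R :> R by rewrite divr_ge0// ltW.
have := seg_split m0 mm (f_int 0 _).
have ba : m.+1%:R / n.+1%:R - m%:R / n.+1%:R = n.+1%:R^-1 :> R.
  by rewrite -mulrBl -natr1 addrAC subrr add0r mul1r.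
have := @seg_dist _ _ _ _ c e mm (f_int _ _); rewrite ba.
set A0 := Rintegral _ _ _; set A1 := Rintegral _ _ _; set A2 := Rintegral _ _ _.
move=> /[swap] hI.
have := IH (ltnW mn).
set Sg := bigop _ _ _ => hS0 h0.
have {hS0} hS : `|A2 - n.+1%:R^-1 * Sg| <= m%:R / n.+1%:R * e by [].
have {h0} : `|A0 - n.+1%:R^-1 * c| <= n.+1%:R^-1 * e.
  apply: h0 => u au ub; have u0 : 0 <= u by apply: le_trans au; rewrite divr_ge0.
  rewrite /f /orb /c -(rlinB _ _ (bfun_rlin hp)) (le_trans (bfun1_le _ hp))//.
  have tu : 0 <= t * u by rewrite mulr_ge0// ltW.
  rewrite maxr0_id//; apply: he => //.
    by rewrite divr_ge0 ?mulr_ge0// ltW.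
  rewrite (_ : t * u - m%:R * t / n.+1%:R = t * (u - m%:R / n.+1%:R)); last by ring.
  rewrite normrM gtr0_norm// ler_pM2l// ger0_norm ?subr_ge0//.
  by rewrite -[leRHS]ba lerD2r.
rewrite mulrDr (_ : m.+1%:R / n.+1%:R = m%:R / n.+1%:R + n.+1%:R^-1); last first.
  by rewrite -natr1 mulrDl mul1r.
rewrite mulrDl; move: hI hS; rewrite !ler_norml.
move: (n.+1%:R^-1 * c) (n.+1%:R^-1 * e) (n.+1%:R^-1 * Sg) (m%:R / n.+1%:R * e).
by clearbody A0 A1 A2 => r1 r2 r3 r4; lra.
Qed.

End RiemannSums.

Lemma cesaro_meanE (t : R) x : 0 < t -> cesaro_mean T t x = cesaro t x.
Proof.
move=> t0; have [w w0 hw] := T_modulus_seq x.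
pose y n : X := (n.+1%:R^-1)%:C *: \sum_(k < n.+1) T (k%:R * t / n.+1%:R) x.
suff hy : y @ \oo --> cesaro t x.
  apply/cvg_lim => //.
  (* The shift by one discards the term n = 0, where the inverse has its default value. *)
  rewrite -(@cvg_shiftS _ (fun n : nat => (n%:R^-1)%:C *: \sum_(k < n) T (k%:R * t / n%:R) x)).
  exact: hy.
apply/cvg_nrmP => e e0.
have [d d0 hd] := T_modulus x (divr_gt0 e0 (ltr0n R 2)).
near=> n; have n0 : 0 < n.+1%:R :> R by rewrite ltr0n.
apply: (@le_lt_trans _ _ (e / 2)); last by rewrite ltr_pdivrMr// ltr_pMr// ltr1n.
apply: nrm_le_bfun => psi hp; have lp := bfun_rlin hp.
have bo := bcont_orb x ler01 hp.
have bt : bmeas setT (fun u => orb psi x (t * u)).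
  by apply: (bmeas_bcont measurableT bo); exact: mulrl_measurable.
have := @riemann_sum_dist t x t0 psi hp n (e / 2) n.+1 (leqnn _).
rewrite mulfV ?gt_eqF// mul1r -unif_int// => /(_ _).
rewrite (rlinB _ _ lp) /cesaro (op_ev _ _ hp) (unif_scaled_int _ bo).
rewrite /y (rlinZ _ _ lp) (rlin_sum _ lp) => h.
apply: le_trans (ler_norm _) (h _) => s r s0 r0 sr; apply: hd => //.
apply: le_lt_trans sr _; rewrite ltr_pdivrMr// mulrC -ltr_pdivrMr//.
rewrite (@lt_trans _ _ n%:R) ?ltr_nat//.
near: n; exact: nbhs_infty_gtr.
Unshelve. all: by end_near. Qed.

Lemma res_bound (a : R) x : nrm (res a x) <= M * nrm x.
Proof. exact: op_bound. Qed.

Lemma resB (a : R) u v : res a (u - v) = res a u - res a v.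
Proof. exact: opB. Qed.

Lemma resZ (a : R) (r : R[i]) u : res a (r *: u) = r *: res a u.
Proof. exact: opZ. Qed.

Lemma resC (a c : R) x : res a (res c x) = res c (res a x).
Proof. exact: op_comm. Qed.

Lemma res_swap (a c : R) x : 0 < a -> 0 < c ->
  a%:C *: res a (x - res c x) = c%:C *: (res c x - res c (res a x)).
Proof. by move=> a0 c0; rewrite -res_resolvent// resB (resC a c). Qed.

Lemma sub_res_bound (a : R) x : nrm (x - res a x) <= 2 * M * nrm x.
Proof.
rewrite (le_trans (nrm_dist _ _))// -mulrA mulrDl mul1r lerD ?res_bound//.
by rewrite ler_peMl ?nrm_ge0.
Qed.

Lemma res_lip (a c : R) y : 0 < a -> 0 < c ->
  nrm (res a y - res c y) <= `|a - c| / c * (2 * M * (M * nrm y)).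
Proof.
move=> a0 c0; have E : res a y - res c y = ((c - a) / c)%:C *: (res a y - res c (res a y)).
  have := res_resolvent y a0 c0.
  move: (res a y) (res c y) (res c (res a y)) => u v w h.
  apply: eq_bfun => psi hp; have lp := bfun_rlin hp.
  have := congr1 psi h; rewrite !(rlinZ _ _ lp, rlinB _ _ lp) => h'.
  apply/(mulfI (_ : c != 0)); first by rewrite gt_eqF.
  rewrite mulrA mulrCA mulfV ?gt_eqF// mulr1; move: h'; lra.
rewrite E nrmZ normrM normfV (gtr0_norm c0) (distrC c).
apply: ler_wpM2l; first by apply: divr_ge0 => //; exact: ltW.
rewrite (le_trans (sub_res_bound _ _))//.
by apply: ler_wpM2l; [exact: mulr_ge0|exact: res_bound].
Qed.

Lemma res_path_cont psi C y (u : R) : bfun C psi -> 0 < u ->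
  {for u, continuous (fun u : R => psi (res (expR (- ln u)) y))}.
Proof.
move=> /bfun_norm_ge0 hp u0; have [lp bp] := hp.
set K := `|C| * (u^-1 * (2 * M * (M * nrm y))).
have K0 : 0 <= K.
  by rewrite /K !mulr_ge0 ?invr_ge0 ?nrm_ge0// ltW.
apply/cvgrPdist_le => e e0; near=> v.
have v0 : 0 < v by near: v; exact: lt_nbhsr.
rewrite -(rlinB _ _ lp) (le_trans (bp _))// !expR_lnN//.
have h : nrm (res u^-1 y - res v^-1 y) <= `|u^-1 - v^-1| / v^-1 * (2 * M * (M * nrm y)).
  by apply: res_lip; rewrite invr_gt0.
have E : `|u^-1 - v^-1| / v^-1 = `|u - v| * u^-1.
  have -> : u^-1 - v^-1 = (v - u) * (u * v)^-1 by field; rewrite !gt_eqF.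
  rewrite normrM (gtr0_norm (_ : 0 < (u * v)^-1)) ?invr_gt0 ?mulr_gt0// distrC.
  by field; rewrite !gt_eqF.
apply: le_trans (ler_wpM2l (normr_ge0 C) h) _; rewrite E.
rewrite [leLHS](_ : _ = K * `|u - v|); last by rewrite /K; ring.
apply: (@le_trans _ _ ((K + 1) * `|u - v|)); first by rewrite ler_wpM2r// lerDl.
rewrite -ler_pdivlMl ?ltr_pwDr//.
near: v; exists ((K + 1)^-1 * e); last by move=> w /= /ltW.
by rewrite /= mulr_gt0// invr_gt0 ltr_pwDr.
Unshelve. all: by end_near. Qed.

(** * Logarithmic decay of resolvents *)

Section Decay.
Variables (y b : X).
Hypothesis highE : op high_law y - y = b - res 1 b.

Section Scalar.
Variable psi : X -> R.
Hypothesis hp : bfun 1 psi.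

Let lp := bfun_rlin hp.

(** This is psi (J_a (1 - J_u) y); [expR (- ln u)] stands for 1/u, as in [high_law]. *)
Definition res_path (a u : R) : R := psi (res a^-1 (y - res (expR (- ln u)) y)).

Let bpa (a : R) : bfun M (psi \o res a^-1).
Proof. by have := bfun_op (expd_scaled a^-1) ler01 hp; rewrite mul1r. Qed.

Let path_cont (a : R) : cont_pos (res_path a).
Proof.
move=> u u0; rewrite (_ : res_path a = fun u => psi (res a^-1 y) -
    (psi \o res a^-1) (res (expR (- ln u)) y)).
  by apply: cvgB; [exact: cvg_cst|exact: res_path_cont (bpa a) u0].
by apply/funext => v; rewrite /res_path resB (rlinB _ _ lp).
Qed.

Lemma res_path_bmeas (a : R) : bmeas setT (res_path a) /\
  \int[leb]_(u in `[0, 1]) res_path a u = - psi (res a^-1 (b - res 1 b)).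
Proof.
have bo := bcont_orb y M0 (bpa a).
have [h1 h2] := high_int bo.
have E : (fun u => ev (expd_scaled (expR (- ln u))) (orb (psi \o res a^-1) y)) =
    fun u => (psi \o res a^-1) (res (expR (- ln u)) y).
  by apply/funext => u; rewrite -(op_ev _ y (bpa a)).
rewrite E in h1 h2.
have bm : bmeas setT (res_path a).
  rewrite (_ : res_path a = fun u => psi (res a^-1 y) -
    (psi \o res a^-1) (res (expR (- ln u)) y)); last first.
    by apply/funext => v; rewrite /res_path resB (rlinB _ _ lp).
  by apply: bmeasB => //; exact: bmeas_cst.
split=> //; rewrite -unif_int// (_ : res_path a = fun u => psi (res a^-1 y) -
    (psi \o res a^-1) (res (expR (- ln u)) y)); last first.
  by apply/funext => v; rewrite /res_path resB (rlinB _ _ lp).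
rewrite evB//; last exact: bmeas_cst.
rewrite ev_cst -h2 -(op_ev _ y (bpa a)) /= -highE resB (rlinB _ _ lp).
by rewrite opprB.
Qed.

Let jf (u : R) := psi (res (expR (- ln u)) y).

Definition remainder (a : R) : R :=
  psi (res 1 (res a^-1 b)) -
  a^-1 * \int[leb]_(u in `[0, a]) res_path a u -
  \int[leb]_(u in `[a, 1]) (res_path a u / u).

(* Applying the resolvent at 1/a to highE and exchanging it with the one at 1/u. *)
Lemma log_identity (a : R) : 0 < a -> a < 1 ->
  \int[leb]_(u in `[a, 1]) (jf u / u) + psi (res 1 b) =
  - ln a * jf a + remainder a.
Proof.
move=> a0 a1.
have alg (p q r I0 I1 I3 j l : R) : a^-1 * p = q - r -> - p - I0 = a * (I1 - j * - l + I3) ->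
    I1 + q = - l * j + (r - a^-1 * I0 - I3).
  move=> h /(congr1 (fun r => a^-1 * r)).
  rewrite mulrBr mulrN h mulrA mulVf ?gt_eqF// mul1r; lra.
have [[mh _] hI] := res_path_bmeas a.
have ai0 : 0 < a^-1 by rewrite invr_gt0.
have ih (x z : R) := seg_int_bmeas x z (res_path_bmeas a).1.
have := seg_split (ltW a0) (ltW a1) (ih 0 1); rewrite hI.
have jcont : cont_pos jf by move=> u u0; exact: res_path_cont hp u0.
have ij := seg_int_pos 1 (cont_posM jcont cont_pos_inv) a0.
have iinv := seg_int_pos 1 cont_pos_inv a0.
have ihu := seg_int_pos 1 (cont_posM (@path_cont a) cont_pos_inv) a0.
have i2 := seg_int_pos 1 (cont_posZ (c := jf a) cont_pos_inv) a0.
have E1 : \int[leb]_(u in `[a, 1]) (jf a * u^-1) = jf a * - ln a.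
  by rewrite -(seg_inv a0 a1) (RintegralZl _ _ iinv).
(* Pointwise J_a (1 - J_u) y = (a/u) J_u (1 - J_a) y = (a/u) (J_u y - J_a y + J_a (1 - J_u) y); the
   middle term integrates to the logarithm. *)
have key : \int[leb]_(u in `[a, 1]) res_path a u =
    a * (\int[leb]_(u in `[a, 1]) (jf u / u) - jf a * - ln a +
      \int[leb]_(u in `[a, 1]) (res_path a u / u)).
  have K3 := seg_comb a ij i2 ihu.
  have K4 := congr1 (fun r => a * (\int[leb]_(u in `[a, 1]) (jf u / u) - r +
      \int[leb]_(u in `[a, 1]) (res_path a u / u))) E1.
  apply: etrans K4; apply: etrans K3.
  apply: eq_Rintegral => u; rewrite inE /= in_itv /= => /andP[au _].
  have u0 : 0 < u := lt_le_trans a0 au.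
  have ui0 : 0 < u^-1 by rewrite invr_gt0.
  rewrite /res_path /jf !expR_lnN// resB (resC _ u^-1).
  have := res_resolvent y ai0 ui0.
  move: (res a^-1 y) (res u^-1 y) (res u^-1 (res a^-1 y)) => p q r /(congr1 psi).
  rewrite 2!(rlinZ _ _ lp) !(rlinB _ _ lp) => h.
  apply: (mulfI (_ : a^-1 != 0)); first by rewrite gt_eqF.
  by rewrite h mulrA mulVf ?gt_eqF// mul1r; ring.
rewrite key /remainder.
have Jb : a^-1 * psi (res a^-1 (b - res 1 b)) = psi (res 1 b) - psi (res 1 (res a^-1 b)).
  have := res_swap b ai0 ltr01; rewrite scale1r.
  move: (res a^-1 (b - res 1 b)) (res 1 b) (res 1 (res a^-1 b)) => u v w /(congr1 psi).
  by rewrite (rlinZ _ _ lp) (rlinB _ _ lp).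
move=> h; exact: alg Jb h.
Qed.

(** The part y1 is meant to lie in the range of A, where J_a gains a factor a, which absorbs the
    logarithm. For y2 there is no such gain, but on [a, 1] the exchange of J_a and J_u gives a
    factor a/u, and the integral of a/u^2 is at most 1. The intervals [0, a] and [a, 1] cost 2 M^2
    |y2| each. *)
Lemma remainder_bound (a C : R) y1 y2 : y = y1 + y2 -> 0 < a -> a < 1 -> 0 <= C ->
  (forall c, 0 < c -> nrm (res a^-1 (y1 - res c y1)) <= a * C) ->
  `|remainder a| <= nrm (res 1 (res a^-1 b)) + C * (a - a * ln a) +
    4 * M * (M * nrm y2).
Proof.
move=> Ey a0 a1 C0 hC.
have ai0 : 0 < a^-1 by rewrite invr_gt0.
set n2 := M * (M * nrm y2).
have n20 : 0 <= n2 by rewrite /n2 !mulr_ge0 ?nrm_ge0.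
have split_path u : res_path a u = psi (res a^-1 (y1 - res (expR (- ln u)) y1)) +
    psi (res a^-1 (y2 - res (expR (- ln u)) y2)).
  have E c : y - res c y = (y1 - res c y1) + (y2 - res c y2).
    by rewrite Ey /res opD opprD addrACA.
  by rewrite /res_path E {1}/res opD (rlinD _ _ lp).
have h1 c : 0 < c -> `|psi (res a^-1 (y1 - res c y1))| <= a * C.
  by move=> c0; rewrite (le_trans (bfun1_le _ hp))// hC.
have hn c r : `|psi (res r (y2 - res c y2))| <= 2 * n2.
  rewrite (le_trans (bfun1_le _ hp))// (le_trans (res_bound _ _))//.
  by rewrite (_ : 2 * n2 = M * (2 * M * nrm y2)) ?ler_wpM2l ?sub_res_bound// /n2; ring.
have h3 u : 0 < u -> `|psi (res a^-1 (y2 - res u^-1 y2))| <= a * (2 * n2) * u^-1.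
  move=> u0; have ui0 : 0 < u^-1 by rewrite invr_gt0.
  have E : psi (res a^-1 (y2 - res u^-1 y2)) = a * u^-1 * psi (res u^-1 (y2 - res a^-1 y2)).
    rewrite !resB (resC _ u^-1); have := res_resolvent y2 ai0 ui0.
    move: (res a^-1 y2) (res u^-1 y2) (res u^-1 (res a^-1 y2)) => p q r /(congr1 psi).
    rewrite 2!(rlinZ _ _ lp) !(rlinB _ _ lp) => h.
    by rewrite -mulrA -h mulrA mulfV ?gt_eqF// mul1r.
  rewrite E normrM (gtr0_norm (_ : 0 < a * u^-1)) ?mulr_gt0//.
  rewrite [leRHS](_ : _ = a * u^-1 * (2 * n2)); last by ring.
  by rewrite ler_wpM2l ?hn// ltW// mulr_gt0.
have T1 : `|a^-1 * \int[leb]_(u in `[0, a]) res_path a u| <= a * C + 2 * n2.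
  rewrite normrM (gtr0_norm ai0) ler_pdivrMl//.
  have ih := seg_int_bmeas 0 a (res_path_bmeas a).1.
  have := seg_dist (c := 0) (e := a * C + 2 * n2) (ltW a0) ih.
  rewrite mulr0 !subr0; apply => u _ _.
  rewrite subr0 split_path (le_trans (ler_normD _ _))// lerD//.
  by apply: h1; exact: expR_gt0.
have T2 : `|\int[leb]_(u in `[a, 1]) (res_path a u / u)| <=
    a * C * - ln a + 2 * n2.
  have ch := cont_posM (@path_cont a) cont_pos_inv.
  have c1 := cont_posZ (c := a * C) cont_pos_inv.
  have c2 : cont_pos (fun u : R => u^-1 * u^-1) := cont_posM cont_pos_inv cont_pos_inv.
  have c3 : cont_pos (fun u : R => a * (2 * n2) * (u^-1 * u^-1)) := cont_posZ c2.
  have c4 : cont_pos (fun u : R => a * C * u^-1 + a * (2 * n2) * (u^-1 * u^-1)) :=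
    cont_posD c1 c3.
  apply: le_trans (seg_le (seg_int_pos 1 ch a0) (seg_int_pos 1 c4 a0) _) _.
    move=> u au _; have u0 : 0 < u := lt_le_trans a0 au.
    have ui0 : 0 < u^-1 by rewrite invr_gt0.
    rewrite normrM (gtr0_norm ui0).
    rewrite [leRHS](_ : _ = (a * C + a * (2 * n2) * u^-1) * u^-1); last by ring.
    rewrite ler_wpM2r ?(ltW ui0)//.
    rewrite split_path (le_trans (ler_normD _ _))// lerD ?h1 ?expR_gt0//.
    by rewrite expR_lnN// h3.
  rewrite RintegralD ?(seg_int_pos 1 c1 a0) ?(seg_int_pos 1 c3 a0)//.
  rewrite RintegralZl ?(seg_int_pos 1 cont_pos_inv a0)// RintegralZl ?(seg_int_pos 1 c2 a0)//.
  rewrite seg_inv// seg_inv2// lerD2l.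
  have -> : a * (2 * n2) * (a^-1 - 1) = 2 * n2 - a * (2 * n2) by field; rewrite gt_eqF.
  by rewrite gerBl mulr_ge0 ?(ltW a0)// mulr_ge0.
have T3 := bfun1_le (res 1 (res a^-1 b)) hp.
rewrite /remainder (le_trans (ler_normB _ _))//.
have -> : 4 * M * (M * nrm y2) = 4 * n2 by rewrite /n2; ring.
have := ler_normB (psi (res 1 (res a^-1 b)))
  (a^-1 * \int[leb]_(u in `[0, a]) res_path a u).
move: T1 T2 T3; move: `|_| `|_| `|_| `|_| (nrm (res _ _)) => p q r s v.
by move=> h4 h5 h6 h7; lra.
Qed.

End Scalar.

Lemma res_decay_dist (k a1 a2 : R) : 0 < a1 -> a1 < a2 -> a2 < 1 ->
  (forall psi a, bfun 1 psi -> 0 < a -> a <= a2 -> `|remainder psi a| <= k) ->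
  nrm (res a1^-1 y - res a2^-1 y) <= 3 * k / - ln a2.
Proof.
move=> a10 a12 a21 hk; apply: nrm_le_bfun => psi hp; have lp := bfun_rlin hp.
have a20 := lt_trans a10 a12.
have := @log_average_decay R (fun u => psi (res (expR (- ln u)) y))
  (fun u u0 => @res_path_cont psi 1 y u hp u0) (remainder psi) (psi (res 1 b)) k a1 a2 a10 a12 a21.
rewrite !expR_lnN// (rlinB _ _ lp) => h.
apply: le_trans (ler_norm _) (h _ _).
- by move=> a a0 a1'; exact: log_identity.
- by move=> a aa1 aa2; apply: hk => //; exact: lt_le_trans aa1.
Qed.

End Decay.

(** As a grows, [res a y] is almost fixed by [res 1]; this is what forces the limit of the
    resolvents into the kernel of A. *)
Lemma sub_res1_res_bound (a : R) y : 0 < a ->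
  nrm (res a y - res 1 (res a y)) <= a^-1 * (2 * M * (M * nrm y)).
Proof.
move=> a0; have := res_resolvent y a0 ltr01; rewrite scale1r => h.
have := congr1 nrm h; rewrite nrmZ gtr0_norm// => E.
rewrite ler_pdivlMl// E (le_trans (nrm_dist _ _))//.
rewrite (_ : 2 * M * (M * nrm y) = M * (M * nrm y) + M * (M * nrm y)); last by ring.
rewrite lerD//; last first.
  by rewrite (le_trans (res_bound _ _))// ler_wpM2l// res_bound.
by rewrite (le_trans (res_bound _ _))// ler_peMl// mulr_ge0// nrm_ge0.
Qed.

Lemma res_eq0 c : gen_injective T -> res 1 c = c -> c = 0.
Proof.
move=> hinj h; apply: (hinj _ _ 0); first exact: gen_fixed (res_fixed ltr01 h).
by apply: gen_fixed => t _; exact: T_lin0.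
Qed.

Lemma lnexpN (n : nat) : - ln (expR (- n.+1%:R) : R) = n.+1%:R.
Proof. by rewrite expRK opprK. Qed.

Section DecayRate.
Variables (y b : X).
Hypothesis highE : op high_law y - y = b - res 1 b.
Hypothesis hinj : gen_injective T.

Let expN_itv (n : nat) : 0 < expR (- n.+1%:R : R) < 1.
Proof. by rewrite expR_gt0 expR_lt1 oppr_lt0 ltr0n. Qed.

(** The splitting y = 0 + y with C = 0: a bound that needs nothing about the range of A, enough for
    (a). *)
Lemma remainder_bound0 psi a : bfun 1 psi -> 0 < a -> a < 1 ->
  `|remainder y b psi a| <= M * (M * nrm b) + 4 * M * (M * nrm y).
Proof.
move=> hp a0 a1.
have Ey : y = 0 + y by rewrite add0r.
have := remainder_bound highE hp Ey a0 a1 (lexx 0); rewrite mul0r addr0 => h.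
apply: le_trans (h _) _.
  by move=> c _; rewrite mulr0 /res op0 subr0 op0 nrm0.
by rewrite lerD2r (le_trans (res_bound _ _))// ler_wpM2l// res_bound.
Qed.

Let k0 := M * (M * nrm b) + 4 * M * (M * nrm y).

(** Sampling at a = exp(-(n+1)), where - ln a = n+1, makes the rate of convergence explicit. *)
Let x (n : nat) := res (expR n.+1%:R) y.

Let k00 : 0 <= k0.
Proof. by rewrite /k0 addr_ge0// !mulr_ge0 ?nrm_ge0. Qed.

Let x_dist n m : (n < m)%N -> nrm (x m - x n) <= 3 * k0 / n.+1%:R.
Proof.
move=> nm; have /andP[a10 a11] := expN_itv m; have /andP[a20 a21] := expN_itv n.
have a12 : expR (- m.+1%:R) < expR (- n.+1%:R) :> R by rewrite ltr_expR ltrN2 ltr_nat.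
have := res_decay_dist highE a10 a12 a21 (k := k0).
rewrite lnexpN !expRN !invrK; apply => psi a hp a0 aa.
by rewrite -expRN in aa; apply: remainder_bound0 => //; exact: le_lt_trans aa a21.
Qed.

Let x_cvg : x @ \oo --> 0.
Proof.
have cx : cvg (x @ \oo).
  apply: cauchy_nrm => e e0.
  pose N := Num.truncn (3 * k0 / e); exists N => n; rewrite leq_eqVlt => /predU1P[<-|Nn].
    by rewrite subrr nrm0.
  rewrite nrmB; apply: le_lt_trans (x_dist Nn) _.
  rewrite ltr_pdivrMr ?ltr0n// [ltRHS]mulrC -ltr_pdivrMr//.
  by have /andP[] := truncn_itv (divr_ge0 (mulr_ge0 (ler0n R 3) k00) (ltW e0)).
have [c xc] := (cvg_ex _).1 cx.
suff h : res 1 c = c by rewrite -(res_eq0 hinj h).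
apply/eqP; rewrite eq_sym -subr_eq0; apply/eqP.
apply: (@nrm_small _ (2 * M + 2 * M * (M * nrm y))) => e e0.
have xe := (cvg_nrmP _ _).1 xc _ e0.
have [n [xn en]] : exists n, nrm (c - x n) < e /\ (expR n.+1%:R)^-1 <= e.
  near \oo => n; exists n; split; first by near: n; exact: xe.
  rewrite -[leRHS]invrK lef_pV2 ?posrE ?expR_gt0 ?invr_gt0//.
  apply: (@le_trans _ _ n%:R); first by near: n; exact: nbhs_infty_ger.
  apply: (@le_trans _ _ n.+1%:R); first by rewrite ler_nat.
  by rewrite (le_trans _ (expR_ge1Dx _))// lerDr.
have E : c - res 1 c = ((c - x n) - res 1 (c - x n)) + (x n - res 1 (x n)).
  have Ec : res 1 c = res 1 (c - x n) + res 1 (x n) by rewrite /res -opD subrK.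
  by rewrite [RHS]addrACA subrK -opprD -Ec.
rewrite E (le_trans (nrmD _ _))// mulrDl lerD//.
  apply: (le_trans (sub_res_bound _ _)).
  by rewrite ler_wpM2l ?mulr_ge0// ltW.
apply: (le_trans (sub_res1_res_bound _ (expR_gt0 _))).
by rewrite mulrC ler_wpM2l// !mulr_ge0// nrm_ge0.
Unshelve. all: by end_near. Qed.

Lemma res_decay (a k : R) : 0 < a -> a < 1 ->
  (forall psi c, bfun 1 psi -> 0 < c -> c <= a -> `|remainder y b psi c| <= k) ->
  nrm (res a^-1 y) <= 3 * k / - ln a.
Proof.
move=> a0 a1 hk; apply/ler_addgt0Pl => e e0.
have xe := (cvg_nrmP _ _).1 x_cvg _ e0.
have [n [xn en]] : exists n, nrm (x n) < e /\ expR (- n.+1%:R) < a.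
  near \oo => n; exists n; split.
    by rewrite -nrmN -sub0r; near: n; exact: xe.
  rewrite expRN -[ltRHS]invrK ltf_pV2 ?posrE ?expR_gt0 ?invr_gt0//.
  apply: (@lt_le_trans _ _ n.+1%:R).
    by apply: (@le_lt_trans _ _ n%:R); [near: n; exact: nbhs_infty_ger|rewrite ltr_nat].
  by rewrite (le_trans _ (expR_ge1Dx _))// lerDr.
have /andP[a10 _] := expN_itv n.
have := res_decay_dist highE a10 en a1 hk; rewrite expRN invrK -/(x n) => h.
rewrite -[res a^-1 y](subKr (x n)) (le_trans (nrm_dist _ _))// lerD// ltW//.
Unshelve. all: by end_near. Qed.

(** For a = t, [res_cesaro] expresses C_t y through r = [res t y] as r - T(t) r + C_t r. *)
Lemma cesaro_res_bound t : 0 < t -> nrm (cesaro t y) <= 3 * M * nrm (res t y).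
Proof.
move=> t0; have := res_cesaro y t0 t0; rewrite divff ?gt_eqF// scale1r.
have h1 : nrm (cesaro t (res t y)) <= M * nrm (res t y) by exact: op_bound.
have h2 : nrm (T t (res t y)) <= M * nrm (res t y) by exact: T_bound (ltW t0) _.
have h3 : nrm (res t y) <= M * nrm (res t y) by rewrite ler_peMl// nrm_ge0.
move: h1 h2 h3; move: (res t y) (cesaro t y) (T t (res t y)) (cesaro t (res t y)).
move=> r s q p h1 h2 h3 /eqP; rewrite eq_sym subr_eq => /eqP ->.
rewrite (le_trans (nrmD _ _))//; have := nrm_dist r q; lra.
Qed.

End DecayRate.

Lemma cesaro_sub_res t v : 0 < t ->
  nrm (cesaro t (v - res 1 v)) <= 2 * M * (M * nrm v) / t.
Proof.
move=> t0; have := res_cesaro v ltr01 t0; rewrite divr1 -cesaroB => h.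
have := congr1 nrm h; rewrite nrmZ (gtr0_norm t0) => E.
rewrite ler_pdivlMr// mulrC -E (le_trans (nrm_dist _ _))//.
have h1 : nrm (res 1 v) <= M * nrm v := res_bound _ _.
have h2 : nrm (T t (res 1 v)) <= M * (M * nrm v).
  by rewrite (le_trans (T_bound (ltW t0) _))// ler_wpM2l.
have h3 : M * nrm v <= M * (M * nrm v) by rewrite ler_peMl// mulr_ge0// nrm_ge0.
by rewrite (_ : 2 * M * (M * nrm v) = M * (M * nrm v) + M * (M * nrm v)) ?lerD ?(le_trans h1)//; ring.
Qed.

Lemma ln_le_sqrt (t : R) : 0 < t -> ln t <= 2 * Num.sqrt t.
Proof.
move=> t0; have s0 : 0 < Num.sqrt t by rewrite sqrtr_gt0.
rewrite -{1}(sqr_sqrtr (ltW t0)) lnXn// mulr_natl ler_pMn2r//.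
have := @le_ln1Dx _ (Num.sqrt t - 1); rewrite subrKC ltrBrDl subrr s0 => /(_ isT) h.
by rewrite (le_trans h)// gerBl.
Qed.

(** Approximating y and b from the dense range leaves terms of order a ln(1/a) and a, plus an error
    proportional to the distance [d]. *)
Lemma remainder_decay y b e : op high_law y - y = b - res 1 b -> 0 < e ->
  closure (gen_range T) = setT ->
  exists a0, [/\ 0 < a0, a0 < 1 & forall psi a, bfun 1 psi -> 0 < a -> a <= a0 ->
    `|remainder y b psi a| <= e].
Proof.
move=> highE e0 dense.
have split_range v d : 0 < d -> exists w, nrm (v - w) <= d /\ gen_range T w.
  move=> d0; have : closure (gen_range T) v by rewrite dense.
  have d0' : 0 < d%:C by rewrite ltcR.
  move=> /(_ (ball v d%:C)) []; first exact: nbhsx_ballx.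
  move=> w [rw]; rewrite -ball_normE /ball_ /= nrmE ltcR => h.
  by exists w; split=> //; exact: ltW.
have MM0 : 0 < M * M by rewrite mulr_gt0// (lt_le_trans ltr01).
(* The approximation errors are at most 4 M^2 d from y and M^2 d from b, together e/2. *)
pose d := e / (10 * (M * M)).
have d0 : 0 < d by rewrite divr_gt0// mulr_gt0.
have [y1 [hy1 [z hz]]] := split_range y d d0.
have [b1 [hb1 [w hw]]] := split_range b d d0.
have gb v1 v a : gen T v v1 -> 0 < a -> nrm (res a^-1 v1) <= a * (2 * M * nrm v).
  move=> gv a0; have ai0 : 0 < a^-1 by rewrite invr_gt0.
  have := congr1 nrm (res_gen_eq ai0 gv); rewrite nrmZ gtr0_norm// => E.
  by rewrite -ler_pdivrMl// E sub_res_bound.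
pose C := 4 * M * M * nrm z.
have C0 : 0 <= C by rewrite /C !mulr_ge0 ?nrm_ge0.
pose K := 2 * M * M * nrm w + 3 * C.
have K0 : 0 <= K by rewrite /K addr_ge0// ?mulr_ge0 ?nrm_ge0.
(* All remaining terms are at most K times the square root of a; the threshold r^2 keeps them below
   e/2. *)
pose r := Num.min (1 / 2) (e / (2 * (K + 1))).
have r0 : 0 < r by rewrite lt_min !divr_gt0// mulr_gt0// ltr_wpDl.
have r1 : r < 1 by rewrite gt_min ltr_pdivrMr// mul1r ltr1n.
have rK : K * r <= e / 2.
  have h : r <= e / (2 * (K + 1)) by rewrite ge_min lexx orbT.
  have : (K + 1) * r <= e / 2.
    by rewrite mulrC -ler_pdivlMr ?ltr_wpDl// -mulrA -invfM.
  by apply: le_trans; rewrite ler_wpM2r ?(ltW r0)// lerDl.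
exists (r ^+ 2); split; first exact: exprn_gt0.
  by rewrite expr2 mulr_ilt1// ltW.
move=> psi a hp a0 ar.
have a1 : a < 1 by apply: le_lt_trans ar _; rewrite expr2 mulr_ilt1// ltW.
have ai0 : 0 < a^-1 by rewrite invr_gt0.
set s := Num.sqrt a.
have s0 : 0 < s by rewrite sqrtr_gt0.
have sr : s <= r by rewrite -(ger0_norm (ltW r0)) -sqrtr_sqr ler_sqrt// exprn_ge0// ltW.
have as2 : a = s * s by rewrite -expr2 sqr_sqrtr// ltW.
have s1 : s <= 1 by rewrite (le_trans sr)// ltW.
have as1 : a <= s by rewrite as2 ler_piMr// ltW.
have aln : a - a * ln a <= 3 * s.
  have := ln_le_sqrt ai0; rewrite lnV ?posrE// sqrtrV ?(ltW a0)// -/s => h.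
  have : a * - ln a <= a * (2 * s^-1) by rewrite ler_wpM2l// ltW.
  have -> : a * (2 * s^-1) = 2 * s by rewrite as2; field; rewrite gt_eqF.
  by rewrite mulrN; lra.
have Ey : y = y1 + (y - y1) by rewrite subrKC.
apply: le_trans (remainder_bound highE hp Ey a0 a1 C0 _) _.
  move=> c c0; rewrite resB (resC _ c); apply: le_trans (sub_res_bound _ _) _.
  rewrite (_ : a * C = 2 * M * (a * (2 * M * nrm z))); last by rewrite /C; ring.
  by rewrite ler_wpM2l ?mulr_ge0// gb.
have h1 : nrm (res 1 (res a^-1 b)) <= M * (a * (2 * M * nrm w) + M * d).
  rewrite (le_trans (res_bound _ _))// ler_wpM2l//.
  rewrite -[X in res _ X](subrKC b1) /res opD (le_trans (nrmD _ _))// lerD//; first exact: gb.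
  by rewrite (le_trans (op_bound _ _))// ler_wpM2l.
have h2 : 4 * M * (M * nrm (y - y1)) <= 4 * (M * (M * d)).
  by rewrite -mulrA ler_wpM2l// ler_wpM2l// ler_wpM2l.
have h3 : C * (a - a * ln a) <= C * (3 * s) by rewrite ler_wpM2l.
have h4 : 5 * (M * (M * d)) = e / 2.
  by rewrite /d; field; rewrite gt_eqF// (lt_le_trans ltr01).
have h5 : M * (a * (2 * M * nrm w)) <= M * (s * (2 * M * nrm w)).
  by rewrite ler_wpM2l// ler_wpM2r// !mulr_ge0// nrm_ge0.
have h6 : K * s <= e / 2 by apply: le_trans rK; rewrite ler_wpM2l.
have h7 : K * s = M * (s * (2 * M * nrm w)) + C * (3 * s) by rewrite /K; ring.
move: h1 h2 h3 h4 h5 h6; rewrite h7 mulrDr.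
move: (nrm (res 1 _)) (4 * M * (M * nrm (y - y1))) (M * (M * d)) (C * (a - a * ln a)).
move: (C * (3 * s)) (M * (a * (2 * M * nrm w))) (M * (s * (2 * M * nrm w))).
move=> q1 q2 q3 q4 q5 q6 q7; lra.
Qed.

Section CesaroDecay.
Variables (x b : X).
Let y := res 1 (res 1 x).
Hypothesis highE : op high_law y - y = b - res 1 b.
Hypothesis hinj : gen_injective T.

(** From 1 - J^2 = (1 - J)(1 + J): x is y plus a vector of the range of 1 - J. The means of the
    latter are O(1/t), and [ln_le_sqrt] converts this to the scale of 1/ln t. The 9 is 3 from
    [res_decay] times 3 from [cesaro_res_bound]. *)
Let cesaro_split t k : 1 < t ->
  (forall psi a, bfun 1 psi -> 0 < a -> a <= t^-1 -> `|remainder y b psi a| <= k) ->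
  nrm (cesaro t x) <= (9 * M * k + 4 * M * (M * nrm (x + res 1 x)) / Num.sqrt t) / ln t.
Proof.
move=> t1 hk; have t0 : 0 < t := lt_trans ltr01 t1.
have l0 : 0 < ln t by rewrite ln_gt0.
have ti0 : 0 < t^-1 by rewrite invr_gt0.
have ti1 : t^-1 < 1 by rewrite invf_lt1.
have s0 : 0 < Num.sqrt t by rewrite sqrtr_gt0.
have h1 := res_decay highE hinj ti0 ti1 hk; rewrite invrK lnV ?posrE// opprK in h1.
have h2 := cesaro_res_bound y t0.
have h3 := cesaro_sub_res (x + res 1 x) t0.
have E : x = y + (x + res 1 x - res 1 (x + res 1 x)).
  rewrite (_ : res 1 (x + res 1 x) = res 1 x + y); last exact: opD.
  by rewrite [x + _ - _](_ : _ = x - y) ?subrKC// opprD addrA addrK.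
rewrite {1}E /cesaro opD (le_trans (nrmD _ _))// mulrDl lerD//.
  apply: (le_trans h2); rewrite (_ : 9 * M * k / ln t = 3 * M * (3 * k / ln t)); last by ring.
  by rewrite ler_wpM2l// mulr_ge0.
apply: (le_trans h3).
rewrite -[leRHS]mulrA -invfM ler_pdivlMr ?mulr_gt0// mulrAC ler_pdivrMr//.
set N := M * nrm _.
have N0 : 0 <= N by rewrite /N mulr_ge0// nrm_ge0.
have := ln_le_sqrt t0; set s := Num.sqrt t => hl.
have -> : 4 * M * N * t = 2 * M * N * (s * (2 * s)).
  by rewrite -{1}(sqr_sqrtr (ltW t0)) -/s; ring.
apply: ler_wpM2l; first exact: (mulr_ge0 (mulr_ge0 (ler0n R 2) M0) N0).
by apply: ler_wpM2l => //; exact: ltW.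
Qed.

Lemma cesaro_bigO t : 2 <= t -> nrm (cesaro t x) <=
  (9 * M * (M * (M * nrm b) + 4 * M * (M * nrm y)) + 4 * M * (M * nrm (x + res 1 x))) / ln t.
Proof.
move=> t2; have t1 : 1 < t by apply: lt_le_trans t2; rewrite ltr1n.
have l0 : 0 < ln t by rewrite ln_gt0.
have s0 : 1 <= Num.sqrt t by rewrite -sqrtr1 ler_sqrt ltW// (lt_trans ltr01).
apply: le_trans (cesaro_split t1 (k := M * (M * nrm b) + 4 * M * (M * nrm y)) _) _.
  move=> psi a hp a0 at1; apply: remainder_bound0 => //.
  by apply: le_lt_trans at1 _; rewrite invf_lt1// (lt_trans ltr01).
rewrite ler_pM2r ?invr_gt0// lerD2l ler_pdivrMr ?(lt_le_trans ltr01)//.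
by rewrite ler_peMr// !mulr_ge0// nrm_ge0.
Qed.

Lemma cesaro_littleo e : closure (gen_range T) = setT -> 0 < e ->
  exists2 t0, 1 < t0 & forall t, t0 <= t -> nrm (cesaro t x) <= e / ln t.
Proof.
move=> dense e0; set N := 4 * M * (M * nrm (x + res 1 x)).
have N0 : 0 <= N by rewrite /N !mulr_ge0// nrm_ge0.
have M0' : 0 < M := lt_le_trans ltr01 M1.
have k0 : 0 < e / (18 * M) by rewrite divr_gt0// mulr_gt0.
have [a0 [a00 a01 ha]] := remainder_decay highE k0 dense.
set s := 2 * N / e + 1.
have s1 : 1 <= s by rewrite /s lerDr (divr_ge0 (mulr_ge0 (ler0n R 2) N0) (ltW e0)).
exists (Num.max a0^-1 (s ^+ 2)); first by rewrite lt_max invf_gt1// a01.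
move=> t; rewrite ge_max => /andP[t1 t2].
have t0 : 1 < t by apply: lt_le_trans t1; rewrite invf_gt1.
have tp := lt_trans ltr01 t0.
have l0 : 0 < ln t by rewrite ln_gt0.
apply: le_trans (cesaro_split t0 (k := e / (18 * M)) _) _.
  move=> psi a hp ap at1; apply: ha => //; apply: (le_trans at1).
  by rewrite -[leRHS]invrK lef_pV2 ?posrE ?invr_gt0.
rewrite ler_pM2r ?invr_gt0// (_ : 9 * M * (e / (18 * M)) = e / 2); last first.
  by field; rewrite gt_eqF.
have st : s <= Num.sqrt t.
  by rewrite -[leLHS]ger0_norm ?(le_trans ler01)// -sqrtr_sqr ler_sqrt// ltW.
have sp : 0 < Num.sqrt t := lt_le_trans (lt_le_trans ltr01 s1) st.
have : N / Num.sqrt t <= e / 2; last by rewrite -/N; lra.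
rewrite ler_pdivrMr//; apply: (@le_trans _ _ (e / 2 * s)).
  have -> : e / 2 * s = N + e / 2 by rewrite /s; field; rewrite gt_eqF.
  by rewrite lerDl divr_ge0// ltW.
by rewrite ler_wpM2l// divr_ge0// ltW.
Qed.

End CesaroDecay.

(** * The domain of log A *)

Section FunctionalOfCalculus.
Variables (psi : X -> R).
Hypothesis hp1 : bfun 1 psi.
Let lp := bfun_rlin hp1.

(** The complex-linear functional with real part psi; [wint] is tested on complex-linear functionals
    only. *)
Definition complexify (v : X) : R[i] := psi v +i* - psi ('i *: v).

Lemma psiZ (a : R[i]) v :
  psi (a *: v) = complex.Re a * psi v + complex.Im a * psi ('i *: v).
Proof.
rewrite {1}(complexE a) scalerDl (rlinD _ _ lp) (rlinZ _ _ lp); congr (_ + _).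
by rewrite mulrC -scalerA (rlinZ _ _ lp).
Qed.

Lemma complexify_linear (a : R[i]) u v :
  complexify (a *: u + v) = a * complexify u + complexify v.
Proof.
apply: complex_eqP; rewrite /complexify /=.
  by rewrite (rlinD _ _ lp) psiZ; case: a => p q /=; ring.
rewrite scalerDr (rlinD _ _ lp) scalerA [psi ((_ * a) *: u)]psiZ.
by case: a => p q /=; ring.
Qed.

Lemma complexify_bound : exists C : R, forall v, `|complexify v| <= C%:C * `|v|.
Proof.
exists 2 => v; rewrite nrmE -rmorphM /= normc_def lecR /=.
have h1 := bfun1_le v hp1; have h2 := bfun1_le ('i *: v) hp1.
have n2 : nrm ('i *: v) = nrm v.
  by rewrite nrmZc /= expr0n add0r expr1n sqrtr1 mul1r.
rewrite n2 in h2.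
have h0 := nrm_ge0 v.
rewrite -[leRHS]ger0_norm ?mulr_ge0// -sqrtr_sqr ler_sqrt ?sqr_ge0// sqrrN.
rewrite -(real_normK (num_real (psi v))) -(real_normK (num_real (psi ('i *: v)))).
move: h1 h2 (normr_ge0 (psi v)) (normr_ge0 (psi ('i *: v))).
move: `|psi v| `|psi ('i *: v)| => p q h1 h2 p0 q0.
have e1 : p ^+ 2 <= nrm v ^+ 2 by rewrite lerXn2r ?nnegrE.
have e2 : q ^+ 2 <= nrm v ^+ 2 by rewrite lerXn2r ?nnegrE.
have e3 : 0 <= nrm v ^+ 2 by rewrite exprn_ge0.
rewrite exprMn; lra.
Qed.

Lemma cexp_kc (s : R) (z : R[i]) : 0 <= s ->
  cexp (- s%:C * z) = kc (complex.Re z) (complex.Im z) s +i* ks (complex.Re z) (complex.Im z) s.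
Proof.
case: z => a b s0; rewrite /cexp /kc /ks maxr0_id//=.
have -> : - s * a - - 0 * b = - (a * s) by rewrite oppr0 mul0r subr0 mulNr mulrC.
have -> : - s * b + - 0 * a = - (b * s) by rewrite oppr0 mul0r addr0 mulNr mulrC.
rewrite cosN sinN; apply: complex_eqP => /=; ring.
Qed.

Let psi_i v := psi ('i *: v).

Let bfun_i : bfun 1 psi_i.
Proof.
have := bfun_scale 'i hp1; rewrite normr1 mul1r.
by rewrite (_ : Normc.normc _ = 1) //= expr0n add0r expr1n sqrtr1.
Qed.

(** Independence of the representing measure. At positive integers f is real, so the imaginary
    density annihilates the exponentials and hence every orbit, while the real density agrees with
    [cs] on exponentials and hence on orbits. *)
Lemma hp_functional (f : R[i] -> R[i]) x y cs : hp T f x y ->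
  (forall z, 0 < complex.Re z -> f z = lap_comb cs z) -> psi y = ev_comb cs (orb psi x).
Proof.
move=> [mu [hr [hi [mhr mhi [K hK] lapf wy]]]] fE.
pose L := ev_comb cs; have gL : good L := @good_ev_comb R cs.
have Lf (j : nat) : f (j.+1%:R : R)%:C = (L (ex j.+1))%:C.
  by rewrite fE ?lap_comb_ex//= ltr0n.
have mD : measurable (`[0, +oo[%classic : set R) by [].
have br : bmeas (`[0, +oo[%classic : set R) hr by apply: bmeasS => //; exists K => r; case: (hK r).
have bi : bmeas (`[0, +oo[%classic : set R) hi by apply: bmeasS => //; exists K => r; case: (hK r).
pose Lr F := \int[mu]_(s in `[0, +oo[) (F s * hr s).
pose Li F := \int[mu]_(s in `[0, +oo[) (F s * hi s).
have gr : good Lr by exact: (good_measure mD (@measurable_id _ _ _) br).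
have gi : good Li by exact: (good_measure mD (@measurable_id _ _ _) bi).
have Lj (j : nat) : Lr (ex j.+1) = L (ex j.+1) /\ Li (ex j.+1) = 0.
  have z0 : 0 < complex.Re (j.+1%:R : R)%:C by rewrite /= ltr0n.
  have := lapf _ z0; rewrite Lf /cint.
  have ce (s : R) : 0 <= s -> cexp (- s%:C * (j.+1%:R : R)%:C) = (ex j.+1 s)%:C.
    by move=> s0; rewrite cexp_kc//= kc_ex ks_ex.
  have Er : \int[mu]_(s in `[0, +oo[) complex.Re (cexp (- s%:C * (j.+1%:R : R)%:C) * (hr s +i* hi s)) =
      Lr (ex j.+1) by apply: eq_Rintegral_ge0 => s s0; rewrite ce//= mul0r subr0.
  have Ei : \int[mu]_(s in `[0, +oo[) complex.Im (cexp (- s%:C * (j.+1%:R : R)%:C) * (hr s +i* hi s)) =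
      Li (ex j.+1) by apply: eq_Rintegral_ge0 => s s0; rewrite ce//= mul0r addr0.
  rewrite Er Ei; move: (Lr _) (Li _) => p q h.
  have := congr1 (@complex.Re R) h; have := congr1 (@complex.Im R) h => /=.
  by split; lra.
have bx := bcont_orb x ler01 hp1; have bxi := bcont_orb x ler01 bfun_i.
have Ey : psi y = Lr (orb psi x) + Li (orb psi_i x).
  have := congr1 (@complex.Re R) (wy _ complexify_linear complexify_bound).
  rewrite /cint /= => ->; rewrite mul0r mul1r subr0 addr0.
  have bD (F : R -> R) : bcont F -> bmeas (`[0, +oo[%classic : set R) F.
    by move=> [cF bF _]; apply: bmeasS => //; exact: continuous_measurable_fun.
  rewrite -RintegralD//; [|by apply: bmeas_integrable => //; apply: bmeasM => //; exact: bD..].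
  apply: eq_Rintegral_ge0 => s s0.
  by rewrite psiZ /= /orb maxr0_id// /psi_i; ring.
have Li0 : Li (orb psi_i x) = 0 by apply: (good_eq0 gi bxi) => j; case: (Lj j).
rewrite Li0 addr0 in Ey.
have gd : good (fun F => Lr F + -1 * L F) by exact: good_comb.
have := good_eq0 gd bx; rewrite Ey => h.
apply/eqP; rewrite -subr_eq0; apply/eqP; rewrite -mulN1r; apply: h => j.
by have [-> _] := Lj j; rewrite mulN1r subrr.
Qed.

End FunctionalOfCalculus.

Definition op_comb s x : X := \sum_(p <- s) p.1%:C *: op p.2 x.

Lemma op_combE s psi C x : bfun C psi -> psi (op_comb s x) = ev_comb s (orb psi x).
Proof.
move=> hp1; have lp := bfun_rlin hp1; elim: s => [|[c P] s].
  by rewrite /op_comb /ev_comb !big_nil (rlin0 lp).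
rewrite /op_comb /ev_comb !big_cons /=; move: (\sum_(p <- s) _) => v.
by rewrite (rlinD _ _ lp) (rlinZ _ _ lp) (op_ev P x hp1) => ->.
Qed.

Lemma hp_op_comb (f : R[i] -> R[i]) s x y : hp T f x y ->
  (forall z, 0 < complex.Re z -> f z = lap_comb s z) -> y = op_comb s x.
Proof.
move=> h fE; apply: eq_bfun => psi hp1; rewrite (op_combE s x hp1).
exact: hp_functional h fE.
Qed.

Lemma op_comb_cons c (P : probability R R) s x :
  op_comb ((c, P) :: s) x = c%:C *: op P x + op_comb s x.
Proof. by rewrite /op_comb big_cons. Qed.

Lemma op_comb_nil x : op_comb [::] x = 0.
Proof. by rewrite /op_comb big_nil. Qed.

Lemma op_combD s u v : op_comb s (u + v) = op_comb s u + op_comb s v.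
Proof.
elim: s => [|[c P] s IH]; first by rewrite !op_comb_nil addr0.
by rewrite !op_comb_cons IH opD scalerDr addrACA.
Qed.

Lemma op_combZ s (a : R[i]) u : op_comb s (a *: u) = a *: op_comb s u.
Proof.
elim: s => [|[c P] s IH]; first by rewrite !op_comb_nil scaler0.
by rewrite !op_comb_cons IH opZ scalerDr !scalerA mulrC.
Qed.

Lemma op_combB s u v : op_comb s (u - v) = op_comb s u - op_comb s v.
Proof. by rewrite op_combD -scaleN1r op_combZ scaleN1r. Qed.

Lemma op_comb_0 s : op_comb s 0 = 0.
Proof. by have := op_combB s 0 0; rewrite !subrr. Qed.

Lemma op_comb_bound s : exists2 B, 0 <= B & forall x, nrm (op_comb s x) <= B * nrm x.
Proof.
elim: s => [|[c P] s [B B0 hB]].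
  by exists 0 => // x; rewrite op_comb_nil nrm0 mul0r.
exists (`|c| * M + B) => [|x]; first by rewrite addr_ge0// mulr_ge0.
rewrite op_comb_cons (le_trans (nrmD _ _))// mulrDl lerD// nrmZ -mulrA ler_wpM2l//.
exact: op_bound.
Qed.

Lemma op_log_comb (E Q N : probability R R) x :
  op_comb (log_comb E Q N) x = op Q x - 2%:C *: op E (op Q x) + op E (op E (op Q x)) -
    op E (op E x) + op E (op E (op N x)).
Proof.
rewrite /log_comb 5!op_comb_cons op_comb_nil.
rewrite (op_conv E Q x) (op_conv E (conv E Q) x) (op_conv E Q x) (op_conv E E x).
rewrite (op_conv E (conv E N) x) (op_conv E N x).
move: (op E (op E (op N x))) (op E (op E x)) (op E (op E (op Q x))) (op E (op Q x)).
move: (op Q x) => v1 v2 v3 v4 v5.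
by rewrite addr0 !rmorphN !scaleNr !scale1r !addrA.
Qed.

Lemma op_reg_comb (E : probability R R) x :
  op_comb (reg_comb E) x = op E x - op E (op E x).
Proof.
rewrite /reg_comb 2!op_comb_cons op_comb_nil (op_conv E E x).
move: (op E (op E x)) (op E x) => v1 v2.
by rewrite addr0 rmorphN scaleNr !scale1r.
Qed.

Let high_algebra (q q1 q2 x2 n2 u1 u2 : X) :
  q - 2%:C *: q1 + q2 - x2 + n2 = u1 - u2 -> n2 - x2 = u1 - (q - q1) - (u2 - (q1 - q2)).
Proof.
move=> h; apply: eq_bfun => psi hp1; have lp := bfun_rlin hp1.
have := congr1 psi h; rewrite !(rlinD _ _ lp, rlinN _ lp, rlinZ _ _ lp); lra.
Qed.

Lemma high_identity x u : op_comb elog_comb x = op_comb ereg_comb u ->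
  let y := res 1 (res 1 x) in
  let b := res 1 u - (op low_law x - res 1 (op low_law x)) in
  op high_law y - y = b - res 1 b.
Proof.
move=> h0; cbv zeta.
have e1 : op high_law (res 1 (res 1 x)) = res 1 (res 1 (op high_law x)).
  exact: (etrans (op_comm high_law (expd_scaled 1) (res 1 x))
    (congr1 (res 1) (op_comm high_law (expd_scaled 1) x))).
rewrite e1 (resB 1 (res 1 u) (op low_law x - res 1 (op low_law x))).
rewrite (resB 1 (op low_law x) (res 1 (op low_law x))).
have : op low_law x - 2%:C *: res 1 (op low_law x) + res 1 (res 1 (op low_law x)) -
    res 1 (res 1 x) + res 1 (res 1 (op high_law x)) = res 1 u - res 1 (res 1 u).
  exact: (etrans (esym (op_log_comb (expd_scaled 1) low_law high_law x))
    (etrans h0 (op_reg_comb (expd_scaled 1) u))).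
exact: high_algebra.
Qed.

Lemma lap_combE (s : seq (R * probability R R)) (z : R[i]) : lap_comb s z =
  ev_comb s (kc (complex.Re z) (complex.Im z)) +i* ev_comb s (ks (complex.Re z) (complex.Im z)).
Proof.
rewrite /lap_comb /ev_comb; elim: s => [|p s IH]; first by rewrite !big_nil.
rewrite !big_cons IH; apply: complex_eqP => /=; ring.
Qed.

Lemma hp_witness (f : R[i] -> R[i]) s x :
  (forall p, List.In p s -> nonneg_law p.2) ->
  (forall z, 0 < complex.Re z -> f z = lap_comb s z) -> hp T f x (op_comb s x).
Proof.
move=> hs fE; have [mu [h [bh hE]]] := ev_comb_pos_density hs.
have [mh [K hK]] := bh.
exists mu, h, (fun=> 0); split=> //.
- exists K => r; split; first exact: hK.
  by rewrite normr0; exact: le_trans (normr_ge0 _) (hK r I).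
- move=> z z0; rewrite fE// lap_combE.
  have b1 := bcont_bmeas (bcont_kc (complex.Im z) (ltW z0)).
  have b2 := bcont_bmeas (bcont_ks (complex.Im z) (ltW z0)).
  rewrite (hE _ b1) (hE _ b2) /cint.
  have E1 : \int[mu]_(r in `[0, +oo[) complex.Re (cexp (- r%:C * z) * (h r +i* 0)) =
      \int[mu]_(r in `[0, +oo[) (kc (complex.Re z) (complex.Im z) r * h r).
    by apply: eq_Rintegral_ge0 => r r0; rewrite cexp_kc//= mulr0 subr0.
  have E2 : \int[mu]_(r in `[0, +oo[) complex.Im (cexp (- r%:C * z) * (h r +i* 0)) =
      \int[mu]_(r in `[0, +oo[) (ks (complex.Re z) (complex.Im z) r * h r).
    by apply: eq_Rintegral_ge0 => r r0; rewrite cexp_kc//= mulr0 add0r.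
  by rewrite E1 E2; apply: complex_eqP => /=; ring.
- move=> phi lphi [C bphi].
  have part (q : R[i] -> R) : (forall (r : R) u v, q (r%:C * u + v) = r * q u + q v) ->
      (forall u, `|q u| <= Normc.normc u) -> bfun C (q \o phi).
    move=> lq bq; split=> [r u v|u] /=; first by rewrite lphi lq.
    apply: le_trans (bq _) _; have := bphi u; rewrite nrmE -rmorphM /= normc_def lecR.
    by case: (phi u).
  have Rb : bfun C (@complex.Re R \o phi).
    apply: part; first by move=> r [u1 u2] [v1 v2] /=; rewrite mul0r subr0.
    by move=> [u1 u2] /=; rewrite -sqrtr_sqr ler_sqrt ?addr_ge0 ?sqr_ge0// lerDl sqr_ge0.
  have Ib : bfun C (@complex.Im R \o phi).
    apply: part; first by move=> r [u1 u2] [v1 v2] /=; rewrite mul0r addr0.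
    by move=> [u1 u2] /=; rewrite -sqrtr_sqr ler_sqrt ?addr_ge0 ?sqr_ge0// lerDr sqr_ge0.
  have val (psi : X -> R) : bfun C psi -> psi (op_comb s x) =
      \int[mu]_(r in `[0, +oo[) (psi (T r x) * h r).
    move=> hp1; rewrite (op_combE s x hp1) hE; last first.
      exact: bcont_bmeas (bcont_orb x (normr_ge0 C) (bfun_norm_ge0 hp1)).
    by apply: eq_Rintegral_ge0 => r r0; rewrite /orb maxr0_id.
  have E1 : \int[mu]_(r in `[0, +oo[) complex.Re (phi ((h r +i* 0) *: T r x)) =
      complex.Re (phi (op_comb s x)).
    rewrite -[RHS]/((@complex.Re R \o phi) _) (val _ Rb); apply: eq_Rintegral => r _ /=.
    exact: etrans (rlinZ (h r) (T r x) (bfun_rlin Rb)) (mulrC _ _).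
  have E2 : \int[mu]_(r in `[0, +oo[) complex.Im (phi ((h r +i* 0) *: T r x)) =
      complex.Im (phi (op_comb s x)).
    rewrite -[RHS]/((@complex.Im R \o phi) _) (val _ Ib); apply: eq_Rintegral => r _ /=.
    exact: etrans (rlinZ (h r) (T r x) (bfun_rlin Ib)) (mulrC _ _).
  rewrite /cint E1 E2; move: (phi _) => [a b]; apply: complex_eqP => /=; ring.
Qed.

Lemma hp_elog x : hp T (@elog R) x (op_comb elog_comb x).
Proof.
apply: hp_witness => [p|]; last exact: lap_elog_comb.
move=> [<-|[<-|[<-|[<-|[<-|//]]]]].
- exact: nonneg_low_law.
- exact: nonneg_conv.
- exact: nonneg_conv.
- exact: nonneg_conv.
- exact: nonneg_conv.
Qed.

Lemma hp_ereg x : hp T (@ereg R) x (op_comb ereg_comb x).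
Proof.
apply: hp_witness => [p|]; last exact: lap_ereg_comb.
move=> [<-|[<-|//]].
- exact: nonneg_expd_scaled.
- exact: nonneg_conv.
Qed.

Lemma dom_logE x : dom_log T x <-> exists u, op_comb elog_comb x = op_comb ereg_comb u.
Proof.
split=> [[w [hw [u hu]]]|[u h]].
  by exists u; rewrite -(hp_op_comb hw lap_elog_comb) (hp_op_comb hu lap_ereg_comb).
exists (op_comb elog_comb x); split; first exact: hp_elog.
by exists u; rewrite h; exact: hp_ereg.
Qed.

(** The graph of log A, [gnorm] being its graph norm. It is closed because both sides are bounded
    operators. *)
Definition graph (p : X * X) := op_comb elog_comb p.1 = op_comb ereg_comb p.2.

Definition gnorm (p : X * X) := nrm p.1 + nrm p.2.

(** The bound of (a) made uniform: b and y depend boundedly on the pair (x, log A x). *)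
Lemma cesaro_graph_bound : gen_injective T ->
  exists2 K, 0 < K & forall p, graph p -> forall t, 2 <= t ->
    nrm (cesaro t p.1) <= K * gnorm p / ln t.
Proof.
move=> hinj; have Mp : 0 < M := lt_le_trans ltr01 M1.
exists (9 * M * (M * (M * (M + M * M)) + 4 * M * (M * (M * M))) + 4 * M * (M * (1 + M))).
  by rewrite !(addr_gt0, mulr_gt0).
move=> [x u] hg t t2.
have l0 : 0 < ln t by rewrite ln_gt0// (lt_le_trans _ t2)// ltr1n.
have hI := high_identity hg.
apply: le_trans (cesaro_bigO hI hinj t2) _.
rewrite ler_pM2r ?invr_gt0// /gnorm /=.
have x0 := nrm_ge0 x; have u0 := nrm_ge0 u.
have b1 : nrm (res 1 u - (op low_law x - res 1 (op low_law x))) <= (M + M * M) * (nrm x + nrm u).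
  have h1 := res_bound 1 u; have h2 := op_bound low_law x.
  have h3 : nrm (res 1 (op low_law x)) <= M * (M * nrm x).
    by rewrite (le_trans (res_bound _ _))// ler_wpM2l.
  have h4 := nrm_dist (res 1 u) (op low_law x - res 1 (op low_law x)).
  have h5 := nrm_dist (op low_law x) (res 1 (op low_law x)).
  have h6 : 0 <= M * (M * nrm u) by rewrite !mulr_ge0.
  apply: (le_trans h4); apply: (le_trans (lerD h1 (le_trans h5 (lerD h2 h3)))).
  rewrite [leRHS](_ : _ = M * nrm u + (M * nrm x + M * (M * nrm x)) + M * (M * nrm u)).
    by rewrite lerDl.
  by ring.
have b2 : nrm (res 1 (res 1 x)) <= M * M * (nrm x + nrm u).
  rewrite (le_trans (res_bound _ _))// -mulrA ler_wpM2l// (le_trans (res_bound _ _))//.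
  by rewrite ler_wpM2l// lerDl.
have b3 : nrm (x + res 1 x) <= (1 + M) * (nrm x + nrm u).
  rewrite (le_trans (nrmD _ _))// mulrDl mul1r lerD ?lerDl//.
  by rewrite (le_trans (res_bound _ _))// ler_wpM2l// lerDl.
rewrite [leRHS](_ : _ = 9 * M * (M * (M * ((M + M * M) * (nrm x + nrm u))) +
    4 * M * (M * (M * M * (nrm x + nrm u)))) + 4 * M * (M * ((1 + M) * (nrm x + nrm u)))).
  have M4 : 0 <= 4 * M by rewrite mulr_ge0.
  have M9 : 0 <= 9 * M by rewrite mulr_ge0.
  apply: lerD; last by do 2!apply: ler_wpM2l => //.
  by apply: ler_wpM2l => //; apply: lerD; do 2!apply: ler_wpM2l => //.
by ring.
Qed.

(** * Approximate eigenvectors and optimality *)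

Section ApproximateEigenvector.
Variables (mu : R[i]) (v w : X).
Hypothesis mu0 : 0 < complex.Re mu.
Hypothesis gvw : gen T v w.
Let g := mu *: v - w.
Let rho := M * nrm g / Normc.normc mu.

Let mup : 0 < Normc.normc mu.
Proof. exact: normc_gt0. Qed.

Let den_bound (a : R) : 0 < a -> a * Normc.normc mu <= Normc.normc (1 + a%:C * mu).
Proof.
move: mu0; case: (mu) => p q /= p0 a0; have ap : 0 < a * p by rewrite mulr_gt0.
rewrite -{1}(ger0_norm (ltW a0)) -sqrtr_sqr -sqrtrM ?sqr_ge0// ler_sqrt; last first.
  by rewrite addr_ge0 ?sqr_ge0.
rewrite !mul0r !subr0 !addr0 !add0r mulrDr -!exprMn lerD2r.
by rewrite lerXn2r ?nnegrE// ?ltW// ?addr_gt0//; lra.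
Qed.

Let den_neq0 (a : R) : 0 < a -> 1 + a%:C * mu != 0.
Proof.
move=> a0; apply/eqP => h; have := den_bound a0.
by rewrite h Normc.normc0 leNgt mulr_gt0.
Qed.

(** The difference equals a/(1 + a mu) times [res a g], and |a/(1 + a mu)| <= 1/|mu| because Re mu >
    0. The bound is free of a, so it survives averaging over the parameter of a mixture of
    resolvents. *)
Lemma res_approx (a : R) : 0 < a -> nrm (res a v - (1 + a%:C * mu)^-1 *: v) <= rho.
Proof.
move=> a0; have := res_gen_eq a0 gvw.
have -> : w = mu *: v - g by rewrite /g opprB subrKC.
rewrite resB resZ scalerBr scalerA.
have E2 := resZ; move: (res_bound a g); move: (res a v) (res a g) => p q hq h.
have d0 := den_neq0 a0.
have E : (1 + a%:C * mu) *: p = v + a%:C *: q.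
  by rewrite scalerDl scale1r; move/eqP: h; rewrite subr_eq => /eqP ->; rewrite addrA subrKC.
have -> : p - (1 + a%:C * mu)^-1 *: v = (a%:C / (1 + a%:C * mu)) *: q.
  rewrite -[p](scalerK d0) E -scalerBr addrAC subrr add0r scalerA mulrC.
  by [].
rewrite nrmZc Normc.normcM Normc.normcV.
have na : Normc.normc a%:C = a by rewrite normc_real gtr0_norm.
have dp : 0 < Normc.normc (1 + a%:C * mu) by apply: lt_le_trans (den_bound a0); rewrite mulr_gt0.
rewrite na /rho [leRHS]mulrC; apply: ler_pM => //.
- by rewrite divr_ge0// ltW.
- exact: nrm_ge0.
by rewrite ler_pdivrMr// ler_pdivlMl// mulrC; exact: den_bound.
Qed.

Lemma lap_expd_scaled (a : R) : 0 < a -> lap (expd_scaled a) mu = (1 + a%:C * mu)^-1.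
Proof.
move: mu0; case: (mu) => p q /= p0 a0; rewrite /lap /= expd_scaled_kc// expd_scaled_ks//.
by apply: complex_eqP => /=; rewrite !mul0r subr0 !addr0 !add0r ?mulNr.
Qed.

(** The second hypothesis is the common shape of [low_int] and [high_int]: P is a mixture of
    exponential laws. *)
Lemma op_approx (P : probability R R) (c : R -> R) : (forall u, 0 < u -> 0 < c u) ->
  (forall F, bcont F -> bmeas setT (fun u => ev (expd_scaled (c u)) F) /\
    ev P F = ev unif (fun u => ev (expd_scaled (c u)) F)) ->
  nrm (op P v - lap P mu *: v) <= rho.
Proof.
move=> c0 hP; apply: nrm_le_bfun => psi hp1; have lp := bfun_rlin hp1.
pose F s := psi v * kc (complex.Re mu) (complex.Im mu) s +
  psi ('i *: v) * ks (complex.Re mu) (complex.Im mu) s.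
have lapE (Q : probability R R) : psi (lap Q mu *: v) = ev Q F.
  rewrite psiZ//= /F evD ?evZ//; last 4 first.
  - exact: bcont_bmeas (bcont_ks _ (ltW mu0)).
  - exact: bcont_bmeas (bcont_kc _ (ltW mu0)).
  - by apply: bmeasZ; exact: bcont_bmeas (bcont_kc _ (ltW mu0)).
  - by apply: bmeasZ; exact: bcont_bmeas (bcont_ks _ (ltW mu0)).
  by rewrite mulrC [X in _ + X]mulrC.
have bF : bcont F by apply: bcontD; apply: bcontZ; [exact: bcont_kc (ltW mu0)|exact: bcont_ks (ltW mu0)].
have bo := bcont_orb v ler01 hp1.
have [m1 e1] := hP _ bF; have [m2 e2] := hP _ bo.
rewrite (rlinB _ _ lp) (op_ev P v hp1) lapE e1 e2 -evB//.
apply: le_trans (ler_norm _) _; apply: unif_bound.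
- exact: bmeasB.
- by rewrite /rho divr_ge0 ?mulr_ge0 ?nrm_ge0// ltW.
move=> u u0 _; rewrite -lapE -(op_ev (expd_scaled (c u)) v hp1) -(rlinB _ _ lp).
rewrite lap_expd_scaled ?c0//; apply: le_trans (bfun1_le _ hp1) _.
by apply: res_approx; exact: c0.
Qed.

Lemma exp_approx : nrm (op (expd_scaled 1) v - lap (expd_scaled 1) mu *: v) <= rho.
Proof. by rewrite lap_expd_scaled//; exact: res_approx. Qed.

Lemma low_approx : nrm (op low_law v - lap low_law mu *: v) <= rho.
Proof. by apply: (@op_approx _ id) => // F bF; exact: low_int. Qed.

Lemma high_approx : nrm (op high_law v - lap high_law mu *: v) <= rho.
Proof.
by apply: (@op_approx _ (fun u => expR (- ln u))) => [u _|F bF]; [exact: expR_gt0|exact: high_int].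
Qed.

Let lap_bound (P : probability R R) : Normc.normc (lap P mu) <= 2.
Proof.
have [m1 [K1 k1]] := bcont_bmeas (bcont_kc (complex.Im mu) (ltW mu0)).
have [m2 [K2 k2]] := bcont_bmeas (bcont_ks (complex.Im mu) (ltW mu0)).
have h1 : `|ev P (kc (complex.Re mu) (complex.Im mu))| <= 1.
  by apply: ev_bound => // s; exact: kc_le1 (ltW mu0).
have h2 : `|ev P (ks (complex.Re mu) (complex.Im mu))| <= 1.
  by apply: ev_bound => // s; exact: ks_le1 (ltW mu0).
rewrite /lap /= -[leRHS]ger0_norm// -sqrtr_sqr ler_sqrt ?sqr_ge0//.
rewrite -(real_normK (num_real (ev P (kc _ _)))) -(real_normK (num_real (ev P (ks _ _)))).
move: h1 h2; set p := `|_|; set q := `|_| => h1 h2.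
have : p ^+ 2 <= 1 by rewrite expr2 mulr_ile1// normr_ge0.
have : q ^+ 2 <= 1 by rewrite expr2 mulr_ile1// normr_ge0.
lra.
Qed.

Lemma conv_approx (P Q : probability R R) K K' :
  nrm (op P v - lap P mu *: v) <= K -> nrm (op Q v - lap Q mu *: v) <= K' ->
  nrm (op (conv P Q) v - lap (conv P Q) mu *: v) <= 2 * K + M * K'.
Proof.
move=> hP hQ; rewrite lap_convE// op_conv mulrC -scalerA.
have -> : op P (op Q v) - lap Q mu *: (lap P mu *: v) =
    lap Q mu *: (op P v - lap P mu *: v) + op P (op Q v - lap Q mu *: v).
  by rewrite scalerBr opB opZ [RHS]addrC addrA subrK.
rewrite (le_trans (nrmD _ _))// lerD//.
  by rewrite nrmZc ler_pM ?nrm_ge0 ?normc_ge0.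
by rewrite (le_trans (op_bound _ _))// ler_wpM2l.
Qed.

Lemma comb_approx_cons c (P : probability R R) s K K' :
  nrm (op P v - lap P mu *: v) <= K ->
  nrm (op_comb s v - lap_comb s mu *: v) <= K' ->
  nrm (op_comb ((c, P) :: s) v - lap_comb ((c, P) :: s) mu *: v) <= `|c| * K + K'.
Proof.
move=> hP hs; rewrite op_comb_cons /lap_comb big_cons -/(lap_comb s mu) /= scalerDl.
move: (op_comb s v) (lap_comb s mu) hs => y l hs.
rewrite opprD addrACA -scalerA -scalerBr (le_trans (nrmD _ _))// lerD// nrmZ.
by rewrite ler_wpM2l.
Qed.

Lemma comb_approx_nil : nrm (op_comb [::] v - lap_comb [::] mu *: v) <= 0.
Proof. by rewrite op_comb_nil /lap_comb big_nil scale0r subrr nrm0. Qed.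

Let rho0 : 0 <= rho.
Proof. by rewrite /rho divr_ge0 ?mulr_ge0 ?nrm_ge0// ltW. Qed.

Let MM1 : 1 <= M * M. Proof. by rewrite mulr_ege1. Qed.
Let MMM : M <= M * M. Proof. by rewrite ler_peMl. Qed.

Lemma elog_approx : nrm (op_comb elog_comb v - elog mu *: v) <= 20 * (M * M * rho).
Proof.
rewrite lap_elog_comb//.
(* The five terms add up to (11 + 7 M + 2 M^2) a, whence 20. *)
have sum_bound (a : R) : 0 <= a -> a <= M * M * a -> M * a <= M * M * a ->
    1 * a + (2 * (2 * a + M * a) + (1 * (2 * a + M * (2 * a + M * a)) + (1 * (2 * a + M * a) +
      (1 * (2 * a + M * (2 * a + M * a)) + 0)))) <= 20 * (M * M * a) by move=> *; lra.
have hE := exp_approx; have hQ := low_approx; have hN := high_approx.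
have hEQ := conv_approx hE hQ; have hEE := conv_approx hE hE; have hEN := conv_approx hE hN.
have h := comb_approx_cons 1 hQ (comb_approx_cons (-2) hEQ
  (comb_approx_cons 1 (conv_approx hE hEQ) (comb_approx_cons (-1) hEE
    (comb_approx_cons 1 (conv_approx hE hEN) comb_approx_nil)))).
apply: le_trans h _; rewrite !normrN !normr1 ger0_norm//.
have r1 : rho <= M * M * rho by rewrite ler_peMl.
have r2 : M * rho <= M * M * rho by rewrite ler_wpM2r.
exact: sum_bound.
Qed.

Lemma ereg_approx : nrm (op_comb ereg_comb v - ereg mu *: v) <= 20 * (M * M * rho).
Proof.
rewrite lap_ereg_comb//.
have sum_bound (a : R) : 0 <= a -> a <= M * M * a -> M * a <= M * M * a ->
    1 * a + (1 * (2 * a + M * a) + 0) <= 20 * (M * M * a) by move=> *; lra.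
have hE := exp_approx; have hEE := conv_approx hE hE.
have h := comb_approx_cons 1 hE (comb_approx_cons (-1) hEE comb_approx_nil).
apply: le_trans h _; rewrite !normrN !normr1.
have r1 : rho <= M * M * rho by rewrite ler_peMl.
have r2 : M * rho <= M * M * rho by rewrite ler_wpM2r.
exact: sum_bound.
Qed.

End ApproximateEigenvector.

Lemma gen_cesaro z w t : gen T z w -> 0 < t -> z - T t z = t%:C *: cesaro t w.
Proof.
move=> gz t0; have := res_gen_eq ltr01 gz; rewrite scale1r => h1.
have hz : res 1 (z + w) = z by rewrite /res opD -!/(res 1 _) h1 addrC subrK.
have := res_cesaro (z + w) ltr01 t0; rewrite hz divr1 => ->.
by congr (_ *: _); rewrite /cesaro opD addrC addKr.
Qed.

Lemma gen_dist z w t : gen T z w -> 0 <= t -> nrm (z - T t z) <= t * (M * nrm w).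
Proof.
move=> gz; rewrite le_eqVlt => /predU1P[<-|t0]; first by rewrite T0 subrr nrm0 mul0r.
by rewrite (gen_cesaro gz t0) nrmZ gtr0_norm// ler_wpM2l ?(ltW t0)// op_bound.
Qed.

Lemma gen_cesaro_dist z w t : gen T z w -> 0 < t ->
  nrm (z - cesaro t z) <= t * (M * nrm w).
Proof.
move=> gz t0; rewrite nrmB; apply: cesaro_dist => // [|s s0 st].
  by rewrite !mulr_ge0 ?nrm_ge0// ltW.
by rewrite nrmB (le_trans (gen_dist gz s0))// ler_wpM2r// mulr_ge0// nrm_ge0.
Qed.

Lemma op_comb_op (P : probability R R) s x : op P (op_comb s x) = op_comb s (op P x).
Proof.
elim: s => [|[c Q] s IH]; first by rewrite !op_comb_nil op0.
by rewrite !op_comb_cons opD opZ IH (op_comm P Q).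
Qed.

Lemma op_combC s s' x : op_comb s (op_comb s' x) = op_comb s' (op_comb s x).
Proof.
elim: s => [|[c Q] s IH].
  rewrite !op_comb_nil; elim: s' => [|[c' Q'] s' IH']; first by rewrite op_comb_nil.
  by rewrite op_comb_cons -IH' op0 scaler0 addr0.
rewrite !op_comb_cons IH op_comb_op; elim: s' {IH} => [|[c' Q'] s' IH'].
  by rewrite !op_comb_nil scaler0 addr0.
rewrite !op_comb_cons opD opZ -IH'.
by rewrite !scalerDr !scalerA mulrC addrACA.
Qed.

Lemma normc_le_parts (a b : R) : Normc.normc (a +i* b) <= `|a| + `|b|.
Proof.
rewrite /= -[leRHS]ger0_norm ?addr_ge0// -sqrtr_sqr ler_sqrt ?sqr_ge0//.
rewrite sqrrD !real_normK ?num_real// addrAC lerDl.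
by rewrite mulrn_wge0// mulr_ge0.
Qed.

Lemma normc_clog (z : R[i]) : 0 < Normc.normc z -> Normc.normc z <= 1 ->
  Normc.normc (clog z) <= 2 - ln (Normc.normc z).
Proof.
move=> z0 z1; rewrite /clog; set r := Normc.normc z; set th := atan _.
have -> : (ln r)%:C + 'i * th%:C = ln r +i* th by apply: complex_eqP => /=; ring.
apply: (le_trans (normc_le_parts _ _)).
rewrite ler0_norm ?ln_le0// addrC lerD2r ler_norml.
have := atan_ltpi2 (complex.Im z / complex.Re z); have := atan_gtNpi2 (complex.Im z / complex.Re z).
by have := @pihalf_lt2 R; rewrite -/th; lra.
Qed.

Lemma graph_eigen v : graph (op_comb ereg_comb v, op_comb elog_comb v).
Proof. exact: op_combC. Qed.

(** At t = 1/(4 M |mu|) the estimate |w| <= 2 |mu| |v| gives |v - C_t v| <= |v|/2. The factor 1/(400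
    M^4) makes every error small against |e(mu)| |v|, where |e(mu)| >= |mu|/4. Then |C_t e(A)v| >=
    |e(mu)| |v|/4, while the graph norm is at most |e(mu)| |v| (4 - ln |mu|) <= 2 |e(mu)| |v| ln t;
    this gives 8. *)
Lemma graph_witness mu v w : 0 < complex.Re mu -> gen T v w -> 0 < nrm v ->
    Normc.normc mu <= 1 ->
    nrm (mu *: v - w) <= Normc.normc mu ^+ 2 / (400 * M ^+ 4) * nrm v ->
    4 + ln (4 * M) <= ln (4 * M * Normc.normc mu)^-1 ->
  let p := (op_comb ereg_comb v, op_comb elog_comb v) in
  let t := (4 * M * Normc.normc mu)^-1 in
  0 < gnorm p /\ gnorm p <= 8 * (ln t * nrm (cesaro t p.1)).
Proof.
set r := Normc.normc mu; move=> mu0 gv v0 r1 hg hl p t.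
have Mp : 0 < M := lt_le_trans ltr01 M1.
have r0 : 0 < r := normc_gt0 mu0.
have t0 : 0 < t by rewrite invr_gt0 !mulr_gt0.
set er := M * M * (M * nrm (mu *: v - w) / r).
have her : 100 * M * er <= r / 4 * nrm v.
  rewrite /er [leLHS](_ : _ = 100 * M ^+ 4 / r * nrm (mu *: v - w)); last by ring.
  have c0 : 0 <= 100 * M ^+ 4 / r by rewrite divr_ge0 ?mulr_ge0 ?exprn_ge0// ltW.
  apply: le_trans (ler_wpM2l c0 hg) _.
  rewrite le_eqVlt; apply/orP; left; apply/eqP; field.
  by rewrite !gt_eqF.
have er0 : 0 <= er by rewrite /er !mulr_ge0 ?nrm_ge0 ?invr_ge0// ltW.
have erM : er <= M * er by rewrite ler_peMl.
have h1 := elog_approx mu0 gv; have h2 := ereg_approx mu0 gv.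
rewrite -/r -/er in h1 h2.
set e := Normc.normc (ereg mu).
have eE : r / 4 <= e.
  rewrite /e /ereg Normc.normcM Normc.normcV -/r ler_wpM2l ?(ltW r0)//.
  have d0 : 0 < Normc.normc (1 + mu).
    by apply: normc_gt0; move: mu0; case: (mu) => a b /= a0; rewrite ltr_wpDl.
  rewrite expr2 Normc.normcM lef_pV2 ?posrE ?mulr_gt0//.
  have d2 : Normc.normc (1 + mu) <= 2.
    by have := @le_normcD R (1 : R[i]) mu; rewrite Normc.normc1 -/r; move: r1; lra.
  rewrite (_ : 4 = 2 * 2 :> R); last by ring.
  by rewrite ler_pM// ltW.
have hw : nrm w <= 2 * r * nrm v.
  have : nrm w <= nrm (mu *: v) + nrm (mu *: v - w).
    by rewrite -{1}[w](subKr (mu *: v)) nrm_dist.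
  rewrite nrmZc -/r.
  have alg (x y : R) : 0 < x -> x <= 1 -> 1 <= y -> x ^+ 2 / y <= x.
    move=> x0 x1 y1; rewrite ler_pdivrMr ?(lt_le_trans ltr01)// expr2.
    by rewrite ler_wpM2l ?(ltW x0)// (le_trans x1).
  have M4 : 1 <= 400 * M ^+ 4.
    by have : 1 <= M ^+ 4 by [rewrite exprn_ege1]; lra.
  have h := le_trans hg (ler_wpM2r (nrm_ge0 v) (alg _ _ r0 r1 M4)).
  move/le_trans; apply; rewrite (_ : 2 * r * nrm v = r * nrm v + r * nrm v); last by ring.
  by rewrite lerD2l.
have hC : nrm v / 2 <= nrm (cesaro t v).
  have := gen_cesaro_dist gv t0.
  have : t * (M * nrm w) <= t * (M * (2 * r * nrm v)).
    by rewrite ler_wpM2l ?(ltW t0)// ler_wpM2l.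
  have -> : t * (M * (2 * r * nrm v)) = nrm v / 2 by rewrite /t; field; rewrite !gt_eqF.
  have : nrm v <= nrm (v - cesaro t v) + nrm (cesaro t v).
    by rewrite -{1}[v](subrK (cesaro t v)) nrmD.
  by lra.
have hP : e * nrm v / 4 <= nrm (cesaro t p.1).
  have E : cesaro t p.1 = ereg mu *: cesaro t v + cesaro t (p.1 - ereg mu *: v).
    by rewrite cesaroB cesaroZ subrKC.
  have b1 : nrm (cesaro t (p.1 - ereg mu *: v)) <= M * (20 * er).
    by rewrite (le_trans (op_bound _ _))// ler_wpM2l.
  have b2 : nrm (ereg mu *: cesaro t v) <= nrm (cesaro t p.1) + M * (20 * er).
    rewrite -[X in nrm X <= _](addrK (cesaro t (p.1 - ereg mu *: v))) -E.
    by rewrite (le_trans (nrm_dist _ _))// lerD2l.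
  rewrite nrmZc -/e in b2.
  have b3 : e * (nrm v / 2) <= e * nrm (cesaro t v).
    by rewrite ler_wpM2l// /e normc_ge0.
  have b4 : r / 4 * nrm v <= e * nrm v by rewrite ler_wpM2r ?nrm_ge0.
  by lra.
have en : 0 < e * nrm v by rewrite mulr_gt0// (lt_le_trans _ eE)// divr_gt0.
have l0 : 4 <= ln t.
  apply: le_trans hl; rewrite lerDl ln_ge0//.
  by have := M1; lra.
have gP : gnorm p <= e * nrm v * (2 * ln t).
  have b1 : nrm p.1 <= e * nrm v + 20 * er.
    rewrite -[p.1](subrK (ereg mu *: v)) addrC (le_trans (nrmD _ _))// nrmZc -/e.
    by rewrite lerD2l.
  have b2 : nrm p.2 <= e * (2 - ln r) * nrm v + 20 * er.
    rewrite -[p.2](subrK (elog mu *: v)) addrC (le_trans (nrmD _ _))//.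
    rewrite lerD// nrmZc /elog Normc.normcM -/e ler_wpM2r ?nrm_ge0//.
    by rewrite ler_wpM2l ?normc_ge0// normc_clog.
  have b3 : 40 * er <= e * nrm v.
    have b4 : r / 4 * nrm v <= e * nrm v by rewrite ler_wpM2r ?nrm_ge0.
    by lra.
  have lt : ln t = - ln (4 * M) - ln r.
    by rewrite /t lnV ?posrE ?mulr_gt0// lnM ?posrE ?mulr_gt0// opprD.
  have b5 : e * nrm v * (4 - ln r) <= e * nrm v * (2 * ln t).
    by rewrite ler_wpM2l ?(ltW en)//; rewrite lt in hl l0 *; lra.
  apply: le_trans b5; rewrite /gnorm.
  have -> : e * nrm v * (4 - ln r) = e * nrm v + e * (2 - ln r) * nrm v + e * nrm v by ring.
  by lra.
split.
  apply: (@lt_le_trans _ _ (nrm p.1)); last by rewrite /gnorm lerDl nrm_ge0.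
  rewrite lt_neqAle nrm_ge0 andbT eq_sym; apply/eqP => h.
  have : nrm (cesaro t p.1) <= M * nrm p.1 by exact: op_bound.
  rewrite h mulr0; have : 0 < e * nrm v / 4 by rewrite divr_gt0.
  by lra.
apply: (le_trans gP).
have : ln t * (e * nrm v / 4) <= ln t * nrm (cesaro t p.1) by rewrite ler_wpM2l// (le_trans _ l0).
by lra.
Qed.

Lemma graph_scale (c : R) p q : graph p -> graph q ->
  graph (p.1 + c%:C *: q.1, p.2 + c%:C *: q.2).
Proof. by rewrite /graph /= => hp hq; rewrite !op_combD !op_combZ hp hq. Qed.

Lemma nrm_pm (u v : X) : nrm v <= nrm (u + v) \/ nrm v <= nrm (u - v).
Proof.
have h : 2 * nrm v <= nrm (u + v) + nrm (u - v).
  rewrite -[2]ger0_norm// -nrmZ (_ : 2%:C *: v = (u + v) - (u - v)) ?nrm_dist//.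
  by rewrite rmorphD /= rmorph1 scalerDl scale1r opprB [RHS]addrC addrA subrK.
by have [h1|h1] := leP (nrm v) (nrm (u + v)); [left|right; lra].
Qed.

(** Chosen so that 1 - q = 32 K q. Then K times the tail bound 2 q^(n+1)/(1 - q) is q^n/16, half of
    the q^n/8 that the term of index n guarantees. *)
Definition hump_ratio (K : R) : R := (1 + 32 * K)^-1.

Lemma hump_ratio_itv K : 0 < K -> 0 < hump_ratio K < 1.
Proof.
by move=> K0; rewrite invr_gt0 invf_lt1 ?ltrDl ?addr_gt0 ?mulr_gt0.
Qed.

(** * The gliding hump in the graph of log A *)

Section GlidingHump.
Variables (K : R) (d : nat -> X * X) (tt : nat -> R).
Hypothesis K0 : 0 < K.
Hypothesis d_graph : forall n, graph (d n).
Hypothesis d_norm : forall n, gnorm (d n) = 1.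
Local Notation q := (hump_ratio K).

Let q01 := hump_ratio_itv K0.
Let qX (n : nat) : 0 < q ^+ n. Proof. by rewrite exprn_gt0//; case/andP: q01. Qed.

(* The sign is chosen so that the new term is not cancelled at time tt n:
   max(|p + r|, |p - r|) >= |r|. *)
Definition hump_step (n : nat) (p : X * X) : X * X :=
  let s : R := if nrm (cesaro (tt n) ((q ^+ n)%:C *: (d n).1)) <=
    nrm (cesaro (tt n) (p.1 + (q ^+ n)%:C *: (d n).1)) then 1 else -1 in
  (p.1 + (s * q ^+ n)%:C *: (d n).1, p.2 + (s * q ^+ n)%:C *: (d n).2).

Fixpoint hump (n : nat) : X * X := if n is m.+1 then hump_step m (hump m) else (0, 0).

Lemma hump_graph n : graph (hump n).
Proof.
elim: n => [|n IH]; first by rewrite /graph /= !op_comb_0.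
exact: graph_scale.
Qed.

Lemma hump_lower n : q ^+ n * nrm (cesaro (tt n) (d n).1) <= nrm (cesaro (tt n) (hump n.+1).1).
Proof.
have E : q ^+ n * nrm (cesaro (tt n) (d n).1) = nrm (cesaro (tt n) ((q ^+ n)%:C *: (d n).1)).
  by rewrite cesaroZ nrmZ gtr0_norm.
rewrite E /= /hump_step /=; case: ifP => [h|/negbT h]; first by rewrite mul1r.
have [h1|h1] := nrm_pm (cesaro (tt n) (hump n).1) (cesaro (tt n) ((q ^+ n)%:C *: (d n).1)).
  by move: h; rewrite /cesaro opD; move: h1; rewrite /cesaro => ->.
by rewrite mulN1r rmorphN scaleNr cesaroB.
Qed.

(** Both components are geometric series; the limit stays in the graph by closedness. *)
Lemma hump_limit : exists2 p, graph p &
  forall n, gnorm (p.1 - (hump n).1, p.2 - (hump n).2) <= 2 / (1 - q) * q ^+ n.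
Proof.
have inc (a : R) (v w : X) n : nrm w <= 1 -> `|a| = 1 ->
    nrm (v + (a * q ^+ n)%:C *: w - v) <= 1 * q ^+ n.
  by move=> w1 a1; rewrite addrC addKr nrmZ normrM a1 !mul1r gtr0_norm// ler_piMr// ltW.
have sg (b : bool) : `|if b then 1 else -1 : R| = 1 by case: b; rewrite ?normrN normr1.
have [l1 h1] : exists l, forall n, nrm (l - (hump n).1) <= 1 / (1 - q) * q ^+ n.
  apply: geometric_limit => // n; apply: inc => //.
  by rewrite -(d_norm n) /gnorm lerDl nrm_ge0.
have [l2 h2] : exists l, forall n, nrm (l - (hump n).2) <= 1 / (1 - q) * q ^+ n.
  apply: geometric_limit => // n; apply: inc => //.
  by rewrite -(d_norm n) /gnorm lerDr nrm_ge0.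
exists (l1, l2); last first.
  by move=> n; rewrite /gnorm /=; move: (h1 n) (h2 n); lra.
have [B1 B10 hB1] := op_comb_bound elog_comb; have [B2 B20 hB2] := op_comb_bound ereg_comb.
rewrite /graph /=; apply/eqP; rewrite -subr_eq0; apply/eqP.
apply: (@nrm_small _ (B1 * (1 / (1 - q)) + B2 * (1 / (1 - q)))) => e e0.
have [m hm] := geometric_small q01 e0.
have -> : op_comb elog_comb l1 - op_comb ereg_comb l2 =
    op_comb elog_comb (l1 - (hump m).1) - op_comb ereg_comb (l2 - (hump m).2).
  by rewrite !op_combB (hump_graph m) opprB addrA subrK.
have q2 : 0 <= 1 / (1 - q) by rewrite divr_ge0// subr_ge0 ltW//; case/andP: q01.
have step B (v : X) : 0 <= B -> nrm v <= 1 / (1 - q) * q ^+ m -> B * nrm v <= B * (1 / (1 - q)) * e.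
  move=> B0 hv; rewrite -mulrA ler_wpM2l// (le_trans hv)// ler_wpM2l//; exact: ltW.
rewrite (le_trans (nrm_dist _ _))// mulrDl lerD//.
  exact: le_trans (hB1 _) (step _ _ B10 (h1 m)).
exact: le_trans (hB2 _) (step _ _ B20 (h2 m)).
Qed.

End GlidingHump.

Lemma hump_unbounded (eps : R -> R) K : 0 < K ->
  (forall p, graph p -> forall t, 2 <= t -> nrm (cesaro t p.1) <= K * gnorm p / ln t) ->
  (forall t, 0 < t -> 0 < eps t) -> eps @ +oo --> 0 ->
  (forall t0, exists t p, [/\ t0 <= t, graph p, 0 < gnorm p &
    gnorm p <= 8 * (ln t * nrm (cesaro t p.1))]) ->
  exists2 p, graph p & forall B, exists2 t, 2 <= t & B < ln t / eps t * nrm (cesaro t p.1).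
Proof.
move=> K0 hK eps0 epsl hex; set q := hump_ratio K.
have /andP[q0 q1] : 0 < q < 1 := hump_ratio_itv K0.
have qX (n : nat) : 0 < q ^+ n by exact: exprn_gt0.
have qK : K * (2 / (1 - q) * q) = 16^-1.
  have -> : 1 - q = 32 * K * q.
    by rewrite /q /hump_ratio; field; rewrite gt_eqF// addr_gt0// mulr_gt0.
  by field; rewrite !gt_eqF.
(* The ratio q is fixed by K beforehand, so the time can be taken so late that eps is below
   q^n/(16(n+1)); what survives of the hump, q^n/16, is then at least n+1 times eps. *)
have hn (n : nat) : exists tp : R * (X * X), [/\ 2 <= tp.1, graph tp.2, gnorm tp.2 = 1,
    1 <= 8 * (ln tp.1 * nrm (cesaro tp.1 tp.2.1)) & eps tp.1 <= q ^+ n / (16 * n.+1%:R)].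
  have e0 : 0 < q ^+ n / (16 * n.+1%:R) by rewrite divr_gt0// mulr_gt0.
  have [t1 [_ ht1]] := (cvgrPdist_lt _ _).1 epsl _ e0.
  have [t [p [tt gp p0 hp]]] := hex (Num.max 2 (t1 + 1)).
  move: tt; rewrite ge_max => /andP[t2 tt1].
  exists (t, ((gnorm p)^-1%:C *: p.1, (gnorm p)^-1%:C *: p.2)); split => //=.
  - by rewrite /graph /= !op_combZ gp.
  - by rewrite /gnorm /= !nrmZ -mulrDr -/(gnorm p) gtr0_norm ?invr_gt0// mulVf// gt_eqF.
  - rewrite cesaroZ nrmZ gtr0_norm ?invr_gt0//.
    move: (nrm (cesaro t p.1)) hp => c hp.
    have -> : 8 * (ln t * ((gnorm p)^-1 * c)) = (gnorm p)^-1 * (8 * (ln t * c)) by ring.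
    by rewrite ler_pdivlMl// mulr1.
  - have tp : 0 < t by apply: lt_le_trans t2.
    have := ht1 t; rewrite /= sub0r normrN gtr0_norm ?eps0//.
    by move=> h; apply/ltW/h; apply: lt_le_trans tt1; rewrite ltrDl.
have [f hf] := @choice _ _ (fun n tp => _) hn.
pose d n := (f n).2; pose tt n := (f n).1.
have dg n : graph (d n) by case: (hf n).
have dn n : gnorm (d n) = 1 by case: (hf n).
have [p gp hp] := hump_limit tt K0 dg dn.
exists p => // B; pose n := Num.truncn `|B|.
have [t2 _ _ h8 he] := hf n; rewrite -/(tt n) in t2 h8 he; exists (tt n) => //.
set t := tt n in t2 h8 he *.
have tp : 0 < t by apply: lt_le_trans t2.
have l0 : 0 < ln t by rewrite ln_gt0// (lt_le_trans _ t2)// ltr1n.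
have Bn : B < n.+1%:R.
  apply: le_lt_trans (ler_norm B) _.
  by have /andP[] := truncn_itv (normr_ge0 B).
have low := hump_lower d tt K0 n.
set h := hump K d tt n.+1 in low.
have gph : graph (p.1 - h.1, p.2 - h.2).
  have := graph_scale (-1) gp (hump_graph K tt dg n.+1).
  by rewrite rmorphN1 !scaleN1r.
have up : nrm (cesaro t (p.1 - h.1)) <= q ^+ n / 16 / ln t.
  apply: le_trans (hK _ gph _ t2) _.
  rewrite ler_pM2r ?invr_gt0// -qK.
  have := ler_wpM2l (ltW K0) (hp n.+1); rewrite -/h -/q exprS.
  by move=> h1; apply: le_trans h1 _; rewrite le_eqVlt; apply/orP; left; apply/eqP; ring.
have main : q ^+ n / 16 <= ln t * nrm (cesaro t p.1).
  have k1 : nrm (cesaro t h.1) <= nrm (cesaro t p.1) + nrm (cesaro t (p.1 - h.1)).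
    have -> : cesaro t h.1 = cesaro t p.1 - cesaro t (p.1 - h.1).
      by rewrite cesaroB opprB subrKC.
    exact: nrm_dist.
  have k2 : ln t * nrm (cesaro t (p.1 - h.1)) <= q ^+ n / 16.
    by rewrite mulrC -ler_pdivlMr.
  have k3 : ln t * (q ^+ n * nrm (cesaro t (d n).1)) <= ln t * nrm (cesaro t h.1).
    by rewrite ler_wpM2l// ltW.
  have k4 : ln t * nrm (cesaro t h.1) <= ln t * (nrm (cesaro t p.1) + nrm (cesaro t (p.1 - h.1))).
    by rewrite ler_wpM2l// ltW.
  have k5 := ler_wpM2l (ltW (qX n)) h8; rewrite -/(d n) in k5.
  move: k2 k3 k4 k5; rewrite mulrDr mulr1 mulrCA.
  move: (nrm (cesaro t (d n).1)) (nrm (cesaro t h.1)) (nrm (cesaro t p.1)) (nrm (cesaro t (p.1 - h.1))).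
  by move=> a1 a2 a3 a4 *; nra.
apply: lt_le_trans Bn _.
have ep : 0 < eps t := eps0 _ tp.
rewrite mulrAC ler_pdivlMr//; apply: le_trans main.
move: he; rewrite ler_pdivlMr ?mulr_gt0// ler_pdivlMr//.
by rewrite (_ : eps t * (16 * n.+1%:R) = n.+1%:R * eps t * 16)//; ring.
Qed.

(** * Linearity of the generator and continuation of surjectivity *)

Lemma gen_lin (a : R[i]) z1 w1 z2 w2 : gen T z1 w1 -> gen T z2 w2 ->
  gen T (a *: z1 + z2) (a *: w1 + w2).
Proof.
rewrite /gen => h1 h2.
rewrite (_ : (fun t : R => _) = (fun t : R => a *: ((t^-1)%:C *: (z1 - T t z1)) +
  (t^-1)%:C *: (z2 - T t z2))); first by apply: cvgD => //; exact: cvgZr.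
apply/funext => t; rewrite T_linear opprD addrACA -scalerBr scalerDr.
by rewrite !scalerA mulrC.
Qed.

Lemma genB z1 w1 z2 w2 : gen T z1 w1 -> gen T z2 w2 -> gen T (z1 - z2) (w1 - w2).
Proof. by move=> h1 h2; have := gen_lin (a := -1) h2 h1; rewrite !scaleN1r !(addrC (- _)). Qed.

Lemma gen0 : gen T 0 0.
Proof. by apply: gen_fixed => t _; exact: T_lin0. Qed.

Lemma genZ (a : R[i]) z w : gen T z w -> gen T (a *: z) (a *: w).
Proof. by move=> h; have := gen_lin (a := a) h gen0; rewrite !addr0. Qed.

Definition range_all (mu : R[i]) := forall y, exists x u, gen T x u /\ mu *: x - u = y.

Definition bounded_below (e : R) (mu : R[i]) :=
  forall x u, gen T x u -> e * nrm x <= nrm (mu *: x - u).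

Lemma range_all_neg (eta : R) : 0 < eta -> range_all (- eta)%:C.
Proof.
move=> e0 y; have ei : 0 < eta^-1 by rewrite invr_gt0.
have := genZ (a := (- eta^-1)%:C) (gen_res (x := y) ei); rewrite invrK => h.
eexists; eexists; split; first exact: h.
rewrite !scalerA -!rmorphM /= !mulrNN mulNr mulfV ?mulVf ?gt_eqF//.
by rewrite scale1r rmorphN1 scaleN1r opprK subrKC.
Qed.

Lemma bounded_below_neg (eta : R) : 0 < eta -> bounded_below (eta / M) (- eta)%:C.
Proof.
move=> e0 x u gx; have ei : 0 < eta^-1 by rewrite invr_gt0.
have Mp : 0 < M := lt_le_trans ltr01 M1.
have E : x = res eta^-1 (- (eta^-1%:C *: ((- eta)%:C *: x - u))).
  have := res_gen_eq ei gx; rewrite -resZ => h.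
  rewrite scalerBr scalerA -rmorphM /= mulrN mulVf ?gt_eqF// rmorphN1 scaleN1r opprB.
  by rewrite opprK /res opD -!/(res _ _) h subrK.
have := res_bound eta^-1 (- (eta^-1%:C *: ((- eta)%:C *: x - u))).
rewrite -E nrmN nrmZ gtr0_norm// => h.
by rewrite mulrAC ler_pdivrMr// -ler_pdivlMl// (le_trans h)// mulrCA (mulrC M).
Qed.

Lemma fixed_point (f : X -> X) : (forall x y, 2 * nrm (f x - f y) <= nrm (x - y)) ->
  exists x, f x = x.
Proof.
move=> hf; pose x n := iter n f 0; set q : R := 2^-1.
have q01 : 0 < q < 1 by rewrite /q invr_gt0 invf_lt1// ltr1n ltr0n.
have inc n : nrm (x n.+1 - x n) <= nrm (f 0) * q ^+ n.
  elim: n => [|n IH]; first by rewrite /x /= subr0 expr0 mulr1.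
  have := hf (x n.+1) (x n); rewrite exprS -/(x n.+2) /q; move: IH.
  change (f (x n)) with (x n.+1); change (f (x n.+1)) with (x n.+2).
  by rewrite /q; move: (nrm _) (nrm _) (nrm _) (_ ^+ n) => *; lra.
have [l hl] := geometric_limit q01 (nrm_ge0 _) inc; exists l.
apply/eqP; rewrite -subr_eq0; apply/eqP; set C := _ / _ in hl.
have C0 : 0 <= C by apply: le_trans (nrm_ge0 _) (le_trans (hl 0%N) _); rewrite expr0 mulr1.
apply: (@nrm_small _ C) => e e0; have [n hn] := geometric_small q01 e0.
have := hf l (x n); have h := nrmD (f l - x n.+1) (x n.+1 - l).
rewrite subrKA (nrmB (x n.+1)) in h; change (f (x n)) with (x n.+1).
have k1 := hl n; have := hl n.+1; rewrite exprS; have k2 := ler_wpM2l C0 (ltW hn).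
have k3 : C * (q * q ^+ n) = q * (C * q ^+ n) by ring.
rewrite k3 /q; move: h k1 k2; rewrite /q.
by move: (C * e) (C * _) (nrm _) (nrm _) (nrm _) (nrm _) => *; lra.
Qed.

(** The right inverse [R0] of mu0 - A comes from choice. The lower bound makes it Lipschitz with
    constant 1/e, so x -> R0 (y - (mu - mu0) x) contracts by 1/2, and its fixed point solves (mu -
    A) x = y. *)
Lemma neumann e mu0 mu : 0 < e -> bounded_below e mu0 -> range_all mu0 ->
  Normc.normc (mu - mu0) <= e / 2 -> range_all mu.
Proof.
move=> e0 lo ra dm y.
have [R0 hR] := choice ra.
have gR v : exists u, gen T (R0 v) u /\ mu0 *: R0 v - u = v by exact: hR.
have [|x hx] := @fixed_point (fun x => R0 (y - (mu - mu0) *: x)).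
  move=> x1 x2; have [u1 [g1 e1]] := gR (y - (mu - mu0) *: x1).
  have [u2 [g2 e2]] := gR (y - (mu - mu0) *: x2).
  have := lo _ _ (genB g1 g2).
  rewrite (_ : mu0 *: _ - (u1 - u2) = (mu0 *: R0 (y - (mu - mu0) *: x1) - u1) -
    (mu0 *: R0 (y - (mu - mu0) *: x2) - u2)); last first.
    by rewrite scalerBr !opprD !opprK addrACA.
  rewrite e1 e2 (_ : y - _ - _ = (mu - mu0) *: (x2 - x1)); last first.
    by rewrite scalerBr opprB addrC addrA subrK.
  rewrite nrmZc (nrmB x2) => h; rewrite -(ler_pM2l e0) mulrCA.
  have := ler_wpM2r (nrm_ge0 (x1 - x2)) dm.
  by move: h; lra.
have [u [g1 e1]] := gR (y - (mu - mu0) *: x); rewrite hx in g1 e1.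
exists x, u; split=> //.
by rewrite -[mu](subrK mu0) scalerDl -addrA e1 subrKC.
Qed.

(** The lower bound is uniform along the segment, so finitely many Neumann steps suffice: a step e/4
    in the parameter moves the point by at most e/2, because |d| <= 2. *)
Lemma range_all_path e (lam d : R[i]) (t1 : R) : 0 < e -> 0 <= t1 ->
  Normc.normc d <= 2 ->
  (forall t : R, 0 <= t -> t <= t1 -> bounded_below e (lam + t%:C * d)) ->
  range_all (lam + t1%:C * d) -> range_all lam.
Proof.
move=> e0 t10 d2 lo ra.
pose s (n : nat) := Num.max (t1 - n%:R * (e / 4)) 0.
have s0 n : 0 <= s n by rewrite /s le_max lexx orbT.
have s1 n : s n <= t1.
  by rewrite /s ge_max t10 andbT gerBl mulr_ge0// divr_ge0// ltW.
have step n : range_all (lam + (s n)%:C * d).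
  elim: n => [|n IH]; first by rewrite /s mul0r subr0 max_l.
  apply: neumann (lo _ (s0 n) (s1 n)) IH _ => //.
  rewrite opprD addrACA subrr add0r -mulrBl Normc.normcM -rmorphB.
  rewrite normc_real.
  have h : `|s n.+1 - s n| <= e / 4.
    have e4 : 0 < e / 4 by rewrite divr_gt0.
    rewrite /s -natr1 mulrDl mul1r; move: (n%:R * (e / 4)) => c.
    by rewrite ler_norml /Order.max; case: ifP; case: ifP; move: e4; rewrite !ltNge => *; lra.
  have := ler_pM (normr_ge0 _) (normc_ge0 d) h d2.
  by rewrite (_ : e / 4 * 2 = e / 2)//; field.
have := step (Num.truncn (t1 / (e / 4))).+1; rewrite /s max_r.
  by rewrite mul0r addr0.
have e4 : 0 < e / 4 by rewrite divr_gt0.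
rewrite subr_le0 -ler_pdivrMr//.
by have /andP[_ /ltW] := truncn_itv (divr_ge0 t10 (ltW e4)).
Qed.

(** * The three assertions for Cesaro means *)

Lemma cesaro_mean_bigO x : gen_injective T -> dom_log T x ->
  exists K, forall t, 2 <= t -> nrm (cesaro_mean T t x) <= K / ln t.
Proof.
move=> hinj /dom_logE[u hu]; have [K K0 hK] := cesaro_graph_bound hinj.
exists (K * gnorm (x, u)) => t t2.
rewrite cesaro_meanE ?(lt_le_trans _ t2)//.
exact: (hK (x, u) hu t t2).
Qed.

Lemma cesaro_mean_littleo x e : gen_injective T -> closure (gen_range T) = setT ->
  dom_log T x -> 0 < e ->
  exists2 t0, 1 < t0 & forall t, t0 <= t -> nrm (cesaro_mean T t x) <= e / ln t.
Proof.
move=> hinj dense /dom_logE[u hu] e0.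
have [t0 t1 h] := cesaro_littleo (high_identity hu) hinj dense e0.
exists t0 => // t tt; rewrite cesaro_meanE; first exact: h.
exact: lt_trans ltr01 (lt_le_trans t1 tt).
Qed.

(* r is chosen before e, so that e may be taken small compared with mu. *)
Definition approximate_eigenvalues := forall r0 : R, 0 < r0 -> exists2 r, 0 < r <= r0 &
  forall e, 0 < e -> exists mu v w, [/\ 0 < complex.Re mu, r / 4 <= Normc.normc mu <= 5 * r,
    gen T v w, 0 < nrm v & nrm (mu *: v - w) <= e * nrm v].

Lemma cesaro_mean_optimal (eps : R -> R) : gen_injective T -> approximate_eigenvalues ->
  (forall t, 0 < t -> 0 < eps t) -> eps @ +oo --> 0 ->
  exists2 y, dom_log T y &
    forall B, exists2 t, 2 <= t & B < ln t / eps t * nrm (cesaro_mean T t y).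
Proof.
move=> hinj heig eps0 epsl; have [K K0 hK] := cesaro_graph_bound hinj.
have Mp : 0 < M := lt_le_trans ltr01 M1.
suff hex t0 : exists t p, [/\ t0 <= t, graph p, 0 < gnorm p &
    gnorm p <= 8 * (ln t * nrm (cesaro t p.1))].
  have [p gp hp] := hump_unbounded K0 hK eps0 epsl hex.
  exists p.1; first by apply/dom_logE; exists p.2.
  move=> B; have [t t2 ht] := hp B; exists t => //.
  by rewrite cesaro_meanE// (lt_le_trans _ t2).
pose C := Num.max t0 (expR (4 + ln (4 * M))).
have C0 : 0 < C by rewrite lt_max expR_gt0 orbT.
(* As |mu| <= 5 r, the first bound gives |mu| <= 1 and the second puts the time 1/(4 M |mu|) beyond
   C. *)
have r00 : 0 < Num.min (1 / 5) (20 * M * C)^-1.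
  by rewrite lt_min divr_gt0// invr_gt0 !mulr_gt0.
have [r /andP[r0]] := heig _ r00; rewrite le_min => /andP[r5 rC] he.
have e0 : 0 < (r / 4) ^+ 2 / (400 * M ^+ 4).
  exact: (divr_gt0 (exprn_gt0 _ (divr_gt0 r0 (ltr0n R 4))) (mulr_gt0 (ltr0n R 400) (exprn_gt0 _ Mp))).
have [mu [v [w [mu0 /andP[m1 m2] gvw v0 hv]]]] := he _ e0.
have mp : 0 < Normc.normc mu by apply: lt_le_trans m1; rewrite divr_gt0.
have Ct : C <= (4 * M * Normc.normc mu)^-1.
  rewrite -[C]invrK lef_pV2 ?posrE ?invr_gt0 ?mulr_gt0//.
  apply: (@le_trans _ _ (4 * M * (5 * (20 * M * C)^-1))).
    rewrite ler_pM2l ?mulr_gt0//; apply: le_trans m2 _.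
    by rewrite ler_pM2l.
  by rewrite le_eqVlt; apply/orP; left; apply/eqP; field; rewrite !gt_eqF.
have hm1 : Normc.normc mu <= 1.
  by apply: (le_trans m2); rewrite mulrC -ler_pdivlMr.
have hsmall : nrm (mu *: v - w) <= Normc.normc mu ^+ 2 / (400 * M ^+ 4) * nrm v.
  apply: (le_trans hv); apply: ler_wpM2r; first exact: nrm_ge0.
  apply: ler_wpM2r; first (rewrite invr_ge0; exact: (ltW (mulr_gt0 (ltr0n R 400) (exprn_gt0 4 Mp)))).
  by rewrite lerXn2r ?nnegrE// ?divr_ge0 ?normc_ge0// ltW.
have hl : 4 + ln (4 * M) <= ln (4 * M * Normc.normc mu)^-1.
  rewrite -[leLHS]expRK ler_ln ?posrE ?expR_gt0 ?invr_gt0 ?mulr_gt0//.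
  by apply: le_trans Ct; rewrite /C le_max lexx orbT.
have [g1 g2] := graph_witness mu0 gvw v0 hm1 hsmall hl.
exists (4 * M * Normc.normc mu)^-1.
exists (op_comb ereg_comb v, op_comb elog_comb v).
split=> //; last exact: graph_eigen.
by apply: le_trans Ct; rewrite /C le_max lexx.
Qed.

End Semigroup.

(** * From the spectrum near 0 to approximate eigenvectors *)

Section Rotation.
Context {R : realType} {X : completeNormedModType R[i]}.
Implicit Types (T : R -> X -> X).

Definition rot (x : R) : R[i] := cos x +i* sin x.

(* The rotated semigroup exp(i b s) T(s), generated by -(A - i b). *)
Definition rotate (b : R) T (s : R) (x : X) : X := rot (b * s) *: T s x.

Lemma rot0 : rot 0 = 1.
Proof. by rewrite /rot cos0 sin0. Qed.

Lemma rotD x y : rot (x + y) = rot x * rot y.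
Proof. by rewrite /rot cosD sinD; apply: complex_eqP => /=; ring. Qed.

Lemma normc_rot x : Normc.normc (rot x) = 1.
Proof. by rewrite /= cos2Dsin2 sqrtr1. Qed.

Lemma rotateK b T : rotate (- b) (rotate b T) = T.
Proof.
apply/funext => s; apply/funext => x.
by rewrite /rotate scalerA -rotD mulNr addNr rot0 scale1r.
Qed.

Lemma cvg_realZ {I : Type} {F : set_system I} {FF : Filter F} (a : I -> R) (l : R)
  (y : I -> X) (v : X) :
  a @ F --> l -> y @ F --> v -> (fun i => (a i)%:C *: y i) @ F --> l%:C *: v.
Proof.
move=> /cvgrPdist_lt ha hy; apply: (cvgZ _ hy).
apply/cvgrPdist_lt => -[e e'] /=.
rewrite ltcE /= => /andP[/eqP -> e0]; apply: filterS (ha _ e0) => i.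
by rewrite -rmorphB normc_def /= expr0n addr0 sqrtr_sqr -[(_ +i* 0)]/(e%:C) ltcR.
Qed.

Lemma derive_at_right (f : R -> R) df : is_derive (0 : R) 1 f df -> f 0 = 0 ->
  (fun t => t^-1 * f t) @ 0^'+ --> df.
Proof.
move=> [hd hv] f0; apply: cvg_dnbhs_at_right.
have E : (fun h : R => h^-1 *: ((f \o shift 0) (h *: 1) - f 0)) = (fun t : R => t^-1 * f t).
  by apply/funext => t; rewrite /= addr0 f0 subr0 /GRing.scale /= mulr1.
by move: hd; rewrite /derivable -hv /derive E.
Qed.

Lemma cvg_cos_right (b : R) : (fun t => cos (b * t)) @ 0^'+ --> (1 : R).
Proof.
apply: cvg_at_right_filter; rewrite -[X in _ --> X](_ : cos (b * 0) = 1); last by rewrite mulr0 cos0.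
apply: continuous_comp; last exact: continuous_cos.
by apply: cvgM; [exact: cvg_cst|exact: cvg_id].
Qed.

Lemma cvg_sin_right (b : R) : (fun t => sin (b * t)) @ 0^'+ --> (0 : R).
Proof.
apply: cvg_at_right_filter; rewrite -[X in _ --> X](_ : sin (b * 0) = 0); last by rewrite mulr0 sin0.
apply: continuous_comp; last exact: continuous_sin.
by apply: cvgM; [exact: cvg_cst|exact: cvg_id].
Qed.

(** Product rule at 0: the difference quotient of the rotated orbit is split into that of T and
    those of cos and sin. *)
Lemma gen_rotate b T z w : gen T z w -> gen (rotate b T) z (w - (0 +i* b) *: z).
Proof.
rewrite /gen => h.
have dc : (fun t => t^-1 * (cos (b * t) - 1)) @ 0^'+ --> (0 : R).
  apply: derive_at_right; last by rewrite mulr0 cos0 subrr.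
  by apply: is_derive_eq; rewrite mulr0 sin0 /GRing.scale /=; ring.
have ds : (fun t => t^-1 * sin (b * t)) @ 0^'+ --> b.
  apply: derive_at_right; last by rewrite mulr0 sin0.
  by apply: is_derive_eq; rewrite mulr0 cos0 /GRing.scale /=; ring.
have cc := cvg_cos_right b; have cs := cvg_sin_right b.
pose p t := (t^-1)%:C *: (z - T t z).
have hp : p @ 0^'+ --> w by exact: h.
rewrite (_ : (fun t : R => _) = (fun t : R => (cos (b * t))%:C *: p t +
   (sin (b * t))%:C *: ('i *: p t) - (t^-1 * (cos (b * t) - 1))%:C *: z -
   (t^-1 * sin (b * t))%:C *: ('i *: z))).
  have -> : w - (0 +i* b) *: z = 1%:C *: w + 0%:C *: ('i *: w) - 0%:C *: z - b%:C *: ('i *: z).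
    rewrite !scale0r scale1r addr0 subr0 scalerA; congr (_ - _ *: _).
    by apply: complex_eqP => /=; ring.
  apply: cvgB; last by apply: cvg_realZ => //; exact: cvg_cst.
  apply: cvgB; last by apply: cvg_realZ => //; exact: cvg_cst.
  apply: cvgD; first exact: cvg_realZ.
  by apply: cvg_realZ => //; exact: cvgZr.
apply/funext => t; rewrite /rotate /p.
set c := cos _; set s := sin _.
move: (T t z) t^-1 => y k.
have E (x1 x2 x3 x4 : R[i]) : x1 *: z - x1 *: y + (x2 *: z - x2 *: y) - x3 *: z - x4 *: z =
    (x1 + x2 - x3 - x4) *: z - (x1 + x2) *: y.
  rewrite addrACA -opprD -!scalerDl -addrA -opprD -scalerDl addrAC -scalerBl.
  by rewrite opprD addrA.
rewrite !scalerA !scalerBr !scalerA E.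
by rewrite /rot -/c -/s; congr (_ *: _ - _ *: _); apply: complex_eqP => /=; ring.
Qed.

End Rotation.

Section ApproximateEigenvalues.
Context {R : realType} {X : completeNormedModType R[i]}.
Variables (T : R -> X -> X) (M : R).
Hypothesis M1 : 1 <= M.
Hypothesis T_linear : forall s (a : R[i]) (u v : X), T s (a *: u + v) = a *: T s u + T s v.
Hypothesis T0 : forall x, T 0 x = x.
Hypothesis TD : forall s t, 0 <= s -> 0 <= t -> forall x, T (s + t) x = T s (T t x).
Hypothesis T_cont0 : forall x, (fun s => T s x) @ 0^'+ --> x.
Hypothesis T_bound : forall s, 0 <= s -> forall x, nrm (T s x) <= M * nrm x.

Let Mp : 0 < M. Proof. exact: lt_le_trans M1. Qed.

Lemma rotate_linear b s (a : R[i]) (u v : X) :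
  rotate b T s (a *: u + v) = a *: rotate b T s u + rotate b T s v.
Proof. by rewrite /rotate T_linear scalerDr !scalerA mulrC. Qed.

Lemma rotate_0 b x : rotate b T 0 x = x.
Proof. by rewrite /rotate mulr0 rot0 scale1r T0. Qed.

Lemma rotate_D b s t : 0 <= s -> 0 <= t ->
  forall x, rotate b T (s + t) x = rotate b T s (rotate b T t x).
Proof.
move=> s0 t0 x; rewrite /rotate TD// mulrDr rotD -scalerA; congr (_ *: _).
have h := T_linear s (rot (b * t)) (T t x) 0.
have z : T s 0 = 0 by have := T_linear s (-1) 0 0; rewrite scaler0 addr0 scaleN1r addNr.
by move: h; rewrite addr0 z addr0.
Qed.

Lemma rotate_bound b s : 0 <= s -> forall x, nrm (rotate b T s x) <= M * nrm x.
Proof. by move=> s0 x; rewrite /rotate nrmZc normc_rot mul1r T_bound. Qed.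

Lemma rotate_cont0 b x : (fun s => rotate b T s x) @ 0^'+ --> x.
Proof.
rewrite (_ : (fun s => _) = fun s => (cos (b * s))%:C *: T s x + (sin (b * s))%:C *: ('i *: T s x)).
  rewrite -[X in _ --> X]addr0 -[X in X + _]scale1r -[X in _ + X](scale0r ('i *: x)).
  apply: cvgD; apply: cvg_realZ.
  - exact: cvg_cos_right.
  - exact: T_cont0.
  - exact: cvg_sin_right.
  - by apply: cvgZr; exact: T_cont0.
apply/funext => s; rewrite /rotate scalerA -scalerDl; congr (_ *: _).
by apply: complex_eqP => /=; ring.
Qed.

(** The vertical shift by ib is absorbed in a rotation of the semigroup, which keeps the bound M;
    only the negative half-line remains. *)
Lemma range_all_left (eta b : R) : 0 < eta -> range_all T (- eta +i* b).
Proof.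
move=> e0 y; have [x [u [gx E]]] := @range_all_neg _ _ (rotate b T) M M1 (rotate_linear b)
  (rotate_0 b) (@rotate_D b) (rotate_cont0 b) (@rotate_bound b) eta e0 y.
have := gen_rotate (b := - b) gx; rewrite rotateK => h.
exists x; eexists; split; first exact: h.
rewrite -E opprB addrA -scalerDl; congr (_ *: _ - _).
by apply: complex_eqP => /=; ring.
Qed.

Lemma bounded_below_left (eta b : R) : 0 < eta -> bounded_below T (eta / M) (- eta +i* b).
Proof.
move=> e0 x u gx; have gr := gen_rotate (b := b) gx.
have := @bounded_below_neg _ _ (rotate b T) M M1 (rotate_linear b)
  (rotate_0 b) (@rotate_D b) (rotate_cont0 b) (@rotate_bound b) eta e0 _ _ gr.
rewrite opprB addrA -scalerDl => h; apply: le_trans h _.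
rewrite (_ : (- eta)%:C + (0 +i* b) = - eta +i* b)//.
by apply: complex_eqP => /=; rewrite ?addr0 ?add0r.
Qed.

Lemma in_resolventI e mu : 0 < e -> bounded_below T e mu -> range_all T mu ->
  in_resolvent T mu.
Proof.
move=> e0 lo ra; split=> //; exists e^-1 => x u gx.
have := lo x u gx; rewrite !nrmE -rmorphM /= lecR => h.
by rewrite ler_pdivlMl.
Qed.

Lemma spectrum_Re_ge0 mu : spectrum T mu -> 0 <= complex.Re mu.
Proof.
case: mu => a b sp /=; rewrite leNgt; apply/negP => a0; apply: sp.
have e0 : 0 < - a by rewrite oppr_gt0.
have := range_all_left b e0; have := bounded_below_left b e0; rewrite opprK.
by apply: in_resolventI; rewrite divr_gt0.
Qed.

(* Follow the half-line lam + t (-1 +i* +-1) into the left half-plane, where the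
   resolvent exists. If mu - A were uniformly bounded below along it, Neumann
   steps would bring the resolvent back to lam; the offending point is then moved
   slightly to the right to make its real part positive. *)
Lemma spectrum_approximate lam e : spectrum T lam -> lam != 0 -> 0 < e ->
  let r := Normc.normc lam in
  exists mu v w, [/\ 0 < complex.Re mu, r / 4 <= Normc.normc mu <= 5 * r,
    gen T v w, 0 < nrm v & nrm (mu *: v - w) <= e * nrm v].
Proof.
move=> sp l0 e0; have := spectrum_Re_ge0 sp; case: lam sp l0 => a b sp l0 /= a0.
set r := Num.sqrt _.
have N0 : 0 < a ^+ 2 + b ^+ 2.
  rewrite lt_neqAle eq_sym addr_ge0 ?sqr_ge0// andbT.
  by rewrite paddr_eq0 ?sqr_ge0// !sqrf_eq0; move: l0; rewrite eq_complex.
have r0 : 0 < r by rewrite sqrtr_gt0.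
have r2 : r ^+ 2 = a ^+ 2 + b ^+ 2 by rewrite sqr_sqrtr// ltW.
(* The final shift (M+1) d plus the defect d must stay below both e and r/4. *)
pose d := Num.min e (r / 4) / (M + 2).
have d0 : 0 < d by rewrite divr_gt0 ?lt_min ?e0 ?divr_gt0// addr_gt0.
have M2 : 0 < M + 2 by rewrite addr_gt0.
have dE : (M + 2) * d <= e by rewrite /d mulrC divfK ?gt_eqF// ge_min lexx.
have dr : (M + 2) * d <= r / 4 by rewrite /d mulrC divfK ?gt_eqF// ge_min lexx orbT.
(* The path moves away from the real axis, |Im p(t)| = |b| + t, so that it cannot approach 0 while
   its real part changes sign. *)
pose sg : R := if 0 <= b then 1 else -1.
have sg1 : sg * sg = 1 by rewrite /sg; case: ifP => _; ring.
have sgb : sg * b = `|b|.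
  rewrite /sg; case: (leP 0 b) => b0; first by rewrite mul1r ger0_norm.
  by rewrite mulN1r ltr0_norm.
pose dir : R[i] := -1 +i* sg.
pose p (t : R) := (a +i* b) + t%:C * dir.
have pE t : p t = (a - t) +i* (b + sg * t) by apply: complex_eqP => /=; ring.
have t10 : 0 <= a + r by rewrite addr_ge0// ltW.
have [t [t0 t1 nlo]] : exists t, [/\ 0 <= t, t <= a + r & ~ bounded_below T d (p t)].
  apply: contrapT => /forallNP hall.
  have lo t : 0 <= t -> t <= a + r -> bounded_below T d (p t).
    by move=> h1 h2; apply: contrapT => h3; apply: (hall t).
  apply: sp; have lo0 := lo 0 (lexx 0) t10.
  have p0 : p 0 = a +i* b by rewrite pE subr0 mulr0 addr0.
  rewrite p0 in lo0; apply: (in_resolventI d0 lo0).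
  apply: (range_all_path T_linear d0 t10 _ lo).
    rewrite /dir /= -[leRHS]ger0_norm// -sqrtr_sqr ler_sqrt ?sqr_ge0//.
    by rewrite [sg ^+ 2]expr2 sg1; lra.
  rewrite -/(p (a + r)) pE (_ : a - (a + r) = - r); last by ring.
  exact: range_all_left.
have [v [w [gvw hvw]]] : exists v w, gen T v w /\ nrm (p t *: v - w) < d * nrm v.
  move/existsNP: nlo => [v /existsNP[w /not_implyP[gvw /negP h]]].
  by exists v, w; split=> //; rewrite ltNge.
have v0 : 0 < nrm v.
  rewrite lt_neqAle nrm_ge0 andbT eq_sym; apply/eqP => h.
  by move: hvw; rewrite h mulr0 ltNge nrm_ge0.
(* Further to the left, [bounded_below_left] would give the lower bound d that fails at p(t). *)
have reP : - (M * d) < a - t.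
  rewrite ltNge; apply/negP => h.
  have e1 : 0 < t - a by have : 0 < M * d by [rewrite mulr_gt0]; lra.
  have := bounded_below_left (b + sg * t) e1; rewrite opprB -pE => /(_ _ _ gvw) hlo.
  have := le_lt_trans hlo hvw; rewrite ltr_pM2r// ltr_pdivrMr//.
  by move: h; rewrite (mulrC d); lra.
have b0 := normr_ge0 b.
have np2 : (a - t) ^+ 2 + (b + sg * t) ^+ 2 = (a - t) ^+ 2 + (`|b| + t) ^+ 2.
  have alg (g q : R) : g * g = 1 -> (b + g * q) ^+ 2 = (g * b + q) ^+ 2.
    move=> h; have -> : g * b + q = g * (b + g * q) by rewrite mulrDr mulrA h mul1r.
    by rewrite exprMn [g ^+ 2]expr2 h mul1r.
  by rewrite -sgb (alg _ _ sg1).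
have rb : r ^+ 2 = a ^+ 2 + `|b| ^+ 2 by rewrite r2 real_normK ?num_real.
have rw : 0 <= r := ltW r0.
have ar : a <= r by rewrite -(ler_pXn2r (n := 2)) ?nnegrE// rb lerDl sqr_ge0.
have br : `|b| <= r by rewrite -(ler_pXn2r (n := 2)) ?nnegrE// rb lerDr sqr_ge0.
have low : r / 2 <= Normc.normc (p t).
  rewrite pE /= np2 -[leLHS]ger0_norm ?divr_ge0// -sqrtr_sqr ler_sqrt; last by rewrite addr_ge0 ?sqr_ge0.
  rewrite exprMn rb; have h1 : 0 <= (t - a / 2) ^+ 2 := sqr_ge0 _.
  have h2 : 0 <= `|b| * t by rewrite mulr_ge0.
  have h3 : 0 <= a ^+ 2 := sqr_ge0 _; have h4 : 0 <= `|b| ^+ 2 := sqr_ge0 _.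
  by nra.
have upp : Normc.normc (p t) <= 4 * r.
  rewrite pE /= np2 -[leRHS]ger0_norm ?mulr_ge0// -(sqrtr_sqr (4 * r)) ler_sqrt ?sqr_ge0//.
  have h1 : (a - t) ^+ 2 <= r ^+ 2.
    by rewrite -real_normK ?num_real// lerXn2r ?nnegrE ?normr_ge0// ler_norml; apply/andP; split; lra.
  have h2 : (`|b| + t) ^+ 2 <= (3 * r) ^+ 2.
    by rewrite lerXn2r ?nnegrE ?addr_ge0 ?mulr_ge0//; lra.
  by move: h1 h2; have := sqr_ge0 r; nra.
(* With Re p(t) > - M d this shift makes the real part exceed d. *)
pose x := (M + 1) * d.
have x0 : 0 <= x by rewrite mulr_ge0 ?ltW// addr_gt0.
have xd : x + d = (M + 2) * d by rewrite /x; ring.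
have nx : Normc.normc x%:C = x by rewrite normc_real ger0_norm.
have nxN : Normc.normc (- x%:C) = x by rewrite -rmorphN normc_real normrN ger0_norm.
exists (p t + x%:C), v, w; split=> //.
- by rewrite pE /= /x; move: reP d0; lra.
- apply/andP; split.
    have := @le_normcD R (p t + x%:C) (- x%:C); rewrite addrK nxN => h.
    by move: h low xd dr d0; lra.
  by have := @le_normcD R (p t) x%:C; rewrite nx; move: upp xd dr d0; lra.
- rewrite scalerDl addrAC (le_trans (nrmD _ _))//.
  rewrite nrmZ ger0_norm//.
  have : (x + d) * nrm v <= e * nrm v by rewrite ler_wpM2r ?nrm_ge0// xd.
  by move: hvw; lra.
Qed.

Lemma limit_point_approximate : zero_limit_point_spectrum T -> approximate_eigenvalues T.
Proof.
move=> hz r0 r00; have [lam [sp [l0 hl]]] := hz r0 r00.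
exists (Normc.normc lam); last by move=> e; exact: spectrum_approximate.
apply/andP; split.
  rewrite lt_neqAle normc_ge0 andbT eq_sym; apply: contra l0 => /eqP h.
  by apply/eqP; exact: Normc.eq0_normc.
by move: hl; rewrite normc_def ltcR => /ltW; case: (lam).
Qed.

End ApproximateEigenvalues.

Theorem theorem5p3 (R : realType) (X : completeNormedModType R[i])
    (T : R -> X -> X) (hT : bounded_C0_semigroup T) (hinj : gen_injective T) :
  [/\ (* (a) *)
      (forall x, dom_log T x ->
         exists M t0 : R, forall t : R, t0 <= t -> `|cesaro_mean T t x| <= (M / ln t)%:C),
      (* (b) *)
      (closure (gen_range T) = setT ->
       forall x, dom_log T x ->
         forall e : R, 0 < e ->
           exists t0 : R, forall t : R, t0 <= t -> `|cesaro_mean T t x| <= (e / ln t)%:C) &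
      (* (c) *)
      (zero_limit_point_spectrum T ->
       forall eps : R -> R,
         (forall s t, 0 < s -> s <= t -> eps t <= eps s) ->
         (forall t, 0 < t -> 0 < eps t) ->
         eps @ +oo --> 0 ->
         exists y, dom_log T y /\
           forall M : R, exists t : R, 1 <= t /\
             M%:C < (ln t / eps t)%:C * `|cesaro_mean T t y|)].
Proof.
case: hT => hl h0 hD hc [M hM].
(* M >= 1 would follow from T 0 = id only on a nonzero space, so the bound is enlarged instead. *)
have hb s : 0 <= s -> forall x, nrm (T s x) <= Num.max M 1 * nrm x.
  move=> s0 x; have := hM s s0 x; rewrite !nrmE -rmorphM /= lecR => /le_trans; apply.
  by rewrite ler_wpM2r ?nrm_ge0// le_max lexx.
have M1 : 1 <= Num.max M 1 by rewrite le_max lexx orbT.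
split.
- move=> x hx; have [K hK] := cesaro_mean_bigO M1 hl h0 hD hc hb hinj hx.
  by exists K, 2 => t t2; rewrite nrm_le; exact: hK.
- move=> dense x hx e e0.
  have [t0 _ h] := cesaro_mean_littleo M1 hl h0 hD hc hb hinj dense hx e0.
  by exists t0 => t tt; rewrite nrm_le; exact: h.
- move=> hz eps _ eps0 epsl.
  have happ := limit_point_approximate M1 hl h0 hD hc hb hz.
  have [y hy h] := cesaro_mean_optimal M1 hl h0 hD hc hb hinj happ eps0 epsl.
  exists y; split=> // B; have [t t2 ht] := h B; exists t; split.
    by apply: le_trans t2; rewrite ler1n.
  by rewrite nrmE -rmorphM /= ltcR.
Qed.
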